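(* Let $f:\mathbb{R}\to\mathbb{R}$ be a $\mathcal{C}^\infty$-function all of whose derivatives grow at most polynomially at infinity and such that $f''>0$ on $\mathbb{R}$. Let $\mu\in(0,1]$, let $p_1<p_2$ be finite real numbers, and suppose that the tempered distribution $u_0$ satisfies Condition (C1$_{[p_1,p_2],\mu}$) (see context), with regular factor $\tilde u$. Choose finite real numbers $\tilde p_1<\tilde p_2$ such that $[p_1,p_2]\subset(\tilde p_1,\tilde p_2)=:\tilde I$. Let $u_f$ be the solution of $[i\partial_t-f(D)]u_f(t)=0$ $(t\geqslant0)$, $u_f(0)=u_0$. Then $$\forall\,(t,x)\in\mathfrak{C}_f(\tilde p_1,\tilde p_2)\qquad |u_f(t,x)|\leqslant c(u_0,f)\,t^{-\frac{\mu}{2}},$$ $$\forall\,(t,x)\in\mathfrak{C}_f(\tilde p_1,\tilde p_2)^c\qquad |u_f(t,x)|\leqslant c_{\tilde I}(u_0,f)\,t^{-\mu},$$ where, with $m:=\min_{p\in[p_1,p_2]}f''(p)$, $m_{\tilde p_2}:=f'(\tilde p_2)-f'(p_2)$ and $m_{\tilde p_1}:=f'(p_1)-f'(\tilde p_1)$ (all positive), $$c(u_0,f):=\frac{1}{2\pi}\,\frac{3}{\mu}\,\|\tilde u\|_{L^\infty(p_1,p_2)}+\frac1\pi\left(4\|\tilde u\|_{L^\infty(p_1,p_2)}+\|\tilde u'\|_{L^1(p_1,p_2)}\right)m^{-1},$$ $$c_{\tilde I}(u_0,f):=\sum_{j=1,2}\left[\frac{1}{2\pi}\,\frac1\mu\,\|\tilde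 u\|_{L^\infty(p_1,p_2)}+\frac{1}{2\pi}\left(4\|\tilde u\|_{L^\infty(p_1,p_2)}+\|\tilde u'\|_{L^1(p_1,p_2)}\right)m_{\tilde p_j}^{-1}\right].$$ Moreover the two decay rates are optimal: there are no $\gamma>\frac{\mu}{2}$ and $C>0$ such that $|u_f(t,x)|\leqslant C\,t^{-\gamma}$ for all $(t,x)\in\mathfrak{C}_f(\tilde p_1,\tilde p_2)$ with $t\geqslant1$, and there are no $\gamma>\mu$ and $C>0$ such that $|u_f(t,x)|\leqslant C\,t^{-\gamma}$ for all $(t,x)\in\mathfrak{C}_f(\tilde p_1,\tilde p_2)^c$ with $t\geqslant1$.
   Context: Fourier transform: $\mathcal{F}u(p)=\int_{\mathbb{R}}u(x)e^{-ixp}\,dx$, extended to tempered distributions $\mathcal{S}'(\mathbb{R})$. The Fourier multiplier $f(D):\mathcal{S}'(\mathbb{R})\to\mathcal{S}'(\mathbb{R})$ is $f(D)u=\mathcal{F}^{-1}(f\,\mathcal{F}u)$. The evolution equation has a unique solution in $\mathcal{C}^1(\mathbb{R}_+,\mathcal{S}'(\mathbb{R}))$, namely $u_f(t)=\mathcal{F}^{-1}(e^{-itf}\mathcal{F}u_0)$; when $\mathcal{F}u_0\in L^1(\mathbb{R})$ (as is the case here) it is the function $$u_f(t,x)=\frac{1}{2\pi}\int_{\mathbb{R}}\mathcal{F}u_0(p)\,e^{-itf(p)+ixp}\,dp,\qquad (t,x)\in\mathbb{R}_+\times\mathbb{R}.$$ Condition (C1$_{[p_1,p_2],\mu}$): $\mathcal{F}u_0$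 is a complex-valued function with $\mathrm{supp}\,\mathcal{F}u_0\subseteq[p_1,p_2]$ and $\mathcal{F}u_0(p)=(p-p_1)^{\mu-1}\,\tilde u(p)$ for all $p\in(p_1,p_2]$, where $\tilde u\in\mathcal{C}^1([p_1,p_2],\mathbb{C})$ and $\tilde u(p_1)\neq0$. The function $\tilde u$ is called the regular factor. Space-time cone: $\mathfrak{C}_f(a,b):=\{(t,x)\in(0,+\infty)\times\mathbb{R} : f'(a)<\frac{x}{t}<f'(b)\}$, and $\mathfrak{C}_f(a,b)^c$ is its complement in $(0,+\infty)\times\mathbb{R}$. *)

(* Defs.v *)
From HB Require Import structures.
From mathcomp Require Import all_boot all_order all_algebra.
From mathcomp Require Import all_classical all_reals all_analysis.
From mathcomp Require Import complex.
Set Implicit Arguments.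
Unset Strict Implicit.
Unset Printing Implicit Defensive.
Import Order.TTheory GRing.Theory Num.Theory.
Import numFieldNormedType.Exports.
Local Open Scope classical_set_scope.
Local Open Scope ring_scope.
Local Open Scope complex_scope.

Definition cmod {R : realType} (z : R[i]) : R :=
  Num.sqrt (complex.Re z ^+ 2 + complex.Im z ^+ 2).

(* e^{i y} *)
Definition cis {R : realType} (y : R) : R[i] := cos y +i* sin y.

(* R[i] carries no normed module structure over R in the library, so the
   calculus of functions R -> R[i] is done on real and imaginary parts. *)
Definition re_fun {R : realType} (g : R -> R[i]) : R -> R :=
  fun x => complex.Re (g x).
Definition im_fun {R : realType} (g : R -> R[i]) : R -> R :=
  fun x => complex.Im (g x).

Definition cderiven {R : realType} (n : nat) (g : R -> R[i]) : R -> R[i] :=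
  fun x => derive1n n (re_fun g) x +i* derive1n n (im_fun g) x.

Definition smooth {R : realType} (g : R -> R) : Prop :=
  forall (n : nat) (x : R), derivable (derive1n n g) x 1.

Definition csmooth {R : realType} (g : R -> R[i]) : Prop :=
  smooth (re_fun g) /\ smooth (im_fun g).

Definition cintegral {R : realType} (g : R -> R[i]) : R[i] :=
  (\int[@lebesgue_measure R]_x re_fun g x)
    +i* (\int[@lebesgue_measure R]_x im_fun g x).

(* C^1 on the closed interval: g is continuous on [a, b], and its derivative
   on ]a, b[ exists and extends continuously to [a, b]. *)
Definition C1_segment {R : realType} (a b : R) (g : R -> R) : Prop :=
  [/\ {within `[a, b], continuous g},
      forall x, x \in `]a, b[ -> derivable g x 1 &
      exists d : R -> R, {within `[a, b], continuous d} /\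
        forall x, x \in `]a, b[ -> d x = derive1 g x].

Definition cC1_segment {R : realType} (a b : R) (g : R -> R[i]) : Prop :=
  C1_segment a b (re_fun g) /\ C1_segment a b (im_fun g).

Definition Linf_norm {R : realType} (a b : R) (g : R -> R[i]) : R :=
  fine (Lnorm (@lebesgue_measure R) +oo%E
          ((fun x => (cmod (g x))%:E) \_ `]a, b[)).

Definition L1_norm {R : realType} (a b : R) (g : R -> R[i]) : R :=
  fine (Lnorm (@lebesgue_measure R) 1%E
          ((fun x => (cmod (g x))%:E) \_ `]a, b[)).

Definition poly_growth {R : realType} (g : R -> R) : Prop :=
  exists (C : R) (N : nat), forall x, `|g x| <= C * (1 + `|x|) ^+ N.

Definition fourier {R : realType} (g : R -> R[i]) : R -> R[i] :=
  fun p => cintegral (fun x => g x * cis (- (x * p))).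

Definition ifourier {R : realType} (g : R -> R[i]) : R -> R[i] :=
  fun x => ((2 * pi)^-1)%:C * cintegral (fun p => g p * cis (x * p)).

Definition schwartz_values {R : realType} (j k : nat) (phi : R -> R[i]) :
    set R :=
  range (fun x => `|x| ^+ j * cmod (cderiven k phi x)).

Definition schwartz {R : realType} (phi : R -> R[i]) : Prop :=
  csmooth phi /\ forall j k, has_ubound (schwartz_values j k phi).

Definition seminorm {R : realType} (j k : nat) (phi : R -> R[i]) : R :=
  sup (schwartz_values j k phi).

Definition bounded_schwartz {R : realType} (B : set (R -> R[i])) : Prop :=
  (forall phi, B phi -> schwartz phi) /\
  forall j k, exists M : R, forall phi, B phi -> seminorm j k phi <= M.

(* Distributions are functionals on all of R -> R[i]; only their values on
   Schwartz functions are meaningful, whence [eq_distr] rather than [=]. *)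
Definition distr (R : realType) : Type := (R -> R[i]) -> R[i].

Definition eq_distr {R : realType} (T U : distr R) : Prop :=
  forall phi, schwartz phi -> T phi = U phi.

Definition tempered {R : realType} (T : distr R) : Prop :=
  (forall (a : R[i]) (phi psi : R -> R[i]), schwartz phi -> schwartz psi ->
     T (fun x => a * phi x + psi x) = a * T phi + T psi) /\
  exists (N : nat) (M : R), forall phi, schwartz phi ->
     cmod (T phi) <= M * \sum_(j < N.+1) \sum_(k < N.+1) seminorm j k phi.

Definition distr_of_fun {R : realType} (g : R -> R[i]) : distr R :=
  fun phi => cintegral (fun x => g x * phi x).

Definition distr_scale {R : realType} (a : R[i]) (T : distr R) : distr R :=
  fun phi => a * T phi.

Definition distr_sub {R : realType} (T U : distr R) : distr R :=
  fun phi => T phi - U phi.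

Definition distr_fourier {R : realType} (T : distr R) : distr R :=
  fun phi => T (fourier phi).

Definition distr_ifourier {R : realType} (T : distr R) : distr R :=
  fun phi => T (ifourier phi).

Definition distr_mul {R : realType} (f : R -> R) (T : distr R) : distr R :=
  fun phi => T (fun p => (f p)%:C * phi p).

Definition fourier_multiplier {R : realType} (f : R -> R) (T : distr R) :
    distr R :=
  distr_ifourier (distr_mul f (distr_fourier T)).

(* convergence in the strong dual topology of S': uniformly on the bounded
   subsets of S *)
Definition cvg_distr {R : realType} (F : set_system R) (U : R -> distr R)
    (T : distr R) : Prop :=
  forall B, bounded_schwartz B -> forall e : R, 0 < e ->
    \forall s \near F, forall phi, B phi ->
      cmod (distr_sub (U s) T phi) <= e.

(* u is in C^1(R_+, S') with derivative du; one-sided at t = 0 *)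
Definition C1_curve {R : realType} (u du : R -> distr R) : Prop :=
  forall t : R, 0 <= t ->
  [/\ tempered (u t), tempered (du t),
      cvg_distr (within `[0, +oo[ t^')
        (fun s => distr_scale ((s - t)^-1)%:C (distr_sub (u s) (u t)))
        (du t) &
      cvg_distr (within `[0, +oo[ (nbhs t)) du (du t)].

(* [i d/dt - f(D)] u(t) = 0 for t >= 0, u(0) = u0 *)
Definition solution {R : realType} (f : R -> R) (u0 : distr R)
    (u : R -> distr R) : Prop :=
  exists du : R -> distr R,
  [/\ C1_curve u du,
      forall t : R, 0 <= t ->
        eq_distr (distr_scale 'i (du t)) (fourier_multiplier f (u t)) &
      eq_distr (u 0) u0].

(* the function F^{-1}(e^{-itf} uhat) at x, with uhat = F u0 *)
Definition uf {R : realType} (f : R -> R) (uhat : R -> R[i]) (t x : R) : R[i] :=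
  ((2 * pi)^-1)%:C * cintegral (fun p => uhat p * cis (x * p - t * f p)).

Definition condition_C1 {R : realType} (p1 p2 mu : R)
    (uhat ut : R -> R[i]) : Prop :=
  [/\ forall p, p \notin `[p1, p2] -> uhat p = 0,
      forall p, p \in `]p1, p2] ->
        uhat p = ((p - p1) `^ (mu - 1))%:C * ut p,
      cC1_segment p1 p2 ut &
      ut p1 <> 0].

Definition cone {R : realType} (f : R -> R) (a b : R) : set (R * R) :=
  [set tx | 0 < tx.1 /\ derive1 f a < tx.2 / tx.1 < derive1 f b].

Definition cone_compl {R : realType} (f : R -> R) (a b : R) : set (R * R) :=
  [set tx | 0 < tx.1] `\` cone f a b.

(* for smooth f and p1 <= p2 this infimum is a minimum *)
Definition min_f2 {R : realType} (f : R -> R) (p1 p2 : R) : R :=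
  inf (derive1n 2 f @` `[p1, p2]).

Definition c_cone {R : realType} (f : R -> R) (mu p1 p2 : R)
    (ut : R -> R[i]) : R :=
  (2 * pi)^-1 * (3 / mu) * Linf_norm p1 p2 ut
  + pi^-1 * (4 * Linf_norm p1 p2 ut + L1_norm p1 p2 (cderiven 1 ut))
    * (min_f2 f p1 p2)^-1.

Definition c_compl {R : realType} (f : R -> R) (mu p1 p2 q1 q2 : R)
    (ut : R -> R[i]) : R :=
  let summand (mq : R) :=
    (2 * pi)^-1 * mu^-1 * Linf_norm p1 p2 ut
    + (2 * pi)^-1 * (4 * Linf_norm p1 p2 ut + L1_norm p1 p2 (cderiven 1 ut))
      * mq^-1 in
  summand (derive1 f p1 - derive1 f q1) + summand (derive1 f q2 - derive1 f p2).

(* Main.v *)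
Require Import Defs.
From HB Require Import structures.
From mathcomp Require Import all_boot all_order all_algebra.
From mathcomp Require Import all_classical all_reals all_analysis.
From mathcomp Require Import complex.
From mathcomp Require Import measurable_realfun ess_sup_inf ring lra.
Import Order.TTheory GRing.Theory Num.Theory.
Import numFieldNormedType.Exports.
Local Open Scope classical_set_scope.
Local Open Scope ring_scope.
Local Open Scope complex_scope.

(** Write u(t) for the solution and call weight the factor (p - p1)^(mu - 1).

    The solution formula.  For a Schwartz function psi put
    w(t) = u(t) (F (e^{itf} psi)).  With h = r - s, the phase expands as
    e^{ihf} = 1 + h kH and kH = i f + h kG, where the functions kH and kG,
    over all 0 < |h| <= 1, have derivatives of polynomial growth with
    constants that do not depend on h ([cmult_kH], [cmult_kG]).  Tempered
    functionals are therefore bounded on the test functions built from them,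
    and, as difference quotients of u converge uniformly on bounded subsets of
    the Schwartz space, the equation gives w(r) - w(s) = o(r - s).  So w is
    constant ([evolution]), and taking psi = e^{-itf} F^{-1} phi determines
    u(t) phi: Fourier inversion on the Schwartz space ([fourierK],
    [ifourierK]) and Fubini ([ifourier_swap]) identify it with the integral of
    u_f(t, .) phi.  Fourier inversion is obtained by damping with e^{-e|p|},
    whose transform is the Poisson kernel.

    Decay.  The modulus of u_f is the maximum over rotations c + i s, with
    c^2 + s^2 = 1, of a real integral of weight times amplitude times
    cos/sin of g(p) = x p - t f(p), and g is concave.  On an interval of length
    d the weight alone gives L d^mu / mu, with L the sup norm of the regular
    factor ([osc_small]).  At distance at least d from p1, where |g'| >= lam,
    one integration by parts gives d^(mu - 1) (4 L + N) / lam, with N the L^1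
    norm of the derivative of the regular factor ([osc_nonstat]): two boundary
    terms and the variation of 1/g' make 3 L, and the variation of the monotone
    weight makes one more L.  Outside the cone |g'| >= t m_j throughout, and
    d = 1/t balances the two bounds into t^(-mu).  In general g' vanishes at
    most once, |g'| >= t m |p - p0| around that point p0, and removing the
    d-neighbourhood of p0 as well, with d = t^(-1/2), gives t^(-mu/2).

    Optimality.  On the ray x = f'(p1) t the phase is, up to an additive
    constant and a sign, t phi(p) with phi comparable to (p - p1)^2; on the ray
    x = f'(q2) t the same holds with phi comparable to p - p1.  In both cases
    phi is comparable to (p - p1)^k, the claimed rate is t^(-mu/k), and a rate
    t^(-gamma) with gamma > mu/k is refuted by averaging over time against
    e^2 t e^{-e t} with e = sig^k ([osc_sin_optimal]).  The average would be
    O(sig^(mu + rho)) for some rho > 0.  After exchanging integrals it is also,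
    up to an error O(sig^(mu + 1/2)) due to the variation of the amplitude, a
    positive multiple of the integral of the weight times a kernel which is
    nonnegative and bounded below by a positive constant for p - p1 between
    sig/2 and sig; hence it is at least a constant times sig^mu, which is
    contradictory as sig -> 0. *)

Local Notation igr D h :=
  ((@lebesgue_measure _).-integrable D (EFin \o h)).

(** * Calculus of real functions *)

Section Derivatives.
Context {R : realType}.
Implicit Types (f g : R -> R) (x a b : R).

(** A plain synonym, so that derivatives are not searched by instance
    resolution. *)
Definition isd (f : R -> R) (x d : R) := is_derive x 1 f d.

Lemma isd_eq f x a b : isd f x a -> a = b -> isd f x b.
Proof. by move=> + <-. Qed.

Lemma isd_cst x (c : R) : isd (fun=> c : R) x 0.
Proof. exact: is_derive_cst. Qed.

Lemma isd_id x : isd (fun y : R => y) x 1.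
Proof. exact: is_derive_id. Qed.

Lemma isdD f g x a b : isd f x a -> isd g x b ->
  isd (fun y => f y + g y) x (a + b).
Proof. by move=> fa gb; exact: is_deriveD. Qed.

Lemma isdN f x a : isd f x a -> isd (fun y => - f y) x (- a).
Proof. by move=> fa; exact: is_deriveN. Qed.

Lemma isdB f g x a b : isd f x a -> isd g x b ->
  isd (fun y => f y - g y) x (a - b).
Proof. by move=> fa gb; exact: is_deriveB. Qed.

Lemma isdM f g x a b : isd f x a -> isd g x b ->
  isd (fun y => f y * g y) x (a * g x + f x * b).
Proof.
move=> fa gb; have := @is_deriveM _ _ f g x 1 a b fa gb.
by rewrite /GRing.scale/= addrC (mulrC a).
Qed.

Lemma isdZ f x a (c : R) : isd f x a ->
  isd (fun y => c * f y) x (c * a).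
Proof. by move=> fa; exact: is_deriveZ. Qed.

Lemma isdV f x a : f x != 0 -> isd f x a ->
  isd (fun y => (f y)^-1) x (- a / f x ^+ 2).
Proof.
move=> fx fa; have := @is_deriveV _ f x a 1 fx fa.
by rewrite /GRing.scale/= mulrC mulNr mulrN.
Qed.

Lemma isd_comp f g x a b : isd f (g x) a -> isd g x b ->
  isd (fun y => f (g y)) x (a * b).
Proof. by move=> fa gb; exact: is_derive1_comp. Qed.

Lemma isd_cos f x a : isd f x a ->
  isd (fun y => cos (f y)) x (- sin (f x) * a).
Proof. by move=> fa; apply: (isd_comp cos) => //; exact: is_derive_cos. Qed.

Lemma isd_sin f x a : isd f x a ->
  isd (fun y => sin (f y)) x (cos (f x) * a).
Proof. by move=> fa; apply: (isd_comp sin) => //; exact: is_derive_sin. Qed.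

Lemma isd_exp f x a : isd f x a ->
  isd (fun y => expR (f y)) x (expR (f x) * a).
Proof. by move=> fa; apply: (isd_comp expR) => //; exact: is_derive_expR. Qed.

Lemma isd_derivable f x : derivable f x 1 -> isd f x (derive1 f x).
Proof. by move=> df; rewrite derive1E; exact: derivableP. Qed.

Lemma isd_val f x a : isd f x a -> derive1 f x = a.
Proof. by move=> [_ <-]; rewrite derive1E. Qed.

Lemma isd_ex f x a : isd f x a -> derivable f x 1.
Proof. by case. Qed.

Lemma isd_continuous f x a : isd f x a -> {for x, continuous f}.
Proof.
by move=> /isd_ex df; apply: differentiable_continuous; exact/derivable1_diffP.
Qed.

Lemma cts_comp f g : continuous f -> continuous g -> continuous (fun x => f (g x)).
Proof.
by move=> cf cg x; apply: (@continuous_comp _ _ _ g f); [exact: cg|exact: cf].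
Qed.

Lemma ctsM f g : continuous f -> continuous g -> continuous (fun x => f x * g x).
Proof. by move=> cf cg x; apply: cvgM; [exact: cf|exact: cg]. Qed.

Lemma ctsD f g : continuous f -> continuous g -> continuous (fun x => f x + g x).
Proof. by move=> cf cg x; apply: cvgD; [exact: cf|exact: cg]. Qed.

Lemma ctsN f : continuous f -> continuous (fun x => - f x).
Proof. by move=> cf x; apply: cvgN; exact: cf. Qed.

Lemma ctsZ (c : R) f : continuous f -> continuous (fun x => c * f x).
Proof. by move=> cf x; apply: cvgMr; exact: cf. Qed.

Lemma cts_id : continuous (fun x : R => x).
Proof. by move=> x; exact: cvg_id. Qed.

Lemma cts_norm : continuous (fun x : R => `|x|).
Proof. exact: norm_continuous. Qed.

Lemma cts_cst (c : R) : continuous (fun _ : R => c).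
Proof. by move=> x; exact: cvg_cst. Qed.

End Derivatives.

(** * Lebesgue integration of real functions *)

Section Integration.
Context {R : realType}.
Notation mu := (@lebesgue_measure R).
Implicit Types (h g k F : R -> R) (D : set (measurableTypeR R)).

Lemma igr_dom D h g : measurable D -> measurable_fun D h -> igr D g ->
  (forall x : R, D x -> `|h x| <= g x) -> igr D h.
Proof.
move=> mD mh ig hg; apply: le_integrable ig => //; first exact/measurable_EFinP.
by move=> x Dx; rewrite /= lee_fin (le_trans (hg x Dx))// ler_norm.
Qed.

Lemma igr_meas D h : igr D h -> measurable_fun D h.
Proof. by move=> /integrableP[/measurable_EFinP]. Qed.

Lemma igrS {D} D' {h} : measurable D -> measurable D' -> D' `<=` D ->
  igr D h -> igr D' h.
Proof. by move=> mD mD' DD'; apply: integrableS. Qed.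

Lemma igrD D h g : measurable D -> igr D h -> igr D g ->
  igr D (fun x => h x + g x).
Proof. by move=> mD ih ig; have := integrableD mD ih ig. Qed.

Lemma igrZ D c h : measurable D -> igr D h -> igr D (fun x => c * h x).
Proof. by move=> mD ih; have := integrableZl mD c ih. Qed.

Lemma igrN D h : measurable D -> igr D h -> igr D (fun x => - h x).
Proof. by move=> mD ih; have := integrableN ih. Qed.

Lemma igrB D h g : measurable D -> igr D h -> igr D g ->
  igr D (fun x => h x - g x).
Proof. by move=> mD ih ig; apply: igrD => //; exact: igrN. Qed.

Lemma igr_norm D h : measurable D -> igr D h -> igr D (fun x => `|h x|).
Proof. by move=> mD ih; have := integrable_abse ih. Qed.

Lemma eq_igr D h g : measurable D -> (forall x : R, D x -> h x = g x) -> igr D h -> igr D g.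
Proof.
by move=> mD hg; apply: eq_integrable => // x xD /=; rewrite hg//; exact: set_mem.
Qed.

Lemma igrMb D h k (C : R) : measurable D -> igr D h -> measurable_fun D k ->
  (forall x : R, D x -> `|k x| <= C) -> igr D (fun x => h x * k x).
Proof.
move=> mD ih mk kC; apply: (igr_dom _ _ (fun x => C * `|h x|)) => //.
- by apply: measurable_funM => //; exact: igr_meas.
- by apply: igrZ => //; exact: igr_norm.
- by move=> x Dx; rewrite normrM mulrC ler_wpM2r// kC.
Qed.

Lemma le_norm_integral D h g : measurable D -> igr D h -> igr D g ->
  (forall x : R, D x -> `|h x| <= g x) ->
  `|\int[mu]_(x in D) h x| <= \int[mu]_(x in D) g x.
Proof.
move=> mD ih ig hg; apply: (le_trans (le_normr_Rintegral _ _)) => //.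
by apply: le_Rintegral => //; exact: igr_norm.
Qed.

Lemma dominated_cvg D (h_ : nat -> R -> R) h g : measurable D ->
  (forall n, measurable_fun D (h_ n)) -> igr D g ->
  (forall n (x : R), D x -> `|h_ n x| <= g x) ->
  (forall x : R, D x -> h_ n x @[n --> \oo] --> h x) ->
  igr D h /\
  (\int[mu]_(x in D) h_ n x) @[n --> \oo] --> \int[mu]_(x in D) h x.
Proof.
move=> mD mh ig hg hh.
have mlim : measurable_fun D h by apply: measurable_fun_cvg hh.
have [] := @dominated_convergence _ _ _ mu D mD (fun n x => (h_ n x)%:E)
  (EFin \o h) (EFin \o g).
- by move=> n; apply/measurable_EFinP.
- exact/measurable_EFinP.
- by apply: aeW => x Dx; apply: cvg_EFin; [exact: nearW|exact: hh].
- exact: ig.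
- by apply: aeW => x n Dx; rewrite /= lee_fin hg.
move=> ih _ cvi; split=> //.
apply: fine_cvg; rewrite fineK; first exact: cvi.
exact: integrable_fin_num.
Qed.

Lemma patch_measurable D h a b : measurable D -> measurable_fun D h ->
  measurable_fun D (h \_ `[a, b]).
Proof.
move=> mD mh; apply/measurable_restrict => //.
by apply: measurable_funS mh => //; exact: subIsetl.
Qed.

Lemma seg_FTC h F (a b : R) : a < b -> {within `[a, b], continuous h} ->
  {within `[a, b], continuous F} ->
  (forall x, a < x < b -> isd F x (h x)) ->
  \int[mu]_(x in `[a, b]) h x = F b - F a.
Proof.
move=> ab ch cF dF.
have [_ Fa Fb] := (continuous_within_itvP F ab).1 cF.
rewrite /Rintegral (@continuous_FTC2 _ h F a b)//.
- split=> // x; rewrite in_itv/= => xab.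
  by have [] := dF x xab.
- by move=> x; rewrite in_itv/= => /dF [_]; rewrite derive1E.
Qed.

Lemma seg_igr h (a b : R) : {within `[a, b], continuous h} -> igr `[a, b] h.
Proof. by move=> ch; apply: continuous_compact_integrable => //; exact: segment_compact. Qed.

Lemma continuous_within (D : set R) h : (forall x : R, D x -> {for x, continuous h}) ->
  {within D, continuous h}.
Proof.
move=> ch; apply: continuous_in_subspaceT => x /set_mem; exact: ch.
Qed.

Lemma exhaust_cvg D (a b : nat -> R) h :
  (forall x : R, D x -> \forall n \near \oo, a n <= x <= b n) ->
  (forall x : R, D x -> (h \_ `[a n, b n]) x @[n --> \oo] --> h x).
Proof.
move=> Dab x Dx; apply: cvg_near_cst.
near=> n; rewrite patchE mem_set//=.
by rewrite in_itv/=; near: n; exact: Dab.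
Unshelve. all: by end_near. Qed.

(** An improper integral is reduced by dominated convergence to the
    fundamental theorem of calculus on the segments [a n, b n] that exhaust D;
    F may fail to extend continuously to the ends of D, only its limits along
    the two sequences matter. *)
Lemma exhaust D (a b : nat -> R) h F (la lb : R) : measurable D -> igr D h ->
  (forall n, a n < b n) -> (forall n (x : R), a n <= x <= b n -> D x) ->
  (forall x : R, D x -> \forall n \near \oo, a n <= x <= b n) ->
  (forall x : R, D x -> isd F x (h x)) ->
  (forall x : R, D x -> {for x, continuous h}) ->
  F (a n) @[n --> \oo] --> la -> F (b n) @[n --> \oo] --> lb ->
  \int[mu]_(x in D) h x = lb - la.
Proof.
move=> mD ih ab abD Dab dF ch Fa Fb.
have sub n : `[a n, b n] `<=` D by move=> x /=; rewrite in_itv/=; exact: abD.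
have [_ cvi] : igr D h /\ (\int[mu]_(x in D) (h \_ `[a n, b n]) x) @[n --> \oo]
     --> \int[mu]_(x in D) h x.
  apply: (dominated_cvg _ _ _ (fun x => `|h x|)) => //.
  - by move=> n; apply: patch_measurable => //; exact: igr_meas.
  - exact: igr_norm.
  - by move=> n x Dx; rewrite patchE; case: ifPn; rewrite ?normr0.
  - exact: exhaust_cvg.
have E n : \int[mu]_(x in D) (h \_ `[a n, b n]) x = F (b n) - F (a n).
  rewrite -Rintegral_mkcondr setIidr//; apply: (@seg_FTC h F) => //.
  - by apply: continuous_within => x /sub; exact: ch.
  - by apply: continuous_within => x /sub /dF; exact: isd_continuous.
  - by move=> x /andP[ax xb]; apply: dF; apply: (abD n); rewrite !ltW.
have : (\int[mu]_(x in D) (h \_ `[a n, b n]) x) @[n --> \oo] --> lb - la.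
  by rewrite (_ : (fun n => _) = (fun n => F (b n) - F (a n)));
    [exact: cvgB|apply/funext => n].
by move=> /(cvg_unique _ cvi) ->.
Qed.

(** Monotone convergence makes the integrability hypothesis of [exhaust] part
    of the conclusion when the derivative is nonnegative. *)
Lemma exhaust_ge0 D (a b : nat -> R) h F (la lb : R) : measurable D ->
  measurable_fun D h -> (forall x : R, D x -> 0 <= h x) ->
  (forall n, a n < b n) -> (forall n (x : R), a n <= x <= b n -> D x) ->
  (forall n m, (n <= m)%N -> a m <= a n /\ b n <= b m) ->
  (forall x : R, D x -> \forall n \near \oo, a n <= x <= b n) ->
  (forall x : R, D x -> isd F x (h x)) ->
  (forall x : R, D x -> {for x, continuous h}) ->
  F (a n) @[n --> \oo] --> la -> F (b n) @[n --> \oo] --> lb ->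
  igr D h /\ \int[mu]_(x in D) h x = lb - la.
Proof.
move=> mD mh h0 ab abD nd Dab dF ch Fa Fb.
have sub n : `[a n, b n] `<=` D by move=> x /=; rewrite in_itv/=; exact: abD.
suff ih : igr D h by split=> //; exact: (exhaust _ a b _ F).
apply/integrableP; split; first exact/measurable_EFinP.
pose h_ n x := ((h \_ `[a n, b n]) x)%:E.
have hge0 n x : D x -> 0 <= (h \_ `[a n, b n]) x.
  by move=> Dx; rewrite patchE; case: ifPn => // _; exact: h0.
have := @cvg_monotone_convergence _ _ _ mu D mD h_.
have mh_ n : measurable_fun D (h_ n).
  by apply/measurable_EFinP; exact: patch_measurable.
have h_0 n x : D x -> (0 <= h_ n x)%E by move=> Dx; rewrite lee_fin hge0.
have ndh x : D x -> nondecreasing_seq (h_ ^~ x).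
  move=> Dx n m nm; rewrite lee_fin 2!patchE.
  case: ifPn => [|_].
    move=> /set_mem/=; rewrite in_itv/= => /andP[x1 x2].
    rewrite mem_set//= in_itv/= (le_trans (nd _ _ nm).1 x1)/=.
    exact: le_trans x2 (nd _ _ nm).2.
  by case: ifPn => // _; exact: h0.
move=> /(_ mh_ h_0 ndh) cvi.
have limh x : D x -> limn (h_ ^~ x) = (h x)%:E.
  move=> Dx; apply/cvg_lim => //; apply: cvg_EFin; first exact: nearW.
  exact: (exhaust_cvg D a b h Dab x Dx).
have E n : (\int[mu]_(x in D) (h_ n x) = (F (b n) - F (a n))%:E)%E.
  rewrite /h_ -[LHS]fineK; last first.
    apply: integrable_fin_num => //.
    have : igr (D `&` `[a n, b n]) h.
      rewrite setIidr//; apply: seg_igr; apply: continuous_within => x /sub.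
      exact: ch.
    by move/integrable_restrict; rewrite restrict_EFin; apply.
  congr EFin.
  rewrite -[LHS]/(\int[mu]_(x in D) (h \_ `[a n, b n]) x).
  rewrite -Rintegral_mkcondr setIidr//; apply: (@seg_FTC h F) => //.
  - by apply: continuous_within => x /sub; exact: ch.
  - by apply: continuous_within => x /sub /dF; exact: isd_continuous.
  - by move=> x /andP[ax xb]; apply: dF; apply: (abD n); rewrite !ltW.
have : (\int[mu]_(x in D) (h_ n x))%E @[n --> \oo] --> (lb - la)%:E.
  rewrite (_ : (fun n => _) = (fun n => (F (b n) - F (a n))%:E)); last first.
    by apply/funext => n.
  by apply: cvg_EFin; [exact: nearW|exact: cvgB].
move=> /(cvg_unique _ cvi) => /(_ (@ereal_hausdorff _)) E2.
have -> : (\int[mu]_(x in D) `|(EFin \o h) x| =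
    \int[mu]_(x in D) limn (h_ ^~ x))%E.
  apply: eq_integral => x /set_mem Dx.
  by rewrite limh// /= ger0_norm//; exact: h0.
by rewrite E2 ltry.
Qed.

Lemma igr_patch D h : measurable D -> igr D h ->
  igr setT (h \_ D).
Proof.
move=> mD ih; have : igr (setT `&` D) h by rewrite setTI.
by move/integrable_restrict; rewrite restrict_EFin; apply.
Qed.

Lemma le_integral_sub (D' D : set (measurableTypeR R)) h : measurable D' ->
  measurable D -> D' `<=` D -> igr D h -> (forall x : R, D x -> 0 <= h x) ->
  \int[mu]_(x in D') h x <= \int[mu]_(x in D) h x.
Proof.
move=> mD' mD sub ih h0; rewrite (Rintegral_mkcond _ D') (Rintegral_mkcond _ D).
apply: le_Rintegral => //; [apply: igr_patch => //; exact: igrS ih|exact: igr_patch|].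
move=> x _; rewrite !patchE; case: ifPn => [/set_mem/sub xD|_]; first by rewrite mem_set.
by case: ifPn => // /set_mem; exact: h0.
Qed.

(** The bound 1 on the kernel makes |g(x) h(y)| a dominating function for the
    double integral. *)
Lemma fubini_kernel g h (k : R * R -> R) : igr setT g -> igr setT h ->
  measurable_fun setT k -> (forall z, `|k z| <= 1) ->
  igr setT (fun x => g x * \int[mu]_y (h y * k (x, y))) /\
  \int[mu]_x (g x * \int[mu]_y (h y * k (x, y))) =
  \int[mu]_y (h y * \int[mu]_x (g x * k (x, y))).
Proof.
move=> ig ih mk k1.
have mky x : measurable_fun setT (fun y => k (x, y)).
  by apply: measurableT_comp => //; exact: measurable_pair1.
have mkx y : measurable_fun setT (fun x => k (x, y)).
  by apply: measurableT_comp => //; exact: measurable_pair2.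
have i1 x : igr setT (fun y => h y * k (x, y)).
  apply: (igrMb setT h (fun y => k (x, y)) 1) => //; exact: mky.
have i2 y : igr setT (fun x => g x * k (x, y)).
  apply: (igrMb setT g (fun x => k (x, y)) 1) => //; exact: mkx.
pose f (z : R * R) := (g z.1 * h z.2 * k z)%:E.
have mf : measurable_fun setT f.
  apply/measurable_EFinP; apply: measurable_funM => //; apply: measurable_funM.
  - by apply: (measurableT_comp (igr_meas _ _ ig)); exact: measurable_fst.
  - by apply: (measurableT_comp (igr_meas _ _ ih)); exact: measurable_snd.
have fy x : (\int[mu]_y f (x, y) = (g x * \int[mu]_y (h y * k (x, y)))%:E)%E.
  rewrite -RintegralZl// /Rintegral fineK.
    by apply: eq_integral => y _; rewrite /f/= mulrA.
  by apply: integrable_fin_num => //; exact: igrZ.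
have fx y : (\int[mu]_x f (x, y) = (h y * \int[mu]_x (g x * k (x, y)))%:E)%E.
  rewrite -RintegralZl// /Rintegral fineK.
    by apply: eq_integral => x _; rewrite /f/= mulrCA mulrA.
  by apply: integrable_fin_num => //; exact: igrZ.
have iif : (mu \x mu)%E.-integrable setT f.
  apply/integrable12ltyP => //.
  apply: (@le_lt_trans _ _ (\int[mu]_x (`|g x| * \int[mu]_y `|h y|)%:E)%E).
    apply: ge0_le_integral => //=.
    - by move=> x _; exact: integral_ge0.
    - apply: (@measurable_fun_fubini_tonelli_F _ _ _ _ _ mu (fun z => `|f z|%E)) => //.
      exact: measurableT_comp.
    - apply/measurable_EFinP; apply: measurable_funM => //.
      by apply: measurableT_comp => //; exact: igr_meas ig.
    - move=> x _; rewrite -RintegralZl//; last exact: igr_norm.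
      rewrite /Rintegral fineK; last first.
        by apply: integrable_fin_num => //; apply: igrZ => //; exact: igr_norm.
      apply: ge0_le_integral => //=.
      + apply/measurable_EFinP.
        apply: (@measurableT_comp _ _ _ _ _ _ (@Num.norm _ R)) => //.
        apply: measurable_funM => /=; last exact: mky.
        by apply: measurable_funM => //; exact: igr_meas ih.
      + apply/measurable_EFinP; apply: measurable_funM => //.
        by apply: measurableT_comp => //; exact: igr_meas ih.
      + move=> y _; rewrite lee_fin 2!normrM ler_piMr ?mulr_ge0//; exact: k1.
  have : igr setT (fun x => (\int[mu]_y `|h y|) * `|g x|).
    by apply: igrZ => //; exact: igr_norm.
  move=> /integrableP[_]; apply: le_lt_trans.
  apply: ge0_le_integral => //=.
  - by move=> x _; rewrite lee_fin mulr_ge0// Rintegral_ge0.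
  - apply/measurable_EFinP; apply: measurable_funM => //.
    by apply: measurableT_comp => //; exact: igr_meas ig.
  - do 2 apply: measurableT_comp => //; apply: measurable_funM => //.
    by apply: measurableT_comp => //; exact: igr_meas ig.
  - by move=> x _; rewrite lee_fin mulrC ler_norm.
split.
  have := integrable_fubini_F iif.
  by apply: eq_integrable => // x _; exact: fy.
have := Fubini iif.
under eq_integral do rewrite fy.
under [X in _ = X -> _]eq_integral do rewrite fx.
by move=> /(congr1 fine).
Qed.

End Integration.

(** * Families of multipliers and of Schwartz functions *)

Section Classes.
Context {R : realType}.

(** The members of the family a and their first n derivatives satisfy P.
    Whole families are considered, with constants uniform in the index, so that
    boundedness of a set of test functions becomes a property of one family. *)
Fixpoint Ck {I : Type} (P : (I -> R -> R) -> Prop) (n : nat)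
    (a : I -> R -> R) : Prop :=
  P a /\ if n is m.+1 then
    (forall i (x : R), derivable (a i) x 1) /\ Ck P m (fun i => derive1 (a i)) else True.

Definition PG {I : Type} (a : I -> R -> R) :=
  exists (C : R) (N : nat), forall i (x : R), `|a i x| <= C * (1 + `|x|) ^+ N.

(** Rapid decrease is expressed with 1 + |x| so that the bounds of different
    orders j are comparable. *)
Definition RD {I : Type} (a : I -> R -> R) :=
  forall j : nat, exists C : R, forall i (x : R), (1 + `|x|) ^+ j * `|a i x| <= C.

Definition multf {I : Type} (a : I -> R -> R) := forall n, Ck PG n a.
Definition schf {I : Type} (a : I -> R -> R) := forall n, Ck RD n a.

Lemma Ck_der {I : Type} P n (a b : I -> R -> R) : P a ->
  (forall i (x : R), isd (a i) x (b i x)) -> Ck P n b -> Ck P n.+1 a.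
Proof.
move=> Pa ab Cb /=; split=> //; split; first by move=> i x; case: (ab i x).
rewrite (_ : (fun i => _) = b)//; apply/funext => i; apply/funext => x.
exact: isd_val.
Qed.

Lemma Ck_succ {I : Type} P n (a : I -> R -> R) : Ck P n.+1 a -> Ck P n a.
Proof.
elim: n a => [|n IH] a; first by case.
by move=> [Pa [da Ca]]; split=> //; split=> //; exact: IH.
Qed.

Lemma Ck_0 {I : Type} P n (a : I -> R -> R) : Ck P n a -> P a.
Proof. by case: n => [|n] []. Qed.

Lemma Ck_add {I : Type} P n (a b : I -> R -> R) :
  (forall a b, P a -> P b -> P (fun i x => a i x + b i x)) ->
  Ck P n a -> Ck P n b -> Ck P n (fun i x => a i x + b i x).
Proof.
move=> PD; elim: n a b => [|n IH] a b; first by move=> [Pa _] [Pb _]; split=> //; exact: PD.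
move=> [Pa [da Ca]] [Pb [db Cb]].
apply: (Ck_der _ _ _ (fun i x => derive1 (a i) x + derive1 (b i) x)); first exact: PD.
  by move=> i x; apply: isdD; exact: isd_derivable.
exact: IH.
Qed.

(** Three classes are needed because products mix them: a multiplier times a
    Schwartz function is a Schwartz function. *)
Lemma Ck_mul {I : Type} P1 P2 P3 n (a b : I -> R -> R) :
  (forall a b, P3 a -> P3 b -> P3 (fun i x => a i x + b i x)) ->
  (forall a b, P1 a -> P2 b -> P3 (fun i x => a i x * b i x)) ->
  Ck P1 n a -> Ck P2 n b -> Ck P3 n (fun i x => a i x * b i x).
Proof.
move=> PD PM; elim: n a b => [|n IH] a b.
  by move=> [Pa _] [Pb _]; split=> //; exact: PM.
move=> Ca0 Cb0; have [Pa [da Ca]] := Ca0; have [Pb [db Cb]] := Cb0.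
apply: (Ck_der _ _ _ (fun i x => derive1 (a i) x * b i x + a i x * derive1 (b i) x)).
- exact: PM.
- by move=> i x; apply: isdM; exact: isd_derivable.
- by apply: Ck_add => //; apply: IH => //; exact: Ck_succ.
Qed.

Lemma Ck_reindex {I J : Type} (P : forall I, (I -> R -> R) -> Prop) n (g : J -> I)
    (a : I -> R -> R) : (forall a, P I a -> P J (fun j => a (g j))) ->
  Ck (P I) n a -> Ck (P J) n (fun j => a (g j)).
Proof.
move=> PJ; elim: n a => [|n IH] a; first by move=> [Pa _]; split=> //; exact: PJ.
by move=> [Pa [da Ca]]; split; [exact: PJ|split=> //; exact: (IH (fun i => derive1 (a i)))].
Qed.

Lemma oneDn_ge1 (x : R) : 1 <= 1 + `|x|. Proof. by rewrite lerDl. Qed.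

Lemma oneDnX_ge1 (x : R) n : 1 <= (1 + `|x|) ^+ n.
Proof. by rewrite exprn_ege1// oneDn_ge1. Qed.

Lemma oneDnX_le (C x : R) (N M : nat) :
  C * (1 + `|x|) ^+ N <= `|C| * (1 + `|x|) ^+ (N + M).
Proof.
have X0 n : 0 <= (1 + `|x|) ^+ n by rewrite exprn_ge0// addr_ge0.
apply: (@le_trans _ _ (`|C| * (1 + `|x|) ^+ N)); first by rewrite ler_wpM2r// ler_norm.
by rewrite ler_wpM2l// exprD ler_peMr// oneDnX_ge1.
Qed.

Lemma PG_add {I : Type} (a b : I -> R -> R) : PG a -> PG b ->
  PG (fun i x => a i x + b i x).
Proof.
move=> [C [N aN]] [D [M bM]]; exists (`|C| + `|D|), (N + M)%N => i x.
rewrite (le_trans (ler_normD _ _))// mulrDl lerD//.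
  exact: (le_trans (aN i x) (oneDnX_le _ _ _ _)).
by rewrite addnC; exact: (le_trans (bM i x) (oneDnX_le _ _ _ _)).
Qed.

Lemma PG_mul {I : Type} (a b : I -> R -> R) : PG a -> PG b ->
  PG (fun i x => a i x * b i x).
Proof.
move=> [C [N aN]] [D [M bM]]; exists (C * D), (N + M)%N => i x.
by rewrite normrM exprD mulrACA ler_pM.
Qed.

Lemma RD_add {I : Type} (a b : I -> R -> R) : RD a -> RD b ->
  RD (fun i x => a i x + b i x).
Proof.
move=> ra rb j; have [C aC] := ra j; have [D bD] := rb j.
exists (C + D) => i x; apply: le_trans (lerD (aC i x) (bD i x)).
by rewrite -mulrDr ler_wpM2l ?ler_normD// exprn_ge0// addr_ge0.
Qed.

Lemma PG_RD_mul {I : Type} (a b : I -> R -> R) : PG a -> RD b ->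
  RD (fun i x => a i x * b i x).
Proof.
move=> [C [N aN]] rb j; have [D bD] := rb (N + j)%N.
have X0 (x : R) n : 0 <= (1 + `|x|) ^+ n by rewrite exprn_ge0// addr_ge0.
exists (`|C| * D) => i x.
apply: (@le_trans _ _ (`|C| * ((1 + `|x|) ^+ (N + j) * `|b i x|))); last first.
  by rewrite ler_wpM2l.
rewrite normrM exprD.
have -> : `|C| * ((1 + `|x|) ^+ N * (1 + `|x|) ^+ j * `|b i x|) =
  (1 + `|x|) ^+ j * (`|C| * (1 + `|x|) ^+ N * `|b i x|) by ring.
apply: ler_wpM2l => //; apply: ler_wpM2r => //.
by apply: (le_trans (aN i x)); rewrite ler_wpM2r// ler_norm.
Qed.

Lemma multf_mul {I : Type} (a b : I -> R -> R) : multf a -> multf b ->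
  multf (fun i x => a i x * b i x).
Proof. by move=> ma mb n; apply: Ck_mul (ma n) (mb n); [exact: PG_add|exact: PG_mul]. Qed.

Lemma schf_add {I : Type} (a b : I -> R -> R) : schf a -> schf b ->
  schf (fun i x => a i x + b i x).
Proof. by move=> ma mb n; apply: Ck_add => //; exact: RD_add. Qed.

Lemma schf_mul {I : Type} (a b : I -> R -> R) : multf a -> schf b ->
  schf (fun i x => a i x * b i x).
Proof. by move=> ma mb n; apply: Ck_mul (ma n) (mb n); [exact: RD_add|exact: PG_RD_mul]. Qed.

Lemma multf_cst {I : Type} (c : I -> R) (K : R) : (forall i, `|c i| <= K) ->
  multf (fun i _ => c i).
Proof.
move=> cK n; elim: n c K cK => [|n IH] c K cK.
  by split=> //; exists K, 0%N => i x; rewrite expr0 mulr1.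
apply: (Ck_der _ _ _ (fun _ _ => 0)).
- by exists K, 0%N => i x; rewrite expr0 mulr1.
- by move=> i x; exact: isd_cst.
- by apply: (IH (fun=> 0) 0) => i; rewrite normr0.
Qed.

Lemma multf_id {I : Type} : multf (fun (_ : I) (x : R) => x).
Proof.
have P : PG (fun (_ : I) (x : R) => x).
  by exists 1, 1%N => _ x; rewrite mul1r expr1 lerDr.
case=> [|n]; first by split.
apply: (Ck_der _ _ _ (fun _ _ => 1)) => //; first by move=> i x; exact: isd_id.
by apply: (multf_cst (fun=> 1) 1) => i; rewrite normr1.
Qed.

Lemma multf_reindex {I J : Type} (g : J -> I) (a : I -> R -> R) :
  multf a -> multf (fun j => a (g j)).
Proof.
move=> ma n; apply: (Ck_reindex (@PG)); last exact: ma.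
by move=> b [C [N bN]]; exists C, N => j x; exact: bN.
Qed.

Lemma schf_reindex {I J : Type} (g : J -> I) (a : I -> R -> R) :
  schf a -> schf (fun j => a (g j)).
Proof.
move=> ma n; apply: (Ck_reindex (@RD)); last exact: ma.
by move=> b bR j; have [C bC] := bR j; exists C => i x; exact: bC.
Qed.

Lemma multfN {I : Type} (a : I -> R -> R) : multf a -> multf (fun i x => - a i x).
Proof.
move=> ma; have := multf_mul _ _ (multf_cst (fun _ : I => -1) 1 _) ma.
rewrite (_ : (fun i x => -1 * a i x) = fun i x => - a i x).
  by apply=> i; rewrite normrN1.
by apply/funext => i; apply/funext => x; rewrite mulN1r.
Qed.

Lemma schfN {I : Type} (a : I -> R -> R) : schf a -> schf (fun i x => - a i x).
Proof.
move=> ma; have := schf_mul _ _ (multf_cst (fun _ : I => -1) 1 _) ma.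
rewrite (_ : (fun i x => -1 * a i x) = fun i x => - a i x).
  by apply=> i; rewrite normrN1.
by apply/funext => i; apply/funext => x; rewrite mulN1r.
Qed.

Lemma schfB {I : Type} (a b : I -> R -> R) : schf a -> schf b ->
  schf (fun i x => a i x - b i x).
Proof. by move=> sa sb; apply: schf_add => //; exact: schfN. Qed.

(** Only the function itself has to be bounded by hand once its derivative is
    known to be a multiplier; this is how difference quotients, singular in the
    step, are handled. *)
Lemma multf_derive {I : Type} (a b : I -> R -> R) : PG a ->
  (forall i (x : R), isd (a i) x (b i x)) -> multf b -> multf a.
Proof. by move=> Pa ab mb n; apply: Ck_succ; exact: (Ck_der _ _ _ b). Qed.

Lemma multf_isd {I : Type} (a : I -> R -> R) i (x : R) : multf a ->
  isd (a i) x (derive1 (a i) x).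
Proof. by move=> /(_ 1%N) [_ [da _]]; exact: isd_derivable. Qed.

Lemma multf_derive1 {I : Type} (a : I -> R -> R) : multf a ->
  multf (fun i => derive1 (a i)).
Proof. by move=> ma n; have [_ [_]] := ma n.+1. Qed.

Lemma schf_isd {I : Type} (a : I -> R -> R) i (x : R) : schf a ->
  isd (a i) x (derive1 (a i) x).
Proof. by move=> /(_ 1%N) [_ [da _]]; exact: isd_derivable. Qed.

Lemma schf_derive1 {I : Type} (a : I -> R -> R) : schf a ->
  schf (fun i => derive1 (a i)).
Proof. by move=> ma n; have [_ [_]] := ma n.+1. Qed.

Lemma schf_RD {I : Type} (a : I -> R -> R) : schf a -> RD a.
Proof. by move=> /(_ 0%N) []. Qed.

(** The derivatives of cos(m) and sin(m) are, up to sign, sin(m) and cos(m)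
    times the derivative of m, so both are treated by one induction on the number
    of derivatives. *)
Lemma multf_trig {I : Type} (m : I -> R -> R) : multf m ->
  multf (fun i x => cos (m i x)) /\ multf (fun i x => sin (m i x)).
Proof.
move=> mm; suff H n : Ck PG n (fun i x => cos (m i x)) /\
    Ck PG n (fun i x => sin (m i x)) by split=> n; have [] := H n.
have Pc : PG (fun i x => cos (m i x)).
  by exists 1, 0%N => i x; rewrite expr0 mulr1 cos_max.
have Ps : PG (fun i x => sin (m i x)).
  by exists 1, 0%N => i x; rewrite expr0 mulr1 sin_max.
elim: n => [|n [IHc IHs]]; first by [].
have m' := multf_derive1 _ mm n.
split.
  apply: (Ck_der _ _ _ (fun i x => - derive1 (m i) x * sin (m i x))) => //.
    move=> i x; apply: isd_eq; first by apply: isd_cos; exact: multf_isd.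
    by rewrite mulrC mulrN mulNr.
  apply: Ck_mul IHs; [exact: PG_add|exact: PG_mul|].
  exact: multfN (multf_derive1 _ mm) n.
apply: (Ck_der _ _ _ (fun i x => derive1 (m i) x * cos (m i x))) => //.
  move=> i x; apply: isd_eq; first by apply: isd_sin; exact: multf_isd.
  by rewrite mulrC.
apply: Ck_mul IHc; [exact: PG_add|exact: PG_mul|exact: m'].
Qed.

End Classes.

(** * Integrability of rapidly decreasing functions *)

Section Decay.
Context {R : realType}.
Notation mu := (@lebesgue_measure R).

Definition lorentz (x : R) : R := (1 + x ^+ 2)^-1.

Lemma lorentz_gt0 x : 0 < lorentz x.
Proof. by rewrite invr_gt0 ltr_pwDl// sqr_ge0. Qed.

Lemma continuous_lorentz : continuous lorentz.
Proof. exact: continuous_oneDsqrV. Qed.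

Lemma atan_lims : (atan (- n.+1%:R : R) @[n --> \oo] --> - (pi / 2)) /\
  (atan (n.+1%:R : R) @[n --> \oo] --> pi / 2).
Proof.
have H : (atan (n.+1%:R : R) @[n --> \oo] --> pi / 2).
  have : (n%:R : R) @[n --> \oo] --> +oo by exact: cvgr_idn.
  rewrite -(cvg_shiftS (fun n => n%:R : R)) => H.
  exact: ((cvg_pinftyP atan (pi / 2)).1 (@cvgy_atan R) (fun n => n.+1%:R) H).
split=> //; rewrite (_ : (fun n => _) = fun n => - atan (n.+1%:R : R)).
  exact: cvgN.
by apply/funext => n; rewrite atanN.
Qed.

Lemma natS_mono n m : (n <= m)%N -> - (m.+1%:R : R) <= - n.+1%:R /\ (n.+1%:R : R) <= m.+1%:R.
Proof. by move=> nm; rewrite lerN2 ler_nat ltnS. Qed.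

Lemma natS_exhaust (x : R) : \forall n \near \oo, - (n.+1%:R : R) <= x <= n.+1%:R.
Proof.
near=> n; rewrite -ler_norml; near: n.
have := @nbhs_infty_ger R `|x|; apply: filterS => n /le_trans; apply.
by rewrite ler_nat.
Unshelve. all: by end_near. Qed.

Lemma lorentz_int : igr setT lorentz /\ \int[mu]_x lorentz x = pi.
Proof.
have [l1 l2] := atan_lims.
have [] := exhaust_ge0 setT (fun n => - n.+1%:R) (fun n => n.+1%:R) lorentz atan
  (- (pi / 2)) (pi / 2); rewrite ?opprK -?splitr//.
- by apply: continuous_measurable_fun; exact: continuous_lorentz.
- by move=> x _; exact/ltW/lorentz_gt0.
- by move=> n; rewrite gtrN.
- exact: natS_mono.
- by move=> x _; exact: natS_exhaust.
- by move=> x _; exact: is_derive1_atan.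
- by move=> x _; exact: continuous_lorentz.
Qed.

(** Rapidly decreasing functions are dominated by (1 + x^2)^(-1), the basic
    integrable weight, whose primitive is the arctangent. *)
Lemma RD_lorentz {I : Type} (a : I -> R -> R) : RD a ->
  exists2 C, 0 <= C & forall i x, `|a i x| <= C * lorentz x.
Proof.
move=> /(_ 2%N) [C aC]; exists `|C| => // i x.
rewrite ler_pdivlMr ?ltr_pwDl ?sqr_ge0// (le_trans _ (ler_norm C))//.
apply: le_trans (aC i x); rewrite mulrC ler_wpM2r//.
rewrite sqrrD expr1n mul1r real_normK ?num_real// -addrA lerD2l.
by rewrite lerDr mulrn_wge0.
Qed.

Lemma schf_cts {I : Type} (a : I -> R -> R) i : schf a -> continuous (a i).
Proof. by move=> sa x; apply: isd_continuous; exact: schf_isd. Qed.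

Lemma schf_meas {I : Type} (a : I -> R -> R) i : schf a -> measurable_fun setT (a i).
Proof. by move=> sa; apply: continuous_measurable_fun; exact: schf_cts. Qed.

Lemma schf_igr {I : Type} (a : I -> R -> R) i : schf a -> igr setT (a i).
Proof.
move=> sa; have [C C0 aC] := RD_lorentz a (schf_RD _ sa).
apply: (igr_dom _ _ (fun x => C * lorentz x)) => //; first exact: schf_meas.
by apply: igrZ => //; exact: lorentz_int.1.
Qed.

End Decay.

(** * The Fourier transform preserves rapid decay *)

Section FourierFamilies.
Context {R : realType}.
Notation mu := (@lebesgue_measure R).

(** Real cosine and sine transforms: all analysis is done on them, since
    complex-valued integrals are defined by real and imaginary parts. *)
Definition Fc (a : R -> R) (p : R) : R := \int[mu]_x (a x * cos (p * x)).
Definition Fs (a : R -> R) (p : R) : R := \int[mu]_x (a x * sin (p * x)).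

(** The pairs (cos, -sin) and (sin, cos) of a bounded function and its bounded
    derivative are treated at once. *)
Section Kernel.
Variables (phi dphi : R -> R).
Hypothesis dphiE : forall y, isd phi y (dphi y).
Hypothesis phi1 : forall y, `|phi y| <= 1.
Hypothesis dphi1 : forall y, `|dphi y| <= 1.
Hypothesis cdphi : continuous dphi.

Lemma cphi : continuous phi.
Proof. by move=> x; exact: isd_continuous (dphiE x). Qed.

Lemma kernel_meas (k : R -> R) (p : R) : continuous k ->
  measurable_fun setT (fun x : measurableTypeR R => k (p * x)).
Proof.
move=> ck; apply: continuous_measurable_fun => x.
by apply: (@continuous_comp _ _ _ (fun x => p * x) k); [exact: mulrl_continuous|exact: ck].
Qed.

Lemma kernel_igr (a k : R -> R) (p : R) : continuous k ->
  (forall y, `|k y| <= 1) -> igr setT a -> igr setT (fun x => a x * k (p * x)).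
Proof.
move=> ck k1 ia; apply: (igrMb setT a (fun x => k (p * x)) 1) => //.
exact: kernel_meas.
Qed.

(** Differentiation under the integral sign, dominated by |x a(x)|. *)
Lemma kernel_isd a p : igr setT a -> igr setT (fun x => x * a x) ->
  isd (fun p => \int[mu]_x (a x * phi (p * x))) p
      (\int[mu]_x (x * a x * dphi (p * x))).
Proof.
move=> ia ixa.
pose f (q x : R) := a x * phi (q * x).
have df q x : isd (f ^~ x) q (x * a x * dphi (q * x)).
  apply: isd_eq; first by apply: isdZ; apply: (isd_comp phi);
    [exact: dphiE|apply: isdM; [exact: isd_id|exact: isd_cst]].
  by rewrite /=; ring.
have pE q x : partial1of2 f q x = x * a x * dphi (q * x) by exact: isd_val.
have Ip : `]p - 1, p + 1[%classic p.
  by rewrite /= in_itv/= ltrBlDr ltrDl ltr01.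
have H1 : forall q, `]p - 1, p + 1[%classic q -> igr setT (f q).
  by move=> q _; apply: kernel_igr => //; exact: cphi.
have H2 : forall q x, `]p - 1, p + 1[%classic q -> setT x -> derivable (f ^~ x) q 1.
  by move=> q x _ _; case: (df q x).
have H3 : forall x : R, 0 <= `|x * a x| by [].
have H4 : igr setT (fun x => `|x * a x|) by exact: igr_norm.
have H5 : forall q x, `]p - 1, p + 1[%classic q -> setT x ->
    `|partial1of2 f q x| <= `|x * a x|.
  by move=> q x _ _; rewrite pE normrM ler_piMr.
have der := @derivable_under_integral R _ _ mu f setT measurableT p _ _ Ip H1 H2
  _ H3 H4 H5.
have val := @differentiation_under_integral R _ _ mu f setT measurableT p _ _ Ip H1 H2
  _ H3 H4 H5.
apply: isd_eq; first exact: isd_derivable.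
rewrite val; apply: eq_Rintegral => x _; exact: pE.
Qed.

(** Integration by parts; the boundary terms vanish by the decay of a. *)
Lemma kernel_parts (a : R -> R) p : schf (fun _ : unit => a) ->
  \int[mu]_x (derive1 a x * phi (p * x)) =
  - p * \int[mu]_x (a x * dphi (p * x)).
Proof.
move=> sa; have sa' := schf_derive1 _ sa.
have ia := schf_igr _ tt sa; have ia' := schf_igr _ tt sa'.
have ca := schf_cts _ tt sa; have ca' := schf_cts _ tt sa'.
have i1 : igr setT (fun x => derive1 a x * phi (p * x)).
  by apply: kernel_igr => //; exact: cphi.
have i2 : igr setT (fun x => a x * dphi (p * x)) by exact: kernel_igr.
have cmp (k : R -> R) : continuous k -> continuous (fun x => k (p * x)).
  move=> ck x.
  by apply: (@continuous_comp _ _ _ (fun x => p * x) k); [exact: mulrl_continuous|exact: ck].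
have dF x : isd (fun x => a x * phi (p * x)) x
    (derive1 a x * phi (p * x) + p * (a x * dphi (p * x))).
  apply: isd_eq; first by apply: isdM; [exact: (schf_isd _ tt x sa)|
    apply: (isd_comp phi); [exact: dphiE|apply: isdZ; exact: isd_id]].
  by rewrite /=; ring.
have [C aC] := schf_RD _ sa 1%N.
have lim0 (u : nat -> R) : (forall n, `|u n| = n.+1%:R) ->
    (a (u n) * phi (p * u n)) @[n --> \oo] --> (0 : R).
  move=> un; apply: (@squeeze_cvgr _ _ _ _ (fun n => - C * harmonic n) (fun n => C * harmonic n)).
  - near=> n; rewrite mulNr -ler_norml normrM /harmonic/= ler_pdivlMr//.
    apply: le_trans (aC tt (u n)); rewrite expr1 un mulrC.
    apply: ler_pM => //; first by rewrite lerDr.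
    by rewrite ler_piMr.
  - by rewrite -(mulr0 (- C)); apply: cvgMr; exact: cvg_harmonic.
  - by rewrite -(mulr0 C); apply: cvgMr; exact: cvg_harmonic.
have E : \int[mu]_x (derive1 a x * phi (p * x) + p * (a x * dphi (p * x))) = 0 - 0.
  apply: (exhaust setT (fun n => - n.+1%:R) (fun n => n.+1%:R) _
    (fun x => a x * phi (p * x))) => //.
  - by apply: igrD => //; exact: igrZ.
  - by move=> n; rewrite gtrN.
  - by move=> x _; exact: natS_exhaust.
  - move=> x _; apply: cvgD.
      by apply: cvgM; [exact: ca'|exact: (cmp _ cphi)].
    by apply: cvgMr; apply: cvgM; [exact: ca|exact: (cmp _ cdphi)].
  - by apply: lim0 => n; rewrite normrN ger0_norm.
  - by apply: lim0 => n; rewrite ger0_norm.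
move: E; rewrite RintegralD//; last exact: igrZ.
rewrite RintegralZl// subr0 => /eqP; rewrite addr_eq0 => /eqP ->.
by rewrite mulNr.
Unshelve. all: by end_near. Qed.

End Kernel.

Lemma cts_Nsin : continuous (fun y : R => - sin y).
Proof. by move=> x; apply: cvgN; exact: continuous_sin. Qed.

Lemma Fc_isd a p : igr setT a -> igr setT (fun x => x * a x) ->
  isd (Fc a) p (- Fs (fun x => x * a x) p).
Proof.
move=> ia ixa; apply: isd_eq.
  apply: (kernel_isd cos (fun y => - sin y)) => //.
  - by move=> y; exact: is_derive_cos.
  - exact: cos_max.
  - by move=> y; rewrite normrN sin_max.
rewrite /Fs -mulN1r -RintegralZl//.
  by apply: eq_Rintegral => x _; rewrite mulrN mulN1r.
by apply: (kernel_igr _ sin) => //; [exact: continuous_sin|exact: sin_max].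
Qed.

Lemma Fs_isd a p : igr setT a -> igr setT (fun x => x * a x) ->
  isd (Fs a) p (Fc (fun x => x * a x) p).
Proof.
move=> ia ixa; apply: (kernel_isd sin cos) => //.
- by move=> y; exact: is_derive_sin.
- exact: sin_max.
- exact: cos_max.
Qed.

Lemma Fc_parts a p : schf (fun _ : unit => a) -> Fc (derive1 a) p = p * Fs a p.
Proof.
move=> sa; rewrite /Fc (kernel_parts cos (fun y => - sin y)) => //.
- rewrite /Fs mulNr -mulrN; congr (_ * _).
  rewrite -mulN1r -RintegralZl//.
    by apply: eq_Rintegral => x _; rewrite mulrN mulN1r opprK.
  apply: (kernel_igr _ (fun y => - sin y)) => //; last exact: (schf_igr _ tt sa).
    exact: cts_Nsin.
  by move=> y; rewrite normrN sin_max.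
- by move=> y; exact: is_derive_cos.
- exact: cos_max.
- by move=> y; rewrite normrN sin_max.
- exact: cts_Nsin.
Qed.

Lemma Fs_parts a p : schf (fun _ : unit => a) -> Fs (derive1 a) p = - p * Fc a p.
Proof.
move=> sa; rewrite /Fs (kernel_parts sin cos) => //.
- by move=> y; exact: is_derive_sin.
- exact: sin_max.
- exact: cos_max.
- exact: continuous_cos.
Qed.

Lemma Fcs_bound {I : Type} (a : I -> R -> R) : schf a ->
  exists C, forall i p, `|Fc (a i) p| <= C /\ `|Fs (a i) p| <= C.
Proof.
move=> sa; have [C C0 aC] := RD_lorentz a (schf_RD _ sa).
have iC : igr setT (fun x => C * lorentz x) by apply: igrZ => //; exact: lorentz_int.1.
exists (\int[mu]_x (C * lorentz x)) => i p.
have ia := schf_igr a i sa.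
split; apply: le_norm_integral => //.
- by apply: (kernel_igr _ cos) => //; [exact: continuous_cos|exact: cos_max].
- move=> x _; rewrite normrM (le_trans _ (aC i x))// ler_piMr//; exact: cos_max.
- by apply: (kernel_igr _ sin) => //; [exact: continuous_sin|exact: sin_max].
- move=> x _; rewrite normrM (le_trans _ (aC i x))// ler_piMr//; exact: sin_max.
Qed.

Lemma schf1 {I : Type} (a : I -> R -> R) i : schf a -> schf (fun _ : unit => a i).
Proof. exact: (schf_reindex (fun _ : unit => i)). Qed.

(** Each factor of p in front of a transform is traded for a derivative of the
    function, and transforms of integrable functions are bounded. *)
Lemma Fcs_RD {I : Type} (a : I -> R -> R) : schf a ->
  RD (fun i => Fc (a i)) /\ RD (fun i => Fs (a i)).
Proof.
move=> sa; suff H j : exists C, forall i p,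
    (1 + `|p|) ^+ j * `|Fc (a i) p| <= C /\ (1 + `|p|) ^+ j * `|Fs (a i) p| <= C.
  by split=> j; have [C HC] := H j; exists C => i p; have [] := HC i p.
elim: j a sa => [|j IH] a sa.
  by have [C aC] := Fcs_bound a sa; exists C => i p; rewrite expr0 !mul1r.
have [C HC] := IH _ sa; have [D HD] := IH _ (schf_derive1 _ sa).
exists (C + D) => i p; have [c1 s1] := HC i p; have [c2 s2] := HD i p.
have sai := schf1 _ i sa.
rewrite exprSr -!mulrA !mulrDl !mul1r !mulrDr; split; apply: lerD => //.
- by move: s2; rewrite Fs_parts// normrM normrN.
- by move: c2; rewrite Fc_parts// normrM.
Qed.

(** Derivatives of a transform are transforms of x a(x), up to sign, so the
    decay of [Fcs_RD] propagates to all orders. *)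
Lemma schf_fourier {I : Type} (a : I -> R -> R) : schf a ->
  schf (fun i => Fc (a i)) /\ schf (fun i => Fs (a i)).
Proof.
move=> sa; suff H n : Ck RD n (fun i => Fc (a i)) /\ Ck RD n (fun i => Fs (a i)).
  by split=> n; have [] := H n.
elim: n a sa => [|n IH] a sa.
  by have [] := Fcs_RD a sa.
have [rc rs] := Fcs_RD a sa.
have sxa : schf (fun i x => x * a i x) by apply: schf_mul => //; exact: multf_id.
split.
  apply: (Ck_der _ _ _ (fun i p => - Fs (fun x => x * a i x) p)) => //.
    by move=> i p; apply: Fc_isd; [exact: schf_igr|exact: (schf_igr _ i sxa)].
  have := (IH _ (schfN _ sxa)).2.
  rewrite (_ : (fun i => Fs (fun x => - (x * a i x))) =
    fun i p => - Fs (fun x => x * a i x) p)//.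
  apply/funext => i; apply/funext => p.
  rewrite /Fs -[RHS]mulN1r -RintegralZl//.
    by apply: eq_Rintegral => x _; rewrite mulN1r mulNr.
  apply: (kernel_igr _ sin) => //; last exact: (schf_igr _ i sxa).
    exact: continuous_sin.
  exact: sin_max.
apply: (Ck_der _ _ _ (fun i p => Fc (fun x => x * a i x) p)) => //.
  by move=> i p; apply: Fs_isd; [exact: schf_igr|exact: (schf_igr _ i sxa)].
exact: (IH _ sxa).1.
Qed.

End FourierFamilies.

(** * Fourier inversion through the Poisson kernel *)

Section Inversion.
Context {R : realType}.
Notation mu := (@lebesgue_measure R).

Lemma lipschitz (a a' : R -> R) (K : R) : (forall z, isd a z (a' z)) ->
  (forall z, `|a' z| <= K) -> forall x y, `|a y - a x| <= K * `|y - x|.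
Proof.
move=> da aK x y; wlog xy : x y / x <= y.
  move=> H; have [|/ltW] := leP x y; first exact: H.
  by move=> /H; rewrite distrC (distrC x).
have [z _ ->] := MVT_segment xy (fun z _ => da z)
  (derivable_within_continuous (fun z _ => isd_ex _ _ _ (da z))).
by rewrite normrM ler_wpM2r.
Qed.

Lemma le_expN (y : R) : 0 <= y -> expR (- y) <= (1 + y ^+ 2 / 4)^-1.
Proof.
move=> y0; rewrite expRN lef_pV2 ?posrE ?expR_gt0//; last first.
  by rewrite ltr_pwDl// divr_ge0// sqr_ge0.
have -> : expR y = expR (y / 2) ^+ 2 by rewrite expr2 -expRD -splitr.
have H : 1 + y / 2 <= expR (y / 2) by exact: expR_ge1Dx.
have := lerXn2r 2 _ _ H; rewrite !nnegrE expR_ge0 addr_ge0 ?divr_ge0// => /(_ isT isT).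
by apply: le_trans; rewrite sqrrD; lra.
Qed.

Lemma expN_harmonic (e : R) n : 0 < e -> expR (- (e * n.+2%:R)) <= e^-1 * harmonic n.
Proof.
move=> e0; rewrite expRN /harmonic/= -invfM lef_pV2 ?posrE ?expR_gt0//; last first.
  by rewrite mulr_gt0.
apply: (@le_trans _ _ (1 + e * n.+2%:R)); last exact: expR_ge1Dx.
by rewrite -[n.+2%:R]natr1 mulrDr mulr1 addrCA lerDl addr_ge0// ltW.
Qed.

Lemma exp_abs_igr (e : R) : 0 < e -> igr setT (fun p => expR (- (e * `|p|))).
Proof.
move=> e0; apply: (igr_dom _ _ (fun p => (1 + 4 / e ^+ 2) * lorentz p)) => //.
- apply: continuous_measurable_fun; apply: (cts_comp expR); first exact: continuous_expR.
  by apply: ctsN; apply: ctsZ; exact: cts_norm.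
- by apply: igrZ => //; exact: lorentz_int.1.
move=> p _; rewrite ger0_norm ?expR_ge0//.
apply: le_trans (le_expN _ _) _; first by rewrite mulr_ge0// ltW.
rewrite /lorentz exprMn real_normK ?num_real//.
have p2 : 0 <= p ^+ 2 by exact: sqr_ge0.
have e2 : 0 < e ^+ 2 by rewrite exprn_gt0.
move: (p ^+ 2) (e ^+ 2) p2 e2 => P E P0 E0.
rewrite ler_pdivlMr ?ltr_pwDl// mulrC ler_pdivrMr; last by rewrite ltr_pwDl// divr_ge0//
  mulr_ge0// ltW.
have -> : (1 + 4 / E) * (1 + E * P / 4) = 1 + P + E * P / 4 + 4 / E by field; rewrite gt_eqF.
have : 0 <= E * P / 4 by rewrite divr_ge0// mulr_ge0// ltW.
have : 0 <= 4 / E by rewrite divr_ge0// ltW.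
by lra.
Qed.

Lemma harmonic_lt n : harmonic n < n.+2%:R :> R.
Proof.
by rewrite /harmonic/= (@le_lt_trans _ _ 1)// ?invf_le1// ?ler1n// ltr1n.
Qed.

Lemma harmonic_anti n m : (n <= m)%N -> harmonic m <= harmonic n :> R.
Proof. by move=> nm; rewrite /harmonic/= lef_pV2 ?posrE// ler_nat ltnS. Qed.

Lemma pos_exhaust (x : R) : 0 < x ->
  \forall n \near \oo, harmonic n <= x <= n.+2%:R.
Proof.
move=> x0; have H1 : \forall n \near \oo, harmonic n <= x.
  have /cvgrPdist_le/(_ _ x0) := @cvg_harmonic R; apply: filterS => n.
  by rewrite sub0r normrN ger0_norm// invr_ge0.
have H2 : \forall n \near \oo, x <= n.+2%:R.
  have := @nbhs_infty_ger R x; apply: filterS => n /le_trans; apply.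
  by rewrite ler_nat -addn2 leq_addr.
by near=> n; apply/andP; split; near: n.
Unshelve. all: by end_near. Qed.

(** The exhausting segments start at a positive number because the half-line is
    open; continuity of F at 0 recovers F 0. *)
Lemma int_pos (h F : R -> R) (l : R) : igr `]0, +oo[ h ->
  (forall p, isd F p (h p)) -> continuous h ->
  F n.+2%:R @[n --> \oo] --> l -> \int[mu]_(p in `]0, +oo[) h p = l - F 0.
Proof.
move=> ih dF ch Fl.
apply: (exhaust _ harmonic (fun n => n.+2%:R) _ F) => //.
- exact: harmonic_lt.
- move=> n x /andP[+ _] /=; rewrite in_itv/= andbT; apply: lt_le_trans.
  by rewrite /harmonic/= invr_gt0.
- by move=> x /=; rewrite in_itv/= andbT; exact: pos_exhaust.
- by move=> x _; exact: ch.
- by apply: (cvg_comp _ _ cvg_harmonic); exact: isd_continuous (dF 0).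
Qed.

Lemma int_neg (h F : R -> R) (l : R) : igr `]-oo, 0[ h ->
  (forall p, isd F p (h p)) -> continuous h ->
  F (- n.+2%:R) @[n --> \oo] --> l -> \int[mu]_(p in `]-oo, 0[) h p = F 0 - l.
Proof.
move=> ih dF ch Fl.
apply: (exhaust _ (fun n => - n.+2%:R) (fun n => - harmonic n) _ F) => //.
- by move=> n; rewrite ltrN2 harmonic_lt.
- move=> n x /andP[_ +] /=; rewrite in_itv/= => /le_lt_trans; apply.
  by rewrite oppr_lt0 /harmonic/= invr_gt0.
- move=> x /=; rewrite in_itv/= => x0.
  have /pos_exhaust : 0 < - x by rewrite oppr_gt0.
  by apply: filterS => n; rewrite lerNr lerNl andbC.
- by move=> x _; exact: ch.
- have -> : F 0 = F (- 0) by rewrite oppr0.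
  have c : {for - 0, continuous F} by exact: isd_continuous (dF _).
  have hN : (- harmonic n : R) @[n --> \oo] --> - (0 : R).
    by apply: cvgN; exact: cvg_harmonic.
  exact: (cvg_comp _ _ hN c).
Qed.

(** Real part of e^{(c + iz) p} / (c + iz); [expsin_isd] is its imaginary part. *)
Lemma expcos_isd (c z p : R) : c != 0 ->
  isd (fun p => expR (c * p) * (c * cos (p * z) + z * sin (p * z)) / (c ^+ 2 + z ^+ 2)) p
    (expR (c * p) * cos (p * z)).
Proof.
move=> c0; have D0 : c ^+ 2 + z ^+ 2 != 0.
  by rewrite gt_eqF// ltr_pwDl// ?sqr_ge0// exprn_even_gt0.
have dpz : isd (fun p => p * z) p z.
  by apply: isd_eq; [apply: isdM; [exact: isd_id|exact: isd_cst]|rewrite /=; ring].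
apply: isd_eq.
  apply: isdM; last exact: isd_cst.
  apply: isdM; first by apply: isd_exp; apply: isdZ; exact: isd_id.
  by apply: isdD; apply: isdZ; [apply: isd_cos|apply: isd_sin]; exact: dpz.
by rewrite /=; field.
Qed.

Lemma expsin_isd (c z p : R) : c != 0 ->
  isd (fun p => expR (c * p) * (c * sin (p * z) - z * cos (p * z)) / (c ^+ 2 + z ^+ 2)) p
    (expR (c * p) * sin (p * z)).
Proof.
move=> c0; have D0 : c ^+ 2 + z ^+ 2 != 0.
  by rewrite gt_eqF// ltr_pwDl// ?sqr_ge0// exprn_even_gt0.
have dpz : isd (fun p => p * z) p z.
  by apply: isd_eq; [apply: isdM; [exact: isd_id|exact: isd_cst]|rewrite /=; ring].
apply: isd_eq.
  apply: isdM; last exact: isd_cst.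
  apply: isdM; first by apply: isd_exp; apply: isdZ; exact: isd_id.
  by apply: isdB; apply: isdZ; [apply: isd_sin|apply: isd_cos]; exact: dpz.
by rewrite /=; field.
Qed.

(** An exponential e^{-e n} is dominated by a multiple of 1/n, and squeezing
    between harmonic sequences suffices. *)
Lemma damped_cvg0 (e : R) (C : R) (v : nat -> R) : 0 < e ->
  (forall n, `|v n| <= C * expR (- (e * n.+2%:R))) -> v n @[n --> \oo] --> (0 : R).
Proof.
move=> e0 vC.
have C0 : 0 <= C by have := le_trans (normr_ge0 _) (vC 0%N); rewrite pmulr_lge0// expR_gt0.
apply: (@squeeze_cvgr _ _ _ _ (fun n => - (C / e) * harmonic n) (fun n => C / e * harmonic n)).
- near=> n; rewrite mulNr -ler_norml (le_trans (vC n))// -mulrA ler_wpM2l//.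
  exact: expN_harmonic.
- by rewrite -(mulr0 (- (C / e))); apply: cvgMr; exact: cvg_harmonic.
- by rewrite -(mulr0 (C / e)); apply: cvgMr; exact: cvg_harmonic.
Unshelve. all: by end_near. Qed.

Lemma trig_comb_le (a b c s : R) : `|c| <= 1 -> `|s| <= 1 ->
  `|a * c + b * s| <= `|a| + `|b|.
Proof.
by move=> c1 s1; rewrite (le_trans (ler_normD _ _))// !normrM lerD// ler_piMr.
Qed.

Lemma split_line (h : R -> R) : igr setT h ->
  \int[mu]_p h p = \int[mu]_(p in `]-oo, 0[) h p + \int[mu]_(p in `]0, +oo[) h p.
Proof.
move=> ih.
rewrite Rintegral_itv_obnd_cbnd; last exact: (igrS _ _ _ _ ih).
rewrite -Rintegral_setU//.
- by rewrite -setCitvr setvU.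
- by apply: (igrS _ _ _ _ ih) => //; exact: measurableU.
- apply/disj_setPS => y [] /=; rewrite !in_itv/= andbT => y0 y0'.
  by have := lt_le_trans y0 y0'; rewrite ltxx.
Qed.

(** The damping factor is an exponential on each half-line, where explicit
    primitives are available. *)
Lemma poisson_kernel (e z : R) : 0 < e ->
  \int[mu]_p (expR (- (e * `|p|)) * cos (p * z)) = 2 * e / (e ^+ 2 + z ^+ 2) /\
  \int[mu]_p (expR (- (e * `|p|)) * sin (p * z)) = 0.
Proof.
move=> e0; have ie := exp_abs_igr e e0.
have e0' : e != 0 by rewrite gt_eqF.
have Ne0 : - e != 0 by rewrite oppr_eq0.
have D0 : 0 < e ^+ 2 + z ^+ 2 by rewrite ltr_pwDl// ?sqr_ge0// exprn_gt0.
have ck (k : R -> R) : continuous k -> continuous (fun p : R => k (p * z)).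
  by move=> ck; apply: (cts_comp k) => //; apply: ctsM; [exact: cts_id|exact: cts_cst].
have ik (k : R -> R) : continuous k -> (forall y, `|k y| <= 1) ->
    igr setT (fun p => expR (- (e * `|p|)) * k (p * z)).
  move=> ck' k1; apply: (igrMb _ _ (fun p => k (p * z)) 1) => //.
  by apply: continuous_measurable_fun; exact: ck.
have ce (c : R) : continuous (fun p : R => expR (c * p)).
  by apply: (cts_comp expR); [exact: continuous_expR|apply: ctsZ; exact: cts_id].
have igrP (k : R -> R) : igr setT (fun p => expR (- (e * `|p|)) * k (p * z)) ->
    igr `]0, +oo[ (fun p => expR (- e * p) * k (p * z)).
  move=> /(igrS `]0, +oo[) ik'; apply: eq_igr (ik' _ _ _) => // p /=.
  by rewrite in_itv/= andbT => p0; rewrite gtr0_norm// mulNr.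
have igrN' (k : R -> R) : igr setT (fun p => expR (- (e * `|p|)) * k (p * z)) ->
    igr `]-oo, 0[ (fun p => expR (e * p) * k (p * z)).
  move=> /(igrS `]-oo, 0[) ik'; apply: eq_igr (ik' _ _ _) => // p /=.
  by rewrite in_itv/= => p0; rewrite ltr0_norm// mulrN opprK.
have eqP (k : R -> R) : \int[mu]_(p in `]0, +oo[) (expR (- (e * `|p|)) * k (p * z)) =
    \int[mu]_(p in `]0, +oo[) (expR (- e * p) * k (p * z)).
  apply: eq_Rintegral => p; rewrite inE/= in_itv/= andbT => p0.
  by rewrite gtr0_norm// mulNr.
have eqN (k : R -> R) : \int[mu]_(p in `]-oo, 0[) (expR (- (e * `|p|)) * k (p * z)) =
    \int[mu]_(p in `]-oo, 0[) (expR (e * p) * k (p * z)).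
  apply: eq_Rintegral => p; rewrite inE/= in_itv/= => p0.
  by rewrite ltr0_norm// mulrN opprK.
have ic := ik cos (@continuous_cos R) (@cos_max R).
have isn := ik sin (@continuous_sin R) (@sin_max R).
have dmp (c : R) (u : nat -> R) (A B : R) (k1 k2 : R -> R) :
    (forall n, c * u n = - (e * n.+2%:R)) ->
    (forall y, `|k1 y| <= 1) -> (forall y, `|k2 y| <= 1) ->
    expR (c * u n) * (A * k1 (u n * z) + B * k2 (u n * z)) / (c ^+ 2 + z ^+ 2)
      @[n --> \oo] --> (0 : R).
  move=> cu k11 k21.
  apply: (damped_cvg0 e ((`|A| + `|B|) / `|c ^+ 2 + z ^+ 2|)) => // n.
  rewrite !normrM normfV cu ger0_norm ?expR_ge0// mulrAC [leRHS]mulrC -mulrA.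
  rewrite ler_wpM2l ?expR_ge0// mulrC ler_wpM2r ?invr_ge0//; exact: trig_comb_le.
split; rewrite split_line//.
  rewrite eqP eqN.
  rewrite (int_neg _ _ 0 (igrN' _ ic) (fun p => expcos_isd e z p e0')); first last.
  - by apply: (dmp e (fun n => - n.+2%:R)) => // n;
      [rewrite mulrN|exact: cos_max|exact: sin_max].
  - by move=> p; apply: cvgM; [exact: ce|exact: (ck cos (@continuous_cos R))].
  rewrite (int_pos _ _ 0 (igrP _ ic) (fun p => expcos_isd (- e) z p Ne0)); first last.
  - by apply: (dmp (- e) (fun n => n.+2%:R)) => // n;
      [rewrite mulNr|exact: cos_max|exact: sin_max].
  - by move=> p; apply: cvgM; [exact: ce|exact: (ck cos (@continuous_cos R))].
  rewrite !(mulr0, mul0r) expR0 cos0 sin0; field.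
  by rewrite gt_eqF.
rewrite eqP eqN.
rewrite (int_neg _ _ 0 (igrN' _ isn) (fun p => expsin_isd e z p e0')); first last.
- under eq_cvg do rewrite -mulNr.
  by apply: (dmp e (fun n => - n.+2%:R)) => // n;
    [rewrite mulrN|exact: sin_max|exact: cos_max].
- by move=> p; apply: cvgM; [exact: ce|exact: (ck sin (@continuous_sin R))].
rewrite (int_pos _ _ 0 (igrP _ isn) (fun p => expsin_isd (- e) z p Ne0)); first last.
- under eq_cvg do rewrite -mulNr.
  by apply: (dmp (- e) (fun n => n.+2%:R)) => // n;
    [rewrite mulNr|exact: sin_max|exact: cos_max].
- by move=> p; apply: cvgM; [exact: ce|exact: (ck sin (@continuous_sin R))].
rewrite !(mulr0, mul0r) expR0 cos0 sin0 sqrrN; ring.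
Qed.

Lemma cvg_atan_affine (x e : R) : 0 < e ->
  (atan ((n.+1%:R - x) / e) @[n --> \oo] --> pi / 2).
Proof.
move=> e0.
apply: ((cvg_pinftyP atan (pi / 2)).1 (@cvgy_atan R) (fun n => (n.+1%:R - x) / e)).
apply/cvgryPge => A; have := @nbhs_infty_ger R (A * e + x); apply: filterS => n H.
rewrite ler_pdivlMr// lerBrDr (le_trans H)//.
by rewrite ler_nat.
Qed.

Definition poisson (e x y : R) : R := 2 * e / (e ^+ 2 + (y - x) ^+ 2).

Lemma poisson_gt0 e x y : 0 < e -> 0 < poisson e x y.
Proof.
by move=> e0; rewrite divr_gt0 ?mulr_gt0// ltr_pwDl ?exprn_gt0// sqr_ge0.
Qed.

Lemma cts_poisson e x : 0 < e -> continuous (poisson e x).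
Proof.
move=> e0; apply: ctsM; first exact: cts_cst.
move=> y; apply: cvgV.
  by rewrite gt_eqF// ltr_pwDl ?exprn_gt0// sqr_ge0.
apply: (ctsD (fun=> e ^+ 2) (fun y => (y - x) ^+ 2)); first exact: cts_cst.
rewrite (_ : (fun y => (y - x) ^+ 2) = fun y => (y - x) * (y - x)); last first.
  by apply/funext => u; rewrite expr2.
by apply: ctsM; apply: ctsD; (exact: cts_id || exact: cts_cst).
Qed.

Lemma poisson_int e x : 0 < e ->
  igr setT (poisson e x) /\ \int[mu]_y poisson e x y = 2 * pi.
Proof.
move=> e0; have e0' : e != 0 by rewrite gt_eqF.
have -> : 2 * pi = 2 * (pi / 2) - - (2 * (pi / 2)) :> R by field.
apply: (exhaust_ge0 setT (fun n => - n.+1%:R) (fun n => n.+1%:R) _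
   (fun y => 2 * atan ((y - x) / e))) => //.
- by apply: continuous_measurable_fun; exact: cts_poisson.
- by move=> y _; exact/ltW/poisson_gt0.
- by move=> n; rewrite gtrN.
- exact: natS_mono.
- by move=> y _; exact: natS_exhaust.
- move=> y _; apply: isd_eq.
    apply: isdZ; apply: (isd_comp atan); first exact: is_derive1_atan.
    by apply: isdM; [apply: isdB; [exact: isd_id|exact: isd_cst]|exact: isd_cst].
  rewrite /poisson/=; field; rewrite e0' andbT/=.
  by rewrite gt_eqF// ltr_pwDl ?exprn_gt0// sqr_ge0.
- by move=> y _; exact: cts_poisson.
- rewrite -mulrN; apply: cvgMr.
  rewrite (_ : (fun n => _) = fun n => - atan ((n.+1%:R - (- x)) / e)); last first.
    by apply/funext => n; rewrite -atanN -mulNr; congr (atan (_ / _)); ring.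
  by apply: cvgN; exact: cvg_atan_affine.
- by apply: cvgMr; exact: cvg_atan_affine.
Qed.

(** Approximate identity: as the kernel has mass 2 pi, the claim is that
    (a(y) - a(x)) times the kernel has integral tending to 0.  Near x the Lipschitz
    bound K and far from x the bound 2 M on the increments of a show that this
    product is dominated, for every scale at most 1, by a multiple of the kernel
    of scale 1, and it tends to 0 pointwise. *)
Lemma poisson_cvg (a : R -> R) (x : R) : schf (fun _ : unit => a) ->
  (\int[mu]_y (a y * poisson (harmonic n) x y)) @[n --> \oo] --> 2 * pi * a x.
Proof.
move=> sa.
have hn n : 0 < harmonic n :> R by rewrite invr_gt0.
have hn1 n : harmonic n <= 1 :> R by rewrite invf_le1// ler1n.
have [M aM] := schf_RD _ sa 0%N.
have [K aK] := schf_RD _ (schf_derive1 _ sa) 0%N.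
have {}aM z : `|a z| <= M by have := aM tt z; rewrite expr0 mul1r.
have {}aK z : `|derive1 a z| <= K by have := aK tt z; rewrite expr0 mul1r.
have M0 : 0 <= M by exact: le_trans (aM 0).
have K0 : 0 <= K by exact: le_trans (aK 0).
have lip := lipschitz a _ K (fun z => schf_isd _ tt z sa) aK.
have ia := schf_igr _ tt sa; have ca := schf_cts _ tt sa.
have bP n : forall y, `|poisson (harmonic n) x y| <= 2 / harmonic n.
  move=> y; rewrite gtr0_norm ?poisson_gt0// /poisson.
  have := hn n; move: (harmonic n) => e e0.
  rewrite ler_pdivrMr; last by rewrite ltr_pwDl ?exprn_gt0// sqr_ge0.
  rewrite mulrDr expr2 mulrA -[2 / e * e]mulrA mulVf ?gt_eqF// mulr1 lerDl.
  by rewrite mulr_ge0 ?sqr_ge0// divr_ge0// ltW.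
have mP n : measurable_fun setT (poisson (harmonic n) x).
  by apply: continuous_measurable_fun; exact: cts_poisson.
have iaP n : igr setT (fun y => a y * poisson (harmonic n) x y).
  apply: (igrMb setT a _ (2 / harmonic n)) => //; first exact: mP.
pose h_ n y := (a y - a x) * poisson (harmonic n) x y.
have mh n : measurable_fun setT (h_ n).
  apply: continuous_measurable_fun; apply: ctsM; last exact: cts_poisson.
  by apply: ctsD; [exact: ca|exact: cts_cst].
have [_] : igr setT (fun=> 0 : R) /\ (\int[mu]_y h_ n y) @[n --> \oo] --> \int[mu]_(y in setT)
  (0 : R).
  apply: (dominated_cvg setT h_ (fun=> 0) (fun y => (K + 4 * M) * poisson 1 x y)) => //.
  - by apply: igrZ => //; exact: (poisson_int 1 x ltr01).1.
  - move=> n y _; rewrite normrM [X in _ * X]gtr0_norm ?poisson_gt0// /poisson.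
    have D1 := lip x y.
    have D2 : `|a y - a x| <= 2 * M.
      by rewrite (le_trans (ler_normB _ _))// mulr_natl mulr2n lerD.
    rewrite -[(y - x) ^+ 2]real_normK ?num_real//.
    have := hn n; have := hn1 n; move: (harmonic n) D1 D2 => e.
    move: `|a y - a x| `|y - x| (normr_ge0 (a y - a x)) (normr_ge0 (y - x)).
    move=> D d D0 d0 D1 D2 e1 e0.
    rewrite expr1n mulr1 !mulrA ler_pdivrMr; last by rewrite ltr_pwDl ?exprn_gt0// sqr_ge0.
    rewrite [leRHS]mulrAC ler_pdivlMr; last by rewrite ltr_pwDl ?sqr_ge0.
    (* In the factor 1 + d^2 of the left-hand side, the term 1 is handled by the
       Lipschitz bound D1 and the term d^2 by D2. *)
    have q1 : 2 * e * d <= e ^+ 2 + d ^+ 2 by have := sqr_ge0 (e - d); nra.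
    have q2 : D * 2 * e <= K * (e ^+ 2 + d ^+ 2).
      apply: (@le_trans _ _ (K * (2 * e * d))); last by rewrite ler_wpM2l.
      have : D * (2 * e) <= K * d * (2 * e) by rewrite ler_wpM2r// mulr_ge0// ltW.
      by lra.
    have q3 : D * 2 * e <= 4 * M.
      have : D * e <= 2 * M * 1 by apply: ler_pM => //; exact: ltW.
      by lra.
    have q4 : D * 2 * e * d ^+ 2 <= 4 * M * (e ^+ 2 + d ^+ 2).
      apply: (@le_trans _ _ (4 * M * d ^+ 2)); first by rewrite ler_wpM2r// sqr_ge0.
      by rewrite ler_wpM2l ?mulr_ge0// lerDr sqr_ge0.
    have K2 : 0 <= K * (e ^+ 2 + d ^+ 2) by rewrite mulr_ge0// addr_ge0 ?sqr_ge0.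
    have M2 : 0 <= M * (e ^+ 2 + d ^+ 2) by rewrite mulr_ge0// addr_ge0 ?sqr_ge0.
    by lra.
  - move=> y _; rewrite /h_; have [->|yx] := eqVneq y x.
      by rewrite subrr; under eq_cvg do rewrite mul0r; exact: cvg_cst.
    have d0 : 0 < (y - x) ^+ 2 by rewrite exprn_even_gt0//= subr_eq0.
    rewrite -(mulr0 (a y - a x)); apply: cvgMr.
    apply: (@squeeze_cvgr _ _ _ _ (fun=> 0) (fun n => 2 / (y - x) ^+ 2 * harmonic n)).
    + near=> n; apply/andP; split; first exact/ltW/poisson_gt0.
      rewrite /poisson mulrAC; apply: ler_wpM2r; first exact: ltW.
      apply: ler_wpM2l => //; rewrite lef_pV2 ?posrE ?lerDr ?sqr_ge0//.
      by rewrite ltr_wpDl// sqr_ge0.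
    + exact: cvg_cst.
    + by rewrite -(mulr0 (2 / (y - x) ^+ 2)); apply: cvgMr; exact: cvg_harmonic.
rewrite (_ : \int[mu]_(y in setT) (0 : R) = 0); last first.
  by rewrite /Rintegral integral0.
move=> H0.
rewrite -[2 * pi * a x]add0r.
rewrite (_ : (fun n => _) = fun n => \int[mu]_y h_ n y + 2 * pi * a x).
  by apply: cvgD => //; exact: cvg_cst.
apply/funext => n; have [iP EP] := poisson_int (harmonic n) x (hn n).
rewrite /h_ mulrC -EP -RintegralZl// -RintegralD//; last exact: igrZ.
  by apply: eq_Rintegral => y _; ring.
have := igrB _ _ _ measurableT (iaP n) (igrZ _ (a x) _ measurableT iP).
by apply: eq_igr => // y _; ring.
Unshelve. all: by end_near. Qed.

(** Real and imaginary parts of e^{ixp} times the Fourier transform of the real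
    function a at p. *)
Definition Gc (a : R -> R) (x p : R) := Fc a p * cos (p * x) + Fs a p * sin (p * x).
Definition Gs (a : R -> R) (x p : R) := Fc a p * sin (p * x) - Fs a p * cos (p * x).

(** With the factor e^{-e|p|} inserted, Fubini turns the inversion integral into
    the convolution of a with the Poisson kernel, which tends to 2 pi a(x); the
    factor is then removed by dominated convergence, since the transforms of a
    Schwartz function are integrable. *)
Lemma fourier_inversion (a : R -> R) (x : R) : schf (fun _ : unit => a) ->
  [/\ igr setT (Gc a x), igr setT (Gs a x),
    \int[mu]_p Gc a x p = 2 * pi * a x & \int[mu]_p Gs a x p = 0].
Proof.
move=> sa; have ia := schf_igr _ tt sa.
have [sc ss] := schf_fourier _ sa.
have iFc := schf_igr _ tt sc; have iFs := schf_igr _ tt ss.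
have mk (k : R -> R) : continuous k -> measurable_fun setT (fun p : R => k (p * x)).
  move=> ck; apply: continuous_measurable_fun; apply: (cts_comp k) => //.
  by apply: ctsM; [exact: cts_id|exact: cts_cst].
have ik (b k : R -> R) : continuous k -> (forall y, `|k y| <= 1) -> igr setT b ->
    igr setT (fun p => b p * k (p * x)).
  by move=> ck k1 ib; apply: (igrMb _ _ (fun p => k (p * x)) 1) => //; exact: mk.
have csin := @continuous_sin R; have ccos := @continuous_cos R.
have sin1 := @sin_max R; have cos1 := @cos_max R.
have iGc : igr setT (Gc a x) by apply: igrD => //; apply: ik.
have iGs : igr setT (Gs a x) by apply: igrB => //; apply: ik.
have mkpy (k : R -> R) (p : R) : continuous k ->
    measurable_fun setT (fun y : measurableTypeR R => k (p * y)).
  by move=> ck; exact: kernel_meas.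
have ikpy (k : R -> R) (p : R) : continuous k -> (forall y, `|k y| <= 1) ->
    igr setT (fun y => a y * k (p * y)).
  by move=> ck k1; exact: kernel_igr.
have GcE p : Gc a x p = \int[mu]_y (a y * cos (p * (y - x))).
  rewrite /Gc /Fc /Fs -!RintegralZr ?ikpy// -RintegralD//; last 2 first.
  - have := igrZ _ (cos (p * x)) _ measurableT (ikpy _ p ccos cos1).
    by apply: eq_igr => // y _; rewrite mulrC.
  - have := igrZ _ (sin (p * x)) _ measurableT (ikpy _ p csin sin1).
    by apply: eq_igr => // y _; rewrite mulrC.
  by apply: eq_Rintegral => y _; rewrite mulrBr cosB; ring.
have GsE p : Gs a x p = - \int[mu]_y (a y * sin (p * (y - x))).
  rewrite /Gs /Fc /Fs -!RintegralZr ?ikpy// -RintegralB//; last 2 first.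
  - have := igrZ _ (sin (p * x)) _ measurableT (ikpy _ p ccos cos1).
    by apply: eq_igr => // y _; rewrite mulrC.
  - have := igrZ _ (cos (p * x)) _ measurableT (ikpy _ p csin sin1).
    by apply: eq_igr => // y _; rewrite mulrC.
  rewrite -mulN1r -RintegralZl//.
    by apply: eq_Rintegral => y _; rewrite mulrBr sinB; ring.
  apply: (igrMb _ _ (fun y => sin (p * (y - x))) 1) => //.
  apply: continuous_measurable_fun; apply: (cts_comp sin) => //.
  by apply: ctsZ; apply: ctsD; [exact: cts_id|exact: cts_cst].
have hn n : 0 < harmonic n :> R by rewrite invr_gt0.
pose E (n : nat) (p : R) : R := expR (- (harmonic n * `|p|)).
have iE n : igr setT (E n) by exact: exp_abs_igr.
have mkk (k : R -> R) : continuous k ->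
    measurable_fun setT (fun z : R * R => k (z.1 * (z.2 - x))).
  move=> ck; apply: (measurableT_comp (f := k)); first exact: continuous_measurable_fun.
  by apply: measurable_funM => //; apply: measurable_funB.
have Fub (k : R -> R) n : continuous k -> (forall y, `|k y| <= 1) ->
    \int[mu]_p (E n p * \int[mu]_y (a y * k (p * (y - x)))) =
    \int[mu]_y (a y * \int[mu]_p (E n p * k (p * (y - x)))).
  move=> ck k1.
  exact: (fubini_kernel (E n) a (fun z => k (z.1 * (z.2 - x))) (iE n) ia (mkk k ck) _).2.
have Ecvg p : E n p @[n --> \oo] --> (1 : R).
  rewrite -expR0 -oppr0; apply: continuous_cvg; first exact: continuous_expR.
  by apply: cvgN; rewrite -(mul0r `|p|); apply: cvgMl; exact: cvg_harmonic.
have E1 n p : `|E n p| <= 1.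
  by rewrite ger0_norm ?expR_ge0// -expR0 ler_expR oppr_le0 mulr_ge0// ltW.
have damp (G : R -> R) : igr setT G ->
    (\int[mu]_p (E n p * G p)) @[n --> \oo] --> \int[mu]_p G p.
  move=> iG; have [] // := dominated_cvg setT (fun n p => E n p * G p) G (fun p => `|G p|).
  - by move=> n; apply: measurable_funM; [exact: igr_meas (iE n)|exact: igr_meas iG].
  - exact: igr_norm.
  - by move=> n p _; rewrite normrM ler_piMl.
  - by move=> p _; rewrite -[G p in X in _ --> X]mul1r; apply: cvgMl; exact: Ecvg.
split=> //.
  have := damp _ iGc; move=> /cvg_unique; apply => //.
  have := poisson_cvg a x sa; apply: cvg_trans; apply: near_eq_cvg.
  near=> n.
  transitivity (\int[mu]_p (E n p * \int[mu]_y (a y * cos (p * (y - x))))).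
    rewrite Fub//; apply: eq_Rintegral => y _; congr (_ * _).
    by rewrite /E (poisson_kernel _ (y - x) (hn n)).1.
  by apply: eq_Rintegral => p _; rewrite GcE.
have := damp _ iGs; move=> /cvg_unique; apply => //.
have c0 : (fun=> 0 : R) @ \oo --> (0 : R) by exact: cvg_cst.
apply: cvg_trans c0; apply: near_eq_cvg.
near=> n.
transitivity (- \int[mu]_p (E n p * \int[mu]_y (a y * sin (p * (y - x))))).
  rewrite Fub//; apply/esym/eqP; rewrite oppr_eq0; apply/eqP.
  rewrite (_ : \int[mu]_y _ = \int[mu]_(y in setT) (0 : R)).
    by rewrite /Rintegral integral0.
  apply: eq_Rintegral => y _.
  by rewrite /E (poisson_kernel _ (y - x) (hn n)).2 mulr0.
rewrite -mulN1r -RintegralZl//.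
  by apply: eq_Rintegral => p _; rewrite GsE mulN1r mulrN.
exact: (fubini_kernel (E n) a (fun z => sin (z.1 * (z.2 - x))) (iE n) ia (mkk sin csin) _).1.
Unshelve. all: by end_near. Qed.

End Inversion.

(** * Complex-valued functions and tempered functionals *)

Section ComplexFunctions.
Context {R : realType}.
Notation mu := (@lebesgue_measure R).
Implicit Types (z w : R[i]) (g h : R -> R[i]).
Local Notation Re := complex.Re.
Local Notation Im := complex.Im.

Lemma ReM z w : Re (z * w) = Re z * Re w - Im z * Im w.
Proof. by case: z w => [a b] [c d]. Qed.
Lemma ImM z w : Im (z * w) = Re z * Im w + Im z * Re w.
Proof. by case: z w => [a b] [c d]. Qed.
Lemma ReD z w : Re (z + w) = Re z + Re w.
Proof. by case: z w => [a b] [c d]. Qed.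
Lemma ImD z w : Im (z + w) = Im z + Im w.
Proof. by case: z w => [a b] [c d]. Qed.
Lemma ReN z : Re (- z) = - Re z.
Proof. by case: z. Qed.
Lemma ImN z : Im (- z) = - Im z.
Proof. by case: z. Qed.
Definition RIE := (ReM, ImM, ReD, ImD, ReN, ImN).

Lemma eqRI z w : Re z = Re w -> Im z = Im w -> z = w.
Proof. by case: z w => [a b] [c d] /= -> ->. Qed.

Lemma cisD (x y : R) : cis (x + y) = cis x * cis y.
Proof. by apply: eqRI; rewrite ?RIE /= ?cosD ?sinD; ring. Qed.

Lemma cis0 : cis 0 = 1 :> R[i].
Proof. by apply: eqRI; rewrite /= ?cos0 ?sin0. Qed.

Lemma cmod_ge0 z : 0 <= cmod z. Proof. exact: sqrtr_ge0. Qed.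

Lemma cmod_sqr z : cmod z ^+ 2 = Re z ^+ 2 + Im z ^+ 2.
Proof. by rewrite sqr_sqrtr// addr_ge0 ?sqr_ge0. Qed.

Lemma Re_le_cmod z : `|Re z| <= cmod z.
Proof. by rewrite -sqrtr_sqr ler_wsqrtr// lerDl sqr_ge0. Qed.

Lemma Im_le_cmod z : `|Im z| <= cmod z.
Proof. by rewrite -sqrtr_sqr ler_wsqrtr// lerDr sqr_ge0. Qed.

Lemma cmod_le_abs z : cmod z <= `|Re z| + `|Im z|.
Proof.
rewrite -(@ler_pXn2r _ 2) ?nnegrE ?cmod_ge0 ?addr_ge0//.
rewrite cmod_sqr sqrrD !real_normK ?num_real// lerD2r lerDl.
by rewrite mulrn_wge0// mulr_ge0.
Qed.

Lemma cmodM z w : cmod (z * w) = cmod z * cmod w.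
Proof.
rewrite /cmod -sqrtrM ?addr_ge0 ?sqr_ge0//; congr Num.sqrt.
by rewrite !RIE; ring.
Qed.

Lemma plane_CS (a b c d : R) : `|a * c + b * d| <= Num.sqrt (a ^+ 2 + b ^+ 2) * Num.sqrt
  (c ^+ 2 + d ^+ 2).
Proof.
rewrite -sqrtrM ?addr_ge0 ?sqr_ge0// -sqrtr_sqr ler_wsqrtr//.
have : 0 <= (a * d - b * c) ^+ 2 by exact: sqr_ge0.
by lra.
Qed.

Lemma cmodD z w : cmod (z + w) <= cmod z + cmod w.
Proof.
rewrite -(@ler_pXn2r _ 2) ?nnegrE ?cmod_ge0 ?addr_ge0 ?cmod_ge0//.
rewrite sqrrD !cmod_sqr !RIE.
have := le_trans (ler_norm _) (plane_CS (Re z) (Im z) (Re w) (Im w)).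
rewrite -/(cmod z) -/(cmod w) -mulr_natr; lra.
Qed.

Lemma cmod_real (r : R) : cmod (r%:C) = `|r|.
Proof. by rewrite /cmod/= expr0n addr0 sqrtr_sqr. Qed.

Definition cigr g := igr setT (re_fun g) /\ igr setT (im_fun g).

Lemma cigrZ (a : R[i]) g : cigr g -> cigr (fun x => a * g x).
Proof.
move=> [g1 g2]; split.
  have := igrB _ _ _ measurableT (igrZ _ (Re a) _ measurableT g1) (igrZ _ (Im a) _ measurableT g2).
  by apply: eq_igr => // x _; rewrite /re_fun ReM.
have := igrD _ _ _ measurableT (igrZ _ (Re a) _ measurableT g2) (igrZ _ (Im a) _ measurableT g1).
by apply: eq_igr => // x _; rewrite /im_fun ImM.
Qed.

Lemma cintegralD g h : cigr g -> cigr h ->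
  cintegral (fun x => g x + h x) = cintegral g + cintegral h.
Proof.
move=> [g1 g2] [h1 h2]; apply: eqRI; rewrite !RIE /= -RintegralD//;
  by apply: eq_Rintegral => x _; rewrite /re_fun /im_fun !RIE.
Qed.

Lemma cintegralZ (a : R[i]) g : cigr g ->
  cintegral (fun x => a * g x) = a * cintegral g.
Proof.
move=> [g1 g2]; apply: eqRI; rewrite !RIE /= -!RintegralZl//.
  rewrite -RintegralB//; try exact: igrZ.
  by apply: eq_Rintegral => x _; rewrite /re_fun /im_fun !RIE.
rewrite -RintegralD//; try exact: igrZ.
by apply: eq_Rintegral => x _; rewrite /re_fun /im_fun !RIE.
Qed.

Lemma cigr_cis g (m : R -> R) : cigr g -> continuous m ->
  cigr (fun x => g x * cis (m x)).
Proof.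
move=> [g1 g2] cm.
have mc : measurable_fun setT (fun x : measurableTypeR R => cos (m x)).
  by apply: continuous_measurable_fun; apply: (cts_comp cos) => //; exact: continuous_cos.
have ms : measurable_fun setT (fun x : measurableTypeR R => sin (m x)).
  by apply: continuous_measurable_fun; apply: (cts_comp sin) => //; exact: continuous_sin.
have ic (b : R -> R) : igr setT b -> igr setT (fun x => b x * cos (m x)).
  by move=> ib; apply: (igrMb _ _ (fun x => cos (m x)) 1) => // x _; exact: cos_max.
have isn (b : R -> R) : igr setT b -> igr setT (fun x => b x * sin (m x)).
  by move=> ib; apply: (igrMb _ _ (fun x => sin (m x)) 1) => // x _; exact: sin_max.
split.
  have := igrB _ _ _ measurableT (ic _ g1) (isn _ g2).
  by apply: eq_igr => // x _; rewrite /re_fun ReM.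
have := igrD _ _ _ measurableT (isn _ g1) (ic _ g2).
by apply: eq_igr => // x _; rewrite /im_fun ImM.
Qed.

Lemma igr_cos (a : R -> R) p : igr setT a -> igr setT (fun x => a x * cos (p * x)).
Proof. by move=> ia; apply: kernel_igr => //; [exact: continuous_cos|exact: cos_max]. Qed.
Lemma igr_sin (a : R -> R) p : igr setT a -> igr setT (fun x => a x * sin (p * x)).
Proof. by move=> ia; apply: kernel_igr => //; [exact: continuous_sin|exact: sin_max]. Qed.

(** Reduction to real transforms, in which Fourier inversion and Fubini are
    already available. *)
Lemma fourierE g p : cigr g ->
  fourier g p = (Fc (re_fun g) p + Fs (im_fun g) p) +i* (Fc (im_fun g) p - Fs (re_fun g) p).
Proof.
move=> [g1 g2]; apply: eqRI => /=.
  rewrite -RintegralD//; [|exact: igr_cos|exact: igr_sin].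
  by apply: eq_Rintegral => x _; rewrite /re_fun ReM/= cosN sinN (mulrC p); ring.
rewrite -RintegralB//; [|exact: igr_cos|exact: igr_sin].
by apply: eq_Rintegral => x _; rewrite /im_fun ImM/= cosN sinN (mulrC p); ring.
Qed.

Lemma cintegral_cisE g p : cigr g ->
  cintegral (fun x => g x * cis (p * x)) =
  (Fc (re_fun g) p - Fs (im_fun g) p) +i* (Fc (im_fun g) p + Fs (re_fun g) p).
Proof.
move=> [g1 g2]; apply: eqRI => /=.
  rewrite -RintegralB//; [|exact: igr_cos|exact: igr_sin].
  by apply: eq_Rintegral => x _; rewrite /re_fun ReM.
rewrite -RintegralD//; [|exact: igr_cos|exact: igr_sin].
by apply: eq_Rintegral => x _; rewrite /im_fun ImM/= addrC.
Qed.

Lemma ifourierE g p : cigr g -> ifourier g p = ((2 * pi)^-1)%:C *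
  ((Fc (re_fun g) p - Fs (im_fun g) p) +i* (Fc (im_fun g) p + Fs (re_fun g) p)).
Proof. by move=> ig; rewrite /ifourier cintegral_cisE. Qed.

Definition csch {I : Type} (g : I -> R -> R[i]) :=
  schf (fun i => re_fun (g i)) /\ schf (fun i => im_fun (g i)).
Definition cmult {I : Type} (g : I -> R -> R[i]) :=
  multf (fun i => re_fun (g i)) /\ multf (fun i => im_fun (g i)).

Lemma csch_cigr {I : Type} (g : I -> R -> R[i]) i : csch g -> cigr (g i).
Proof. by move=> [s1 s2]; split; [exact: (schf_igr _ i s1)|exact: (schf_igr _ i s2)]. Qed.

Lemma csch_reindex {I J : Type} (k : J -> I) (g : I -> R -> R[i]) :
  csch g -> csch (fun j => g (k j)).
Proof. by move=> [s1 s2]; split; [exact: (schf_reindex k _ s1)|exact: (schf_reindex k _ s2)]. Qed.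

Lemma csch1 {I : Type} (g : I -> R -> R[i]) i : csch g -> csch (fun _ : unit => g i).
Proof. exact: (csch_reindex (fun _ : unit => i)). Qed.

Lemma csch_mul {I : Type} (m g : I -> R -> R[i]) : cmult m -> csch g ->
  csch (fun i x => m i x * g i x).
Proof.
move=> [m1 m2] [s1 s2]; split.
  have := schfB _ _ (schf_mul _ _ m1 s1) (schf_mul _ _ m2 s2).
  rewrite (_ : (fun i => re_fun _) = fun i x => re_fun (m i) x * re_fun (g i) x - im_fun (m i) x
    * im_fun (g i) x)//.
  by apply/funext => i; apply/funext => x; rewrite /re_fun ReM.
have := schf_add _ _ (schf_mul _ _ m1 s2) (schf_mul _ _ m2 s1).
rewrite (_ : (fun i => im_fun _) = fun i x => re_fun (m i) x * im_fun (g i) x + im_fun (m i) x *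
  re_fun (g i) x)//.
by apply/funext => i; apply/funext => x; rewrite /im_fun ImM.
Qed.

Lemma cmult_real {I : Type} (m : I -> R -> R) : multf m -> cmult (fun i x => (m i x)%:C).
Proof.
by move=> mm; split => //; apply: (multf_cst (fun=> 0) 0) => i; rewrite normr0.
Qed.

Lemma cmult_cst {I : Type} (c : R[i]) : cmult (fun (_ : I) (_ : R) => c).
Proof. by split; [exact: (multf_cst (fun=> Re c) `|Re c|)|exact:
  (multf_cst (fun=> Im c) `|Im c|)]. Qed.

Lemma csch_scale {I : Type} (c : R[i]) (g : I -> R -> R[i]) : csch g ->
  csch (fun i x => c * g i x).
Proof. by apply: csch_mul; exact: cmult_cst. Qed.

Lemma cmult_cis {I : Type} (m : I -> R -> R) : multf m -> cmult (fun i x => cis (m i x)).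
Proof. by move=> /multf_trig []. Qed.

Lemma csch_fourier {I : Type} (g : I -> R -> R[i]) : csch g ->
  csch (fun i => fourier (g i)).
Proof.
move=> sg; have [s1 s2] := sg.
have [c1 n1] := schf_fourier _ s1; have [c2 n2] := schf_fourier _ s2.
split.
  have := schf_add _ _ c1 n2; rewrite (_ : (fun i => re_fun _) = fun i x => Fc (re_fun (g i)) x +
    Fs (im_fun (g i)) x)//.
  by apply/funext => i; apply/funext => x; rewrite {1}/re_fun fourierE//; exact: csch_cigr.
have := schfB _ _ c2 n1; rewrite (_ : (fun i => im_fun _) = fun i x => Fc (im_fun (g i)) x - Fs
  (re_fun (g i)) x)//.
by apply/funext => i; apply/funext => x; rewrite {1}/im_fun fourierE//; exact: csch_cigr.
Qed.

Lemma csch_ifourier {I : Type} (g : I -> R -> R[i]) : csch g ->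
  csch (fun i => ifourier (g i)).
Proof.
move=> sg; have [s1 s2] := sg.
have [c1 n1] := schf_fourier _ s1; have [c2 n2] := schf_fourier _ s2.
have : csch (fun i x => (Fc (re_fun (g i)) x - Fs (im_fun (g i)) x) +i*
  (Fc (im_fun (g i)) x + Fs (re_fun (g i)) x)).
  by split; [exact: schfB|exact: schf_add].
move=> /(csch_scale ((2 * pi)^-1)%:C).
rewrite (_ : (fun i x => _ * _) = fun i => ifourier (g i))//.
by apply/funext => i; apply/funext => x; rewrite ifourierE//; exact: csch_cigr.
Qed.

Lemma fourierK g : csch (fun _ : unit => g) -> ifourier (fourier g) = g.
Proof.
move=> sg; have [s1 s2] := sg; apply/funext => x.
have [gc1 gs1 c1 n1] := fourier_inversion _ x s1.
have [gc2 gs2 c2 n2] := fourier_inversion _ x s2.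
have pi0 : 2 * pi != 0 :> R by rewrite mulf_neq0// gt_eqF// pi_gt0.
have ig := csch_cigr _ tt sg.
rewrite /ifourier; apply: eqRI; rewrite !RIE /= !(mul0r, subr0, addr0).
  rewrite -[RHS](mulKf pi0); congr (_ * _).
  rewrite -c1 -[RHS]subr0 -n2 -RintegralB//.
  apply: eq_Rintegral => p _; rewrite {1}/re_fun fourierE// ReM /= (mulrC x).
  by rewrite /Gc /Gs; ring.
rewrite -[RHS](mulKf pi0); congr (_ * _).
rewrite -c2 -[RHS]addr0 -n1 -RintegralD//.
apply: eq_Rintegral => p _; rewrite {1}/im_fun fourierE// ImM /= (mulrC x).
by rewrite /Gc /Gs; ring.
Qed.

Lemma ifourierK g : csch (fun _ : unit => g) -> fourier (ifourier g) = g.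
Proof.
move=> sg; have [s1 s2] := sg; apply/funext => x.
have [gc1 gs1 c1 n1] := fourier_inversion _ x s1.
have [gc2 gs2 c2 n2] := fourier_inversion _ x s2.
have pi0 : 2 * pi != 0 :> R by rewrite mulf_neq0// gt_eqF// pi_gt0.
have ig := csch_cigr _ tt sg.
rewrite /fourier; apply: eqRI => /=.
  rewrite -[RHS](mulKf pi0) -c1 -[X in _ * X]addr0 -n2 -RintegralD// -RintegralZl//; last exact:
    igrD.
  apply: eq_Rintegral => p _; rewrite {1}/re_fun ifourierE// !RIE /= cosN sinN.
  by rewrite /Gc /Gs; ring.
rewrite -[RHS](mulKf pi0) -c2 -[X in _ * X]subr0 -n1 -RintegralB// -RintegralZl//; last exact: igrB.
apply: eq_Rintegral => p _; rewrite {1}/im_fun ifourierE// !RIE /= cosN sinN.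
by rewrite /Gc /Gs; ring.
Qed.

Lemma fourier_lin (c : R[i]) g h : cigr g -> cigr h ->
  fourier (fun x => c * g x + h x) = fun p => c * fourier g p + fourier h p.
Proof.
move=> ig ih; apply/funext => p; rewrite /fourier.
have cp : continuous (fun x : R => - (x * p)).
  by apply: ctsN; apply: ctsM; [exact: cts_id|exact: cts_cst].
rewrite -cintegralZ; last exact: cigr_cis.
rewrite -cintegralD; [|apply: cigrZ; exact: cigr_cis|exact: cigr_cis].
by congr cintegral; apply/funext => x; rewrite mulrDl mulrA.
Qed.

Lemma swap_cos (a b : R -> R) : igr setT a -> igr setT b ->
  igr setT (fun p => a p * Fc b p) /\
  \int[mu]_p (a p * Fc b p) = \int[mu]_x (b x * Fc a x).
Proof.
move=> ia ib.
have mk : measurable_fun setT (fun z : R * R => cos (z.1 * z.2)).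
  apply: (measurableT_comp (f := @cos R)); last exact: measurable_funM.
  by apply: continuous_measurable_fun; exact: continuous_cos.
have [i1 ->] := fubini_kernel a b _ ia ib mk (fun u : R * R => cos_max _).
split; first by apply: eq_igr i1 => // p _; rewrite /Fc.
apply: eq_Rintegral => x _; congr (_ * _); apply: eq_Rintegral => p _ /=.
by rewrite (mulrC x).
Qed.

Lemma swap_sin (a b : R -> R) : igr setT a -> igr setT b ->
  igr setT (fun p => a p * Fs b p) /\
  \int[mu]_p (a p * Fs b p) = \int[mu]_x (b x * Fs a x).
Proof.
move=> ia ib.
have mk : measurable_fun setT (fun z : R * R => sin (z.1 * z.2)).
  apply: (measurableT_comp (f := @sin R)); last exact: measurable_funM.
  by apply: continuous_measurable_fun; exact: continuous_sin.
have [i1 ->] := fubini_kernel a b _ ia ib mk (fun u : R * R => sin_max _).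
split; first by apply: eq_igr i1 => // p _; rewrite /Fs.
apply: eq_Rintegral => x _; congr (_ * _); apply: eq_Rintegral => p _ /=.
by rewrite (mulrC x).
Qed.

Lemma Rintegral_lin4 (a b c d : R -> R) (x y z w : R) : igr setT a -> igr setT b ->
  igr setT c -> igr setT d ->
  \int[mu]_p (x * a p + y * b p + z * c p + w * d p) =
  x * \int[mu]_p a p + y * \int[mu]_p b p + z * \int[mu]_p c p + w * \int[mu]_p d p.
Proof.
move=> ia ib ic id.
have i1 := igrZ _ x _ measurableT ia; have i2 := igrZ _ y _ measurableT ib.
have i3 := igrZ _ z _ measurableT ic; have i4 := igrZ _ w _ measurableT id.
have i12 := igrD _ _ _ measurableT i1 i2.
have i123 := igrD _ _ _ measurableT i12 i3.
rewrite (RintegralD measurableT i123 i4) (RintegralD measurableT i12 i3).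
rewrite (RintegralD measurableT i1 i2).
by rewrite (RintegralZl x measurableT ia) (RintegralZl y measurableT ib)
  (RintegralZl z measurableT ic) (RintegralZl w measurableT id).
Qed.

(** Expanding into real and imaginary parts, each of the four terms of either
    side is an instance of [swap_cos] or [swap_sin]. *)
Lemma ifourier_swap g h : cigr g -> cigr h ->
  cintegral (fun p => g p * ifourier h p) = cintegral (fun x => ifourier g x * h x).
Proof.
move=> ig ih; have [g1 g2] := ig; have [h1 h2] := ih.
pose c : R := (2 * pi)^-1.
have [i1 e1] := swap_cos _ _ g1 h1; have [i2 e2] := swap_sin _ _ g1 h2.
have [i3 e3] := swap_cos _ _ g2 h2; have [i4 e4] := swap_sin _ _ g2 h1.
have [j1 f1] := swap_cos _ _ g1 h2; have [j2 f2] := swap_sin _ _ g1 h1.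
have [j3 f3] := swap_cos _ _ g2 h1; have [j4 f4] := swap_sin _ _ g2 h2.
have [k1 _] := swap_cos _ _ h1 g1; have [k2 _] := swap_sin _ _ h2 g1.
have [k3 _] := swap_cos _ _ h2 g2; have [k4 _] := swap_sin _ _ h1 g2.
have [l1 _] := swap_cos _ _ h2 g1; have [l2 _] := swap_sin _ _ h1 g1.
have [l3 _] := swap_cos _ _ h1 g2; have [l4 _] := swap_sin _ _ h2 g2.
apply: eqRI.
  transitivity (c * \int[mu]_p (re_fun g p * Fc (re_fun h) p) +
      (- c) * \int[mu]_p (re_fun g p * Fs (im_fun h) p) +
      (- c) * \int[mu]_p (im_fun g p * Fc (im_fun h) p) +
      (- c) * \int[mu]_p (im_fun g p * Fs (re_fun h) p)).
    rewrite -(Rintegral_lin4 _ _ _ _ _ _ _ _ i1 i2 i3 i4).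
    apply: eq_Rintegral => p _; rewrite {1}/re_fun ReM (ifourierE h p ih) !RIE.
    by rewrite -/c /= /re_fun /im_fun; ring.
  rewrite e1 e2 e3 e4 -(Rintegral_lin4 _ _ _ _ _ _ _ _ k1 k2 k3 k4).
  apply: eq_Rintegral => p _; rewrite [RHS]/re_fun ReM (ifourierE g p ig) !RIE.
  by rewrite -/c /= /re_fun /im_fun; ring.
transitivity (c * \int[mu]_p (re_fun g p * Fc (im_fun h) p) +
    c * \int[mu]_p (re_fun g p * Fs (re_fun h) p) +
    c * \int[mu]_p (im_fun g p * Fc (re_fun h) p) +
    (- c) * \int[mu]_p (im_fun g p * Fs (im_fun h) p)).
  rewrite -(Rintegral_lin4 _ _ _ _ _ _ _ _ j1 j2 j3 j4).
  apply: eq_Rintegral => p _; rewrite {1}/im_fun ImM (ifourierE h p ih) !RIE.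
  by rewrite -/c /= /re_fun /im_fun; ring.
rewrite f1 f2 f3 f4 -(Rintegral_lin4 _ _ _ _ _ _ _ _ l1 l2 l3 l4).
apply: eq_Rintegral => p _; rewrite [RHS]/im_fun ImM (ifourierE g p ig) !RIE.
by rewrite -/c /= /re_fun /im_fun; ring.
Qed.

Lemma Ck_derive1n {I : Type} P n k (a : I -> R -> R) : (k <= n)%N -> Ck P n a ->
  P (fun i => derive1n k (a i)) /\
  ((k < n)%N -> forall i (x : R), derivable (derive1n k (a i)) x 1).
Proof.
elim: k n a => [|k IH] [|n] a //.
- by move=> _ [Pa _]; split.
- by move=> _ [Pa [da _]]; split=> // _.
move=> kn [_ [_ Ca]]; have [P1 d1] := IH n _ kn Ca.
rewrite (_ : (fun i => _) = fun i => derive1n k (derive1 (a i))); last first.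
  by apply/funext => i; rewrite derive1Sn.
by split=> // kn' i x; rewrite derive1Sn; exact: d1.
Qed.

Lemma Ck_of_derive1n {I : Type} P n (a : I -> R -> R) :
  (forall k, P (fun i => derive1n k (a i))) ->
  (forall k i (x : R), derivable (derive1n k (a i)) x 1) -> Ck P n a.
Proof.
elim: n a => [|n IH] a Pa da; first by split=> //; exact: (Pa 0%N).
split; first exact: (Pa 0%N).
split; first exact: (da 0%N).
apply: IH => k; last by move=> i x; rewrite -derive1Sn; exact: da.
have := Pa k.+1; rewrite (_ : (fun i => _) = fun i => derive1n k (derive1 (a i)))//.
by apply/funext => i; rewrite derive1Sn.
Qed.

Lemma csch_bound {I : Type} (g : I -> R -> R[i]) : csch g -> forall j k,
  exists M : R, forall i x, `|x| ^+ j * cmod (cderiven k (g i) x) <= M.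
Proof.
move=> [s1 s2] j k.
have [R1 _] := Ck_derive1n _ _ _ _ (leqnn k) (s1 k).
have [R2 _] := Ck_derive1n _ _ _ _ (leqnn k) (s2 k).
have [M1 H1] := R1 j; have [M2 H2] := R2 j.
exists (M1 + M2) => i x; apply: le_trans (lerD (H1 i x) (H2 i x)).
rewrite -mulrDr; apply: ler_pM; rewrite ?cmod_ge0 ?exprn_ge0//.
  by apply: lerXn2r; rewrite ?nnegrE ?addr_ge0// lerDr.
exact: cmod_le_abs.
Qed.

Lemma csch_schwartz {I : Type} (g : I -> R -> R[i]) i : csch g -> schwartz (g i).
Proof.
move=> sg; split.
  have [s1 s2] := sg; split=> n x.
    by have [_ /(_ (ltnSn n))] := Ck_derive1n _ _ _ _ (leqnSn n) (s1 n.+1); exact.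
  by have [_ /(_ (ltnSn n))] := Ck_derive1n _ _ _ _ (leqnSn n) (s2 n.+1); exact.
by move=> j k; have [M H] := csch_bound g sg j k; exists M => _ [x _ <-].
Qed.

(** The definition of Schwartz functions bounds |x|^j times the derivatives
    separately for each j, whereas [RD] uses (1 + |x|)^j, which is at most
    2^j (1 + |x|^j). *)
Lemma schwartz_csch (phi : R -> R[i]) : schwartz phi -> csch (fun _ : unit => phi).
Proof.
move=> [[sm1 sm2] bd].
have B j k : exists M, forall x, (1 + `|x|) ^+ j * cmod (cderiven k phi x) <= M.
  have [M0 H0] := bd 0%N k; have [M1 H1] := bd j k.
  exists (2 ^+ j * (M0 + M1)) => x.
  have h0 : cmod (cderiven k phi x) <= M0.
    by have := H0 _ (imageT _ x); rewrite expr0 mul1r.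
  have h1 : `|x| ^+ j * cmod (cderiven k phi x) <= M1 by have := H1 _ (imageT _ x).
  have K0 := cmod_ge0 (cderiven k phi x).
  apply: (@le_trans _ _ (2 ^+ j * (cmod (cderiven k phi x) + `|x| ^+ j * cmod
    (cderiven k phi x)))); last first.
    by rewrite ler_wpM2l ?exprn_ge0// lerD.
  rewrite -{2}[cmod _]mul1r -mulrDl mulrA ler_wpM2r//.
  have [x1|x1] := leP `|x| 1.
    apply: (@le_trans _ _ (2 ^+ j * 1)).
      by rewrite mulr1; apply: lerXn2r; rewrite ?nnegrE ?addr_ge0//; lra.
    by rewrite ler_wpM2l ?exprn_ge0// lerDl exprn_ge0.
  apply: (@le_trans _ _ (2 ^+ j * `|x| ^+ j)).
    rewrite -exprMn; apply: lerXn2r; rewrite ?nnegrE ?addr_ge0 ?mulr_ge0//.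
    by move: x1; lra.
  by rewrite ler_wpM2l ?exprn_ge0// lerDr.
split=> n; apply: Ck_of_derive1n => k.
- move=> j; have [M H] := B j k; exists M => _ x; apply: le_trans (H x).
  by rewrite ler_wpM2l ?exprn_ge0 ?addr_ge0//; exact: (Re_le_cmod (cderiven k phi x)).
- by move=> _ x; exact: sm1.
- move=> j; have [M H] := B j k; exists M => _ x; apply: le_trans (H x).
  by rewrite ler_wpM2l ?exprn_ge0 ?addr_ge0//; exact: (Im_le_cmod (cderiven k phi x)).
- by move=> _ x; exact: sm2.
Qed.

Lemma csch_seminorm {I : Type} (g : I -> R -> R[i]) : csch g -> forall j k,
  exists M : R, forall i, seminorm j k (g i) <= M.
Proof.
move=> sg j k; have [M H] := csch_bound g sg j k; exists M => i.
apply: ge_sup; first by eexists; exact: imageT.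
by move=> _ [x _ <-].
Qed.

Lemma csch_bounded {I : Type} (g : I -> R -> R[i]) : csch g ->
  bounded_schwartz (range g).
Proof.
move=> sg; split; first by move=> _ [i _ <-]; exact: csch_schwartz.
by move=> j k; have [M H] := csch_seminorm g sg j k; exists M => _ [i _ <-].
Qed.

(** Uniformity in the index of a Schwartz family bounds each of the finitely
    many seminorms that control T. *)
Lemma tempered_bound {I : Type} (T : distr R) (g : I -> R -> R[i]) :
  tempered T -> csch g -> exists C : R, forall i, cmod (T (g i)) <= C.
Proof.
move=> [_ [N [M TM]]] sg.
have /choice [K HK] : forall jk : nat * nat, exists m : R, forall i, seminorm jk.1 jk.2 (g i) <= m.
  by move=> [j k]; exact: csch_seminorm.
exists (`|M| * \sum_(j < N.+1) \sum_(k < N.+1) `|K (j : nat, k : nat)|) => i.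
apply: (le_trans (TM _ (csch_schwartz _ i sg))).
have S0 j k : 0 <= seminorm j k (g i).
  have [M0 H0] := csch_bound g sg j k.
  apply: (@le_trans _ _ (`|0| ^+ j * cmod (cderiven k (g i) 0))).
    by rewrite mulr_ge0 ?cmod_ge0// exprn_ge0.
  by apply: ub_le_sup; [exists M0 => _ [x _ <-]|exact: imageT].
apply: (@le_trans _ _ (`|M| * \sum_(j < N.+1) \sum_(k < N.+1) seminorm j k (g i))).
  by rewrite ler_wpM2r ?ler_norm// sumr_ge0// => j _; rewrite sumr_ge0.
rewrite ler_wpM2l// ler_sum// => j _; rewrite ler_sum// => k _.
by rewrite (le_trans (HK (j : nat, k : nat) i))// ler_norm.
Qed.

Lemma tempered_lin (T : distr R) (c : R[i]) (phi psi : R -> R[i]) : tempered T ->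
  csch (fun _ : unit => phi) -> csch (fun _ : unit => psi) ->
  T (fun x => c * phi x + psi x) = c * T phi + T psi.
Proof.
by move=> [lin _] s1 s2; apply: lin;
  [exact: (csch_schwartz _ tt s1)|exact: (csch_schwartz _ tt s2)].
Qed.

End ComplexFunctions.

(** * Functions with small increments are constant *)

Section Flat.
Context {R : realType}.

(** The derivative is 0 as soon as increments are small compared to the
    displacement, with no derivative assumed to exist. *)
Lemma isd0 (h : R -> R) (x : R) :
  (forall e : R, 0 < e -> \forall r \near x, `|h r - h x| <= e * `|r - x|) -> isd h x 0.
Proof.
move=> H.
have cv : q^-1 *: (h (q *: (1 : R) + x) - h x) @[q --> (0 : R)^'] --> (0 : R).
  apply/cvgrPdist_le => e e0.
  have /nbhs_ballP[d /= d0 dH] := H e e0.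
  have := @dnbhs0_lt R R d d0; move: (@nbhs_dnbhs_neq R 0).
  apply: filterS2 => q q0 qd.
  rewrite sub0r normrN normrZ normfV ler_pdivrMl ?normr_gt0//.
  have := dH (q *: 1 + x); rewrite /ball/= opprD addrC subrK normrN /GRing.scale/= mulr1.
  by move=> /(_ qd); rewrite addrK mulrC.
split; first by apply/cvg_ex; exists 0.
by apply/cvg_lim.
Qed.

(** Precomposition with r |-> max(r, 0) moves the problem to the whole line,
    where it becomes the vanishing of a derivative. *)
Lemma locally_flat_cst (g : R -> R) :
  (forall s : R, 0 <= s -> forall e : R, 0 < e ->
     \forall r \near s, 0 <= r -> `|g r - g s| <= e * `|r - s|) ->
  forall t : R, 0 <= t -> g t = g 0.
Proof.
move=> H t t0; pose h r := g (Num.max r 0).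
have -> : g t = h t by rewrite /h max_l.
have -> : g 0 = h 0 by rewrite /h maxxx.
apply: is_derive_0_is_cst => x; apply: isd0 => e e0.
have [x0|x0] := ltP x 0.
  have := lt_nbhsl x0; apply: filterS => r r0.
  rewrite /h (max_r (ltW r0)) (max_r (ltW x0)) subrr normr0.
  by apply: mulr_ge0 => //; exact: ltW.
have /nbhs_ballP[d /= d0 dH] := H x x0 e e0.
apply/nbhs_ballP; exists d => //= r; rewrite /ball/= => rd.
have le1 : `|Num.max r 0 - x| <= `|r - x|.
  have [r0|r0] := leP 0 r; first by [].
  by rewrite sub0r normrN ger0_norm// ltr0_norm ?subr_lt0 ?(lt_le_trans r0)//; lra.
rewrite /h (max_l x0); apply: (@le_trans _ _ (e * `|Num.max r 0 - x|)).
  apply: dH; rewrite /ball/=; last by rewrite le_max lexx orbT.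
  by rewrite distrC (le_lt_trans le1)// distrC.
by rewrite ler_wpM2l// ltW.
Qed.

End Flat.

(** * Uniform expansions of the phase factor *)

Section Oscillation.
Context {R : realType}.

Lemma lip_cos (y : R) : `|cos y - 1| <= `|y|.
Proof.
have H (z : R) : `|- sin z| <= 1 by rewrite normrN sin_max.
have := lipschitz cos (fun z => - sin z) 1 (fun z => is_derive_cos z) H 0 y.
by rewrite cos0 subr0 mul1r.
Qed.

Lemma lip_sin (y : R) : `|sin y| <= `|y|.
Proof.
have := lipschitz sin cos 1 (fun z => is_derive_sin z) (@cos_max R) 0 y.
by rewrite sin0 !subr0 mul1r.
Qed.

Lemma mvt0 (a a' : R -> R) (y K : R) : (forall z, isd a z (a' z)) ->
  (forall z, `|z| <= `|y| -> `|a' z| <= K) -> `|a y - a 0| <= K * `|y|.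
Proof.
move=> da aK; have K0 : 0 <= K by apply: le_trans (aK y _) => //.
have dc (i : interval R) : {within [set` i], continuous a}.
  apply: derivable_within_continuous => z _; exact: isd_ex (da z).
have [y0|y0] := leP 0 y.
  have [z + ->] := MVT_segment y0 (fun z _ => da z) (dc _).
  rewrite in_itv/= => /andP[z0 zy]; rewrite subr0 normrM ler_wpM2r// aK//.
  by rewrite !ger0_norm.
have [z + E] := MVT_segment (ltW y0) (fun z _ => da z) (dc _).
rewrite in_itv/= => /andP[yz z0]; rewrite distrC E normrM sub0r normrN ler_wpM2r// aK//.
by rewrite ler0_norm// ltr0_norm// lerN2.
Qed.

Lemma quad_cos (y : R) : `|cos y - 1| <= y ^+ 2.
Proof.
rewrite -[y ^+ 2]real_normK ?num_real// expr2 -{1}cos0.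
apply: (mvt0 cos (fun z => - sin z)) => z; first exact: is_derive_cos.
by rewrite normrN => zy; exact: le_trans (lip_sin z) zy.
Qed.

Lemma quad_sin (y : R) : `|sin y - y| <= y ^+ 2.
Proof.
rewrite -[y ^+ 2]real_normK ?num_real// expr2.
have := mvt0 (fun z => sin z - z) (fun z => cos z - 1) y `|y|.
rewrite sin0 !subr0; apply=> z; last by move=> zy; exact: le_trans (lip_cos z) zy.
by apply: isdB; [exact: is_derive_sin|exact: isd_id].
Qed.

(** Time increments, bounded so that phases h f form a uniform family of
    multipliers. *)
Definition step := {h : R | h != 0 /\ `|h| <= 1}.

Variable f : R -> R.
Hypothesis mf : forall I : Type, multf (fun _ : I => f).

(** The quotients (e^{ihf} - 1) / h and (e^{ihf} - 1 - ihf) / h^2. *)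
Definition kH (h : step) (p : R) : R[i] :=
  ((cos (sval h * f p) - 1) / sval h) +i* (sin (sval h * f p) / sval h).
Definition kG (h : step) (p : R) : R[i] :=
  ((cos (sval h * f p) - 1) / sval h ^+ 2) +i*
  ((sin (sval h * f p) - sval h * f p) / sval h ^+ 2).

Lemma step_neq0 (h : step) : sval h != 0.
Proof. by case: h => h []. Qed.

Lemma multf_hf : multf (fun (h : step) p => sval h * f p).
Proof.
apply: multf_mul => //; apply: (multf_cst _ 1) => h.
by case: (svalP h).
Qed.

Lemma isd_f p : isd f p (derive1 f p).
Proof. exact: (multf_isd (fun _ : unit => f) tt p (mf unit)). Qed.

Lemma isd_hf (h : step) p : isd (fun p => sval h * f p) p (sval h * derive1 f p).
Proof. by apply: isdZ; exact: isd_f. Qed.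

(** The quotient itself is bounded by |f| since sine and cosine are Lipschitz;
    in its derivative the factor 1/h cancels. *)
Lemma cmult_kH : cmult kH.
Proof.
have [C [N fN]] := (Ck_0 _ _ _ (mf unit 0%N)).
have [mc ms] := multf_trig _ multf_hf.
have mf' : multf (fun _ : step => derive1 f) by exact: multf_derive1 (mf step).
have B (g : R -> R) : (forall y, `|g y| <= `|y|) ->
    PG (fun (h : step) p => g (sval h * f p) / sval h).
  move=> gy; exists C, N => h p.
  rewrite normrM normfV ler_pdivrMr ?normr_gt0 ?step_neq0//.
  apply: le_trans (gy _) _; rewrite normrM mulrC ler_wpM2r//; exact: (fN tt).
split.
  apply: (multf_derive _ (fun h p => - derive1 f p * sin (sval h * f p))).
  - by apply: (B (fun y => cos y - 1)); exact: lip_cos.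
  - move=> h p; apply: isd_eq.
      apply: isdM; last exact: isd_cst.
      by apply: isdB; [apply: isd_cos; exact: isd_hf|exact: isd_cst].
    by rewrite /=; field; exact: step_neq0.
  - by apply: multf_mul => //; exact: multfN.
apply: (multf_derive _ (fun h p => derive1 f p * cos (sval h * f p))).
- by apply: (B sin); exact: lip_sin.
- move=> h p; apply: isd_eq.
    by apply: isdM; [apply: isd_sin; exact: isd_hf|exact: isd_cst].
  by rewrite /=; field; exact: step_neq0.
- exact: multf_mul.
Qed.

(** One order further: the quotient is bounded by f^2, and its derivative is f'
    times the real or imaginary part of kH, up to sign. *)
Lemma cmult_kG : cmult kG.
Proof.
have [C [N fN]] := (Ck_0 _ _ _ (mf unit 0%N)).
have [mc ms] := cmult_kH.
have mf' : multf (fun _ : step => derive1 f) by exact: multf_derive1 (mf step).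
have B (g : R -> R) : (forall y, `|g y| <= y ^+ 2) ->
    PG (fun (h : step) p => g (sval h * f p) / sval h ^+ 2).
  move=> gy; exists (C ^+ 2), (N * 2)%N => h p.
  have h2 : 0 < sval h ^+ 2 by rewrite exprn_even_gt0//= step_neq0.
  rewrite normrM normfV (gtr0_norm h2) ler_pdivrMr//.
  apply: le_trans (gy _) _; rewrite exprMn mulrC; apply: ler_wpM2r; first exact: ltW.
  have -> : C ^+ 2 * (1 + `|p|) ^+ (N * 2) = (C * (1 + `|p|) ^+ N) ^+ 2.
    by rewrite exprMn -exprM.
  rewrite -[f p ^+ 2]real_normK ?num_real//.
  apply: lerXn2r; rewrite ?nnegrE//; last exact: (fN tt).
  exact: le_trans (fN tt p).
split.
  apply: (multf_derive _ (fun h p => - derive1 f p * (sin (sval h * f p) / sval h))).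
  - by apply: (B (fun y => cos y - 1)); exact: quad_cos.
  - move=> h p; apply: isd_eq.
      apply: isdM; last exact: isd_cst.
      by apply: isdB; [apply: isd_cos; exact: isd_hf|exact: isd_cst].
    by rewrite /=; field; exact: step_neq0.
  - by apply: multf_mul => //; exact: multfN.
apply: (multf_derive _ (fun h p => derive1 f p * ((cos (sval h * f p) - 1) / sval h))).
- by apply: (B (fun y => sin y - y)); exact: quad_sin.
- move=> h p; apply: isd_eq.
    apply: isdM; last exact: isd_cst.
    by apply: isdB; [apply: isd_sin; exact: isd_hf|exact: isd_hf].
  by rewrite /=; field; exact: step_neq0.
- exact: multf_mul.
Qed.

Definition bddtime (K : R) := {s : R | `|s| <= K}.

Lemma cmult_phase (K : R) : cmult (fun (s : bddtime K) p => cis (sval s * f p)).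
Proof.
apply: cmult_cis; apply: multf_mul => //.
by apply: (multf_cst _ K) => s; case: s.
Qed.

End Oscillation.

(** * The evolution equation *)

Section Evolution.
Context {R : realType}.
Variables (f : R -> R) (u0 : distr R) (u : R -> distr R).
Hypothesis mf : forall I : Type, multf (fun _ : I => f).
Hypothesis sol : solution f u0 u.

Lemma csch_phase (g : R -> R[i]) (s : R) : csch (fun _ : unit => g) ->
  csch (fun _ : unit => fun p => cis (s * f p) * g p).
Proof.
move=> sg; have B : `|s| <= `|s| by [].
apply: csch_mul sg; have [m1 m2] := cmult_phase f mf `|s|.
by split; [exact: (multf_reindex (fun=> exist _ s B) _ m1)|
  exact: (multf_reindex (fun=> exist _ s B) _ m2)].
Qed.

(** Conservation of w(s) = u(s) (F (e^{isf} psi)).  For h = r - s, write the test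
    function at r as that at s plus q times the Fourier transform of H h, with
    q = h seen as a complex number, and H h as i D plus q times G h.  Then w(r) - w(s)
    is q times the error X of the difference quotient of u, tested on a function
    of a bounded set, plus q^2 times bounded terms: the terms of order q cancel
    by the equation. *)
Lemma evolution (psi : R -> R[i]) (t : R) : csch (fun _ : unit => psi) -> 0 <= t ->
  u t (fourier (fun p => cis (t * f p) * psi p)) = u0 (fourier psi).
Proof.
move=> spsi t0; have [du [C1 pde init]] := sol.
pose Phi s : R -> R[i] := fourier (fun p => cis (s * f p) * psi p).
pose w s := u s (Phi s).
have sE s := csch_phase psi s spsi.
have sPhi s : csch (fun _ : unit => Phi s) := csch_fourier _ (sE s).
have key (s : R) : 0 <= s -> forall e : R, 0 < e ->
    \forall r \near s, 0 <= r -> cmod (w r - w s) <= e * `|r - s|.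
  move=> s0 e e0; have [Tu Tdu cvd _] := C1 s s0.
  pose B0 p := cis (s * f p) * psi p.
  have sB0 : csch (fun _ : unit => B0) := sE s.
  pose D p := (f p)%:C * B0 p.
  have sD : csch (fun _ : unit => D) by apply: csch_mul => //; exact: cmult_real.
  pose H (h : step) p := kH f h p * B0 p.
  pose G (h : step) p := kG f h p * B0 p.
  have sH : csch H.
    by apply: csch_mul; [exact: cmult_kH|exact: (csch_reindex (fun _ : step => tt) _ sB0)].
  have sG : csch G.
    by apply: csch_mul; [exact: cmult_kG|exact: (csch_reindex (fun _ : step => tt) _ sB0)].
  have [c1 Hc1] := tempered_bound _ _ Tdu (csch_fourier _ sH).
  have [c2 Hc2] := tempered_bound _ _ Tu (csch_fourier _ sG).
  pose K := `|s| + 1.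
  pose fam (r : bddtime K) := Phi (sval r).
  have sfam : csch fam.
    apply: csch_fourier; apply: csch_mul; first exact: cmult_phase.
    exact: (csch_reindex (fun _ : bddtime K => tt) _ spsi).
  have e20 : 0 < e / 2 by rewrite divr_gt0.
  have := cvd _ (csch_bounded _ sfam) _ e20.
  rewrite near_withinE /dnbhs near_withinE => near1.
  pose c := 1 + `|c1| + `|c2|.
  have c0 : 0 < c by rewrite ltr_pwDl// addr_ge0.
  have near2 : \forall r \near s, `|r - s| < Num.min 1 (e / 2 / c).
    apply/nbhs_ballP; exists (Num.min 1 (e / 2 / c)) => /=.
      by rewrite lt_min ltr01 divr_gt0.
    by move=> r; rewrite /ball/= distrC.
  apply: filterS2 near1 near2 => r nr1 nr2 r0.
  have [->|rs] := eqVneq r s; first by rewrite !subrr normr0 mulr0 /cmod expr0n addr0 sqrtr0.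
  move: nr2; rewrite lt_min => /andP[rs1 rs2].
  have h0 : r - s != 0 by rewrite subr_eq0.
  pose h : step := exist _ (r - s) (conj h0 (ltW rs1)).
  have rK : `|r| <= K.
    by rewrite /K -(subrK s r) (le_trans (ler_normD _ _))// addrC lerD2l ltW.
  have nr : cmod (distr_sub (distr_scale ((r - s)^-1)%:C (distr_sub (u r) (u s))) (du s) (Phi r))
    <= e / 2.
    apply: (nr1 rs); first by rewrite /= in_itv/= r0.
    by exists (exist _ r rK).
  set q : R[i] := (r - s)%:C.
  have E1 : (fun p => cis (r * f p) * psi p) = fun p => q * H h p + B0 p.
    apply/funext => p; rewrite /H /B0 mulrA -[X in _ + X]mul1r -mulrDl.
    have -> : r * f p = (r - s) * f p + s * f p by ring.
    rewrite cisD -[LHS]mulrA; congr (_ * _).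
    by apply: eqRI; rewrite !RIE /=; field.
  have E2 : H h = fun p => q * G h p + 'i * D p.
    apply/funext => p; rewrite /H /G /D !mulrA -mulrDl; congr (_ * _).
    by apply: eqRI; rewrite !RIE /=; field.
  have i_ (g : R -> R[i]) := csch_cigr (fun _ : unit => g) tt.
  have sHh := csch1 _ h sH; have sGh := csch1 _ h sG.
  have F1 : Phi r = fun x => q * fourier (H h) x + Phi s x.
    by rewrite /Phi E1 fourier_lin//; exact: i_.
  have siD : csch (fun _ : unit => fun p => 'i * D p) by exact: csch_scale.
  (* Linearity is stated for c phi + psi; scaling alone takes psi = 0. *)
  have z0 : csch (fun _ : unit => fun _ : R => (0 : R[i])).
    by have := csch_scale 0 _ sD; under eq_fun do under eq_fun do rewrite mul0r.
  have F2 : fourier (H h) = fun x => q * fourier (G h) x + ('i * fourier D x + fourier (fun=> 0) x).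
    rewrite E2 fourier_lin; [|exact: i_|exact: i_].
    have -> : (fun p => 'i * D p) = fun p => 'i * D p + 0.
      by apply/funext => p; rewrite addr0.
    by rewrite (fourier_lin 'i D (fun=> 0)) //; exact: i_.
  have F0 : fourier (fun=> 0 : R[i]) = fun=> 0 :> R[i].
    have Z : (fun _ : R => -1 * 0 + 0) = (fun=> 0) :> (R -> R[i]).
      by apply/funext => p; rewrite mulr0 addr0.
    have := fourier_lin (-1) _ _ (i_ _ z0) (i_ _ z0); rewrite Z => E.
    by apply/funext => x; rewrite E mulN1r addNr.
  have {}F2 : fourier (H h) = fun x => q * fourier (G h) x + ('i * fourier D x).
    by rewrite F2 F0; apply/funext => x; rewrite addr0.
  have sFH := csch_fourier _ sHh; have sFG := csch_fourier _ sGh.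
  have sFD := csch_fourier _ sD.
  have tlin T (a : R[i]) (g k : R -> R[i]) (TT : tempered T) := tempered_lin T a g k TT.
  have T0 (T : distr R) : tempered T -> T (fun=> 0) = 0.
    have Z : (fun _ : R => -1 * 0 + 0) = (fun=> 0) :> (R -> R[i]).
      by apply/funext => p; rewrite mulr0 addr0.
    move=> TT; have := tempered_lin T (-1) _ _ TT z0 z0; rewrite Z => E.
    by rewrite E mulN1r addNr.
  have us1 : u s (Phi r) = q * (q * u s (fourier (G h)) + 'i * u s (fourier D)) + w s.
    rewrite F1 tlin//; congr (_ * _ + _); rewrite F2 tlin//; last exact: csch_scale.
    congr (_ + _); have := tlin (u s) 'i (fourier D) (fun=> 0) Tu sFD z0.
    by rewrite T0// addr0 => <-; congr (u s); apply/funext => x; rewrite addr0.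
  have dus1 : du s (Phi r) = q * du s (fourier (H h)) + du s (Phi s).
    by rewrite F1 tlin.
  (* f(D) u(s) tested on F g is u(s) tested on F (f g). *)
  have pdes : 'i * du s (Phi s) = u s (fourier D).
    have := pde s s0 (Phi s) (csch_schwartz _ tt (sPhi s)).
    rewrite /distr_scale /fourier_multiplier /distr_ifourier /distr_mul /distr_fourier.
    by rewrite /Phi fourierK.
  set X := distr_sub _ _ _ in nr.
  have wE : w r - w s = q * (X + q * (du s (fourier (H h)) + u s (fourier (G h)))).
    have XE : q * X = u r (Phi r) - u s (Phi r) - q * du s (Phi r).
      rewrite /X /distr_sub /distr_scale mulrBr mulrA; congr (_ - _).
      rewrite [X in X * _](_ : _ = 1) ?mul1r//.
      by apply: eqRI; rewrite !RIE /= ?(mul0r, mulr0, subr0, addr0)// mulfV.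
    have i2 : 'i * 'i = -1 :> R[i] by rewrite -expr2 sqr_i.
    have -> : w r - w s = q * X + q * du s (Phi r) + (u s (Phi r) - w s).
      by rewrite XE /w; ring.
    rewrite us1 dus1 -pdes.
    have -> : 'i * ('i * du s (Phi s)) = - du s (Phi s) by rewrite mulrA i2 mulN1r.
    by ring.
  rewrite wE cmodM cmod_real mulrC ler_wpM2r//.
  rewrite (le_trans (cmodD _ _))// [leRHS]splitr lerD//.
  rewrite cmodM cmod_real.
  have b1 : cmod (du s (fourier (H h)) + u s (fourier (G h))) <= c.
    rewrite (le_trans (cmodD _ _))// /c -addrA ler_wpDl// lerD//.
      by rewrite (le_trans (Hc1 h))// ler_norm.
    by rewrite (le_trans (Hc2 h))// ler_norm.
  apply: (@le_trans _ _ (`|r - s| * c)); first by rewrite ler_wpM2l.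
  by rewrite -ler_pdivlMr// ltW.
have wt : w t = w 0.
  apply: eqRI; [apply: (locally_flat_cst (fun r => complex.Re (w r))) t0|
    apply: (locally_flat_cst (fun r => complex.Im (w r))) t0] => s s0 e e0;
    have := key s s0 e e0; apply: filterS => r H r0.
    by rewrite -ReN -ReD (le_trans (Re_le_cmod _))//; exact: H.
  by rewrite -ImN -ImD (le_trans (Im_le_cmod _))//; exact: H.
rewrite -/(Phi t) -/(w t) wt /w init; last exact: (csch_schwartz _ tt (sPhi 0)).
by congr (u0 (fourier _)); apply/funext => p; rewrite mul0r cis0 mul1r.
Qed.

End Evolution.

(** * Continuity on a segment *)

Section Within.
Context {R : realType}.
Implicit Types (f g : R -> R) (D : set R).

Lemma within_cts D f : continuous f -> {within D, continuous f}.
Proof. exact: continuous_subspaceT. Qed.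

Lemma withinM D f g : {within D, continuous f} -> {within D, continuous g} ->
  {within D, continuous (fun x => f x * g x)}.
Proof. by move=> cf cg x; apply: cvgM; [exact: cf|exact: cg]. Qed.

Lemma withinD D f g : {within D, continuous f} -> {within D, continuous g} ->
  {within D, continuous (fun x => f x + g x)}.
Proof. by move=> cf cg x; apply: cvgD; [exact: cf|exact: cg]. Qed.

Lemma withinN D f : {within D, continuous f} -> {within D, continuous (fun x => - f x)}.
Proof. by move=> cf x; apply: cvgN; exact: cf. Qed.

Lemma withinB D f g : {within D, continuous f} -> {within D, continuous g} ->
  {within D, continuous (fun x => f x - g x)}.
Proof. by move=> cf cg; apply: withinD => //; exact: withinN. Qed.

Lemma withinZ D (c : R) f : {within D, continuous f} -> {within D, continuous (fun x => c * f x)}.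
Proof. by move=> cf; apply: withinM => //; apply: within_cts; exact: cts_cst. Qed.

Lemma within_comp D f g : continuous f -> {within D, continuous g} ->
  {within D, continuous (fun x => f (g x))}.
Proof.
by move=> cf cg x; apply: (@continuous_comp (subspace D) R R g f x); [exact: cg|exact: cf].
Qed.

Lemma withinS D D' f : D' `<=` D -> {within D, continuous f} -> {within D', continuous f}.
Proof. by move=> DD'; exact: continuous_subspaceW. Qed.

Lemma within_cmod D f g : {within D, continuous f} -> {within D, continuous g} ->
  {within D, continuous (fun x => cmod (f x +i* g x))}.
Proof.
move=> cf cg; apply: (within_comp _ Num.sqrt); first exact: sqrt_continuous.
rewrite (_ : (fun x => _) = fun x => f x * f x + g x * g x); last first.
  by apply/funext => x; rewrite !expr2.
by apply: withinD; apply: withinM.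
Qed.

(** Bounds pass from the open to the closed interval by continuity at the ends;
    the norms of the regular factor only see the open interval. *)
Lemma closed_bound (h : R -> R) (a b L : R) : a < b -> {within `[a, b], continuous h} ->
  (forall x, a < x < b -> h x <= L) -> forall x, a <= x <= b -> h x <= L.
Proof.
move=> ab /(continuous_within_itvP _ ab) [_ ha hb] hL x /andP[].
rewrite le_eqVlt => /predU1P[<- _|ax].
  apply: (cvgr_to_le ha); near=> z; apply: hL; apply/andP; split.
    by near: z; exact: nbhs_right_gt.
  by near: z; exact: nbhs_right_lt.
rewrite le_eqVlt => /predU1P[->|xb]; last by apply: hL; rewrite ax.
apply: (cvgr_to_le hb); near=> z; apply: hL; apply/andP; split.
  by near: z; exact: nbhs_left_gt.
by near: z; exact: nbhs_left_lt.
Unshelve. all: by end_near. Qed.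

End Within.

(** * Integrals of powers *)

Section PowerIntegral.
Context {R : realType}.
Notation mu := (@lebesgue_measure R).

Lemma isd_pow (a e p : R) : a < p ->
  isd (fun q => (q - a) `^ e) p (e * (p - a) `^ (e - 1)).
Proof.
move=> ap; apply: isd_eq.
  apply: (isd_comp (fun y => y `^ e)); first by apply: is_derive1_powR; rewrite subr_gt0.
  by apply: isdB; [exact: isd_id|exact: isd_cst].
by rewrite subr0 mulr1.
Qed.

(** The integrand may blow up at a, so the interval is exhausted from inside;
    d = (b - a) / 3 keeps the exhausting segments nonempty. *)
Lemma pow_int_oo (a b e : R) : a < b -> 0 < e ->
  igr `]a, b[ (fun p => (p - a) `^ (e - 1)) /\
  \int[mu]_(p in `]a, b[) (p - a) `^ (e - 1) = (b - a) `^ e / e.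
Proof.
move=> ab e0; have e0' : e != 0 by rewrite gt_eqF.
pose d := (b - a) / 3; have d0 : 0 < d by rewrite divr_gt0 ?subr_gt0.
have d3 : 3 * d = b - a by rewrite /d; field.
have h0 n : 0 < harmonic n :> R by rewrite invr_gt0.
have h1 n : harmonic n <= 1 :> R by rewrite invf_le1// ler1n.
have dh0 n : 0 < d * harmonic n by rewrite mulr_gt0.
have dh1 n : d * harmonic n <= d by rewrite ler_piMr// ltW.
have dF p : a < p -> isd (fun p => e^-1 * (p - a) `^ e) p ((p - a) `^ (e - 1)).
  move=> ap; apply: isd_eq; first by apply: isdZ; exact: isd_pow.
  by rewrite mulrA mulVf// mul1r.
have cdh : (d * harmonic n : R) @[n --> \oo] --> 0.
  by rewrite -(mulr0 d); apply: cvgMr; exact: cvg_harmonic.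
have -> : (b - a) `^ e / e = e^-1 * (b - a) `^ e - e^-1 * (a - a) `^ e.
  by rewrite subrr powR0// mulr0 subr0 mulrC.
have cw p : a < p -> {for p, continuous (fun p => (p - a) `^ (e - 1))}.
  by move=> ap; apply: isd_continuous (isd_pow _ _ _ ap).
have mI : measurable_fun `]a, b[ (fun p : measurableTypeR R => (p - a) `^ (e - 1)).
  apply: open_continuous_measurable_fun; first exact: interval_open.
  by move=> p /set_mem/=; rewrite in_itv/= => /andP[ap _]; exact: cw.
apply: (exhaust_ge0 _ (fun n => a + d * harmonic n) (fun n => b - d * harmonic n) _
  (fun p => e^-1 * (p - a) `^ e)) => //.
- by move=> p _; exact: powR_ge0.
- by move=> n; have := dh1 n; lra.
- move=> n x H; rewrite /= in_itv/=; have := dh0 n; lra.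
- move=> n m nm; have : d * harmonic m <= d * harmonic n.
    by apply: ler_wpM2l; [exact: ltW|exact: harmonic_anti].
  by lra.
- move=> x /=; rewrite in_itv/= => /andP[ax xb].
  have m0 : 0 < Num.min (x - a) (b - x) by rewrite lt_min !subr_gt0 ax.
  have /cvgrPdist_le/(_ _ m0) := cdh; apply: filterS => n.
  rewrite sub0r normrN gtr0_norm// => H.
  have : d * harmonic n <= Num.min (x - a) (b - x) := H.
  move=> {H}; rewrite le_min => /andP[H1 H2].
  suff : a + d * harmonic n <= x <= b - d * harmonic n by [].
  by apply/andP; split; lra.
- by move=> x /=; rewrite in_itv/= => /andP[ax _]; exact: dF.
- by move=> x /=; rewrite in_itv/= => /andP[ax _]; exact: cw.
- rewrite subrr powR0// mulr0 -(mulr0 e^-1); apply: cvgMr.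
  rewrite (_ : (fun n => _) = fun n => (d * harmonic n) `^ e); last first.
    by apply/funext => n; congr (_ `^ _); ring.
  have P0 : (fun y : R => y `^ e) x @[x --> 0^'+] --> (0 : R) by exact: powR_cvg0.
  move/cvg_at_rightP : P0 => /(_ (fun n => d * harmonic n)); apply.
  by split.
- have c := isd_continuous _ _ _ (dF b ab).
  have hb : (b - d * harmonic n) @[n --> \oo] --> b.
    by rewrite -[X in _ --> X]subr0; apply: cvgB => //; exact: cvg_cst.
  exact: (cvg_comp _ _ hb c).
Qed.

Lemma pow_igr (a b e : R) : 0 < e -> igr `]a, b] (fun p => (p - a) `^ (e - 1)).
Proof.
move=> e0; have [ab|ba] := ltP a b; last first.
  by rewrite set_itv_ge ?bnd_simp -?leNgt//; exact: integrable_set0.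
have [i1 _] := pow_int_oo a (b + 1) e (ltr_wpDr ler01 ab) e0.
apply: igrS i1 => // x /=; rewrite !in_itv/=; lra.
Qed.

Lemma pow_int (a b e : R) : a <= b -> 0 < e ->
  \int[mu]_(p in `]a, b]) (p - a) `^ (e - 1) = (b - a) `^ e / e.
Proof.
rewrite le_eqVlt => /predU1P[->|ab] e0.
  by rewrite set_itv_ge ?bnd_simp ?ltxx// Rintegral_set0 subrr powR0 ?mul0r// gt_eqF.
have [i1 <-] := pow_int_oo a b e ab e0.
by rewrite Rintegral_itv_bndo_bndc.
Qed.

Lemma pow_antitone (x y e : R) : 0 < x -> x <= y -> e <= 0 -> y `^ e <= x `^ e.
Proof.
move=> x0 xy e0; have y0 := lt_le_trans x0 xy.
rewrite -[e]opprK !(powRN _ (- e)) lef_pV2 ?posrE ?powR_gt0//.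
by apply: ge0_ler_powR; rewrite ?nnegrE ?oppr_ge0// ltW.
Qed.

Lemma split_oc (h : R -> R) (a c b : R) : a <= c -> c <= b -> igr `]a, b] h ->
  \int[mu]_(p in `]a, b]) h p = \int[mu]_(p in `]a, c]) h p + \int[mu]_(p in `]c, b]) h p.
Proof.
move=> ac cb ih; rewrite -(@Rintegral_itvB _ h (BRight a) (BRight b) c ih) ?bnd_simp//.
by rewrite addrC subrK.
Qed.

End PowerIntegral.

(** * A van der Corput estimate *)

Section VanDerCorput.
Context {R : realType}.
Notation mu := (@lebesgue_measure R).

Lemma trig_le_cmod (A B y : R) : `|A * sin y + B * cos y| <= cmod (A +i* B).
Proof.
apply: le_trans (plane_CS _ _ _ _) _.
by rewrite (addrC (sin y ^+ 2)) cos2Dsin2 sqrtr1 mulr1.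
Qed.

Lemma trig_le_cmod' (A B y : R) : `|A * cos y - B * sin y| <= cmod (A +i* B).
Proof.
have := plane_CS A B (cos y) (- sin y).
by rewrite mulrN sqrrN cos2Dsin2 sqrtr1 mulr1.
Qed.

(** Integrate the derivative of S / g1, where S = A sin g + B cos g: it is
    A cos g - B sin g plus terms with a derivative of the amplitude or of 1/g1.
    The boundary terms contribute 2 m0 / lam, the derivative of the amplitude
    v / lam.  As g2 <= 0 and g1 keeps its sign, 1/g1 is monotone, so the
    integral of its derivative contributes its total variation, at most 1/lam,
    times m0. *)
Lemma van_der_corput (A B A' B' V g g1 g2 : R -> R) (a b lam m0 v : R) :
  a <= b -> 0 < lam ->
  {within `[a, b], continuous A} -> {within `[a, b], continuous B} ->
  {within `[a, b], continuous A'} -> {within `[a, b], continuous B'} ->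
  {within `[a, b], continuous V} ->
  (forall x, a < x < b -> isd A x (A' x)) -> (forall x, a < x < b -> isd B x (B' x)) ->
  (forall x, isd g x (g1 x)) -> (forall x, isd g1 x (g2 x)) -> continuous g2 ->
  (forall x, a <= x <= b -> g2 x <= 0) ->
  (forall x, a <= x <= b -> lam <= g1 x) \/ (forall x, a <= x <= b -> g1 x <= - lam) ->
  (forall x, a <= x <= b -> cmod (A x +i* B x) <= m0) ->
  (forall x, a <= x <= b -> cmod (A' x +i* B' x) <= V x) ->
  \int[mu]_(x in `[a, b]) V x <= v ->
  `|\int[mu]_(x in `[a, b]) (A x * cos (g x) - B x * sin (g x))| <= (3 * m0 + v) / lam.
Proof.
rewrite le_eqVlt => /predU1P[<-{b} l0 _ _ _ _ _ _ _ _ _ _ _ _ hm hV|ab l0].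
  rewrite set_itv1 !Rintegral_set1 normr0 => v0.
  have m00 : 0 <= m0 by apply: le_trans (hm a _); rewrite ?cmod_ge0 ?lexx.
  by apply: divr_ge0; [apply: addr_ge0 => //; exact: mulr_ge0|exact: ltW].
move=> cA cB cA' cB' cV dA dB dg dg1 cg2 g2le sgn hm hV hv.
have g1n0 x : a <= x <= b -> g1 x != 0.
  move=> xab; case: sgn => /(_ x xab) H; first by rewrite gt_eqF// (lt_le_trans l0).
  by rewrite lt_eqF// (le_lt_trans H)// oppr_lt0.
have g1lam x : a <= x <= b -> `|(g1 x)^-1| <= lam^-1.
  move=> xab; rewrite normfV lef_pV2 ?posrE ?normr_gt0 ?g1n0//.
  case: sgn => /(_ x xab) H; first by rewrite (le_trans H)// ler_norm.
  by rewrite lerNr in H; rewrite -normrN (le_trans H)// ler_norm.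
have cg : continuous g by move=> x; exact: isd_continuous (dg x).
have cg1 : continuous g1 by move=> x; exact: isd_continuous (dg1 x).
have wV1 : {within `[a, b], continuous (fun x => (g1 x)^-1)}.
  apply: continuous_within => x /=; rewrite in_itv/= => xab.
  by apply: cvgV; [exact: g1n0|exact: cg1].
have wc : {within `[a, b], continuous (fun x => cos (g x))}.
  by apply: within_cts; apply: (cts_comp cos) => //; exact: continuous_cos.
have ws : {within `[a, b], continuous (fun x => sin (g x))}.
  by apply: within_cts; apply: (cts_comp sin) => //; exact: continuous_sin.
have wg2 : {within `[a, b], continuous g2} by exact: within_cts.
pose K x := A x * cos (g x) - B x * sin (g x).
pose S x := A x * sin (g x) + B x * cos (g x).
pose S' x := A' x * sin (g x) + B' x * cos (g x).
pose W x := - g2 x * ((g1 x)^-1 * (g1 x)^-1).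
pose h x := K x + (S' x * (g1 x)^-1 + S x * W x).
have cK : {within `[a, b], continuous K} by apply: withinB; apply: withinM.
have cS : {within `[a, b], continuous S} by apply: withinD; apply: withinM.
have cS' : {within `[a, b], continuous S'} by apply: withinD; apply: withinM.
have cW : {within `[a, b], continuous W}.
  by apply: withinM; [exact: withinN|exact: withinM].
have cR : {within `[a, b], continuous (fun x => S' x * (g1 x)^-1 + S x * W x)}.
  by apply: withinD; apply: withinM.
have ch : {within `[a, b], continuous h} by exact: withinD.
have sub x : a < x < b -> a <= x <= b by move=> /andP[/ltW -> /ltW ->].
have dQ x : a < x < b -> isd (fun x => S x * (g1 x)^-1) x (h x).
  move=> xab; have n0 := g1n0 x (sub x xab).
  apply: isd_eq.
    apply: isdM; last by apply: isdV => //; exact: dg1.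
    by apply: isdD; apply: isdM; [exact: dA|apply: isd_sin; exact: dg|
      exact: dB|apply: isd_cos; exact: dg].
  by rewrite /h /K /S /S' /W /=; field.
have dG x : a < x < b -> isd (fun x => (g1 x)^-1) x (W x).
  move=> xab; have n0 := g1n0 x (sub x xab).
  apply: isd_eq; first by apply: isdV => //; exact: dg1.
  by rewrite /W; field.
have Q_int := seg_FTC h _ a b ab ch (withinM _ _ _ cS wV1) dQ.
have W_int := seg_FTC W _ a b ab cW wV1 dG.
pose M x := lam^-1 * V x + m0 * W x.
have iV := seg_igr _ _ _ cV; have iW := seg_igr _ _ _ cW.
have iK := seg_igr _ _ _ cK; have iR := seg_igr _ _ _ cR.
have W0 x : a <= x <= b -> 0 <= W x.
  by move=> xab; rewrite mulr_ge0 ?oppr_ge0 ?g2le// -expr2 sqr_ge0.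
have Rle : `|\int[mu]_(x in `[a, b]) (S' x * (g1 x)^-1 + S x * W x)| <=
    \int[mu]_(x in `[a, b]) M x.
  apply: le_norm_integral => //.
    by apply: igrD => //; exact: igrZ.
  move=> x /=; rewrite in_itv/= => xab.
  rewrite (le_trans (ler_normD _ _))// (normrM (S' x)) (normrM (S x)).
  rewrite (ger0_norm (W0 _ xab)) lerD//.
    rewrite mulrC; apply: ler_pM => //; first exact: g1lam.
    exact: le_trans (trig_le_cmod _ _ _) (hV x xab).
  apply: ler_wpM2r; first exact: W0.
  exact: le_trans (trig_le_cmod _ _ _) (hm x xab).
have ME : \int[mu]_(x in `[a, b]) M x <= lam^-1 * v + m0 * ((g1 b)^-1 - (g1 a)^-1).
  rewrite RintegralD//; [|exact: igrZ|exact: igrZ].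
  rewrite !RintegralZl// W_int lerD2r ler_wpM2l// invr_ge0 ltW//.
have aab : a <= a <= b by rewrite lexx ltW.
have bab : a <= b <= b by rewrite lexx ltW.
have m00 : 0 <= m0 by apply: le_trans (hm a aab); exact: cmod_ge0.
have osc : (g1 b)^-1 - (g1 a)^-1 <= lam^-1.
  have := g1lam a aab; have := g1lam b bab; rewrite !ler_norml.
  case: sgn => H.
    have : 0 < (g1 a)^-1 by rewrite invr_gt0 (lt_le_trans l0)// H.
    by lra.
  have : (g1 b)^-1 < 0 by rewrite invr_lt0 (le_lt_trans (H b bab))// oppr_lt0.
  by lra.
have bdry x : a <= x <= b -> `|S x * (g1 x)^-1| <= m0 * lam^-1.
  move=> xab; rewrite normrM; apply: ler_pM => //; last exact: g1lam.
  exact: le_trans (trig_le_cmod _ _ _) (hm x xab).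
have KE : \int[mu]_(x in `[a, b]) K x = S b * (g1 b)^-1 - S a * (g1 a)^-1 -
    \int[mu]_(x in `[a, b]) (S' x * (g1 x)^-1 + S x * W x).
  rewrite -Q_int; apply/eqP; rewrite eq_sym subr_eq; apply/eqP.
  exact: RintegralD.
rewrite -/(K _) KE.
have t1 := le_trans (ler_normB (S b * (g1 b)^-1) (S a * (g1 a)^-1))
  (lerD (bdry b bab) (bdry a aab)).
have t2 := ler_wpM2l m00 osc.
apply: le_trans (ler_normB _ _) _.
apply: le_trans (lerD t1 (le_trans Rle ME)) _.
rewrite mulrDl (mulrC v) mulrC in t2 *.
by lra.
Qed.

End VanDerCorput.

(** * Oscillatory integrals with an endpoint singularity *)

Section Amplitude.
Context {R : realType}.
Notation mu_ := (@lebesgue_measure R).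
Variables (p1 p2 mu L N1 : R) (ur ui dr di : R -> R).
Hypothesis p12 : p1 < p2.
Hypothesis mu0 : 0 < mu.
Hypothesis mu1 : mu <= 1.
Hypothesis cur : {within `[p1, p2], continuous ur}.
Hypothesis cui : {within `[p1, p2], continuous ui}.
Hypothesis cdr : {within `[p1, p2], continuous dr}.
Hypothesis cdi : {within `[p1, p2], continuous di}.
Hypothesis dur : forall x, p1 < x < p2 -> isd ur x (dr x).
Hypothesis dui : forall x, p1 < x < p2 -> isd ui x (di x).
Hypothesis uL : forall x, p1 <= x <= p2 -> cmod (ur x +i* ui x) <= L.
Hypothesis dN1 : \int[mu_]_(x in `[p1, p2]) cmod (dr x +i* di x) <= N1.

Definition wgt (p : R) : R := (p - p1) `^ (mu - 1).
Definition osc (g : R -> R) (p : R) : R :=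
  wgt p * ur p * cos (g p) - wgt p * ui p * sin (g p).

Let L0 : 0 <= L.
Proof. by apply: le_trans (uL p1 _); rewrite ?cmod_ge0// lexx ltW. Qed.

Let cdu : {within `[p1, p2], continuous (fun x => cmod (dr x +i* di x))}.
Proof. exact: within_cmod. Qed.

Let N10 : 0 <= N1.
Proof. by apply: le_trans dN1; apply: Rintegral_ge0 => x _; exact: cmod_ge0. Qed.

Lemma oscE g p : osc g p = wgt p * (ur p * cos (g p) - ui p * sin (g p)).
Proof. by rewrite /osc; ring. Qed.

Lemma osc_igr g : continuous g -> igr `]p1, p2] (osc g).
Proof.
move=> cg.
have mU (v : R -> R) : {within `[p1, p2], continuous v} ->
    measurable_fun `]p1, p2] (v : measurableTypeR R -> R).
  move=> cv; apply: subspace_continuous_measurable_fun => //.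
  by apply: withinS cv => x /=; rewrite !in_itv/= => /andP[/ltW -> ->].
have ccg : continuous (fun p => cos (g p)) by apply: (cts_comp cos) => //; exact: continuous_cos.
have csg : continuous (fun p => sin (g p)) by apply: (cts_comp sin) => //; exact: continuous_sin.
have : igr `]p1, p2] (fun p => wgt p * (ur p * cos (g p) - ui p * sin (g p))).
  apply: (igrMb _ _ _ L) => //; first exact: pow_igr.
    by apply: mU; apply: withinB; apply: withinM => //; exact: within_cts.
  move=> p /=; rewrite in_itv/= => /andP[/ltW a b].
  by apply: le_trans (trig_le_cmod' _ _ _) (uL p _); rewrite a.
by apply: eq_igr => // p _; rewrite oscE.
Qed.

(** No cancellation is used: the weight is largest when the interval starts at
    the singularity. *)
Lemma osc_small g a b : continuous g -> p1 <= a -> a <= b -> b <= p2 ->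
  `|\int[mu_]_(p in `]a, b]) osc g p| <= L * ((b - a) `^ mu / mu).
Proof.
move=> cg pa ab bp.
rewrite -(pow_int a b mu ab mu0) -RintegralZl//; last exact: pow_igr.
apply: le_norm_integral => //.
- apply: igrS (osc_igr g cg) => // p /=; rewrite !in_itv/= => /andP[ap pb].
  by rewrite (le_lt_trans pa ap) (le_trans pb bp).
- by apply: igrZ => //; exact: pow_igr.
- move=> p /=; rewrite in_itv/= => /andP[ap pb].
  rewrite oscE normrM mulrC; apply: ler_pM => //.
    apply: le_trans (trig_le_cmod' _ _ _) (uL p _).
    by rewrite (le_trans pa (ltW ap)) (le_trans pb bp).
  rewrite ger0_norm ?powR_ge0//; apply: pow_antitone; rewrite ?subr_gt0//.
    by rewrite lerD2l lerN2.
  by rewrite subr_le0.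
Qed.

Section Phase.
Variables (g g1 g2 : R -> R).
Hypothesis dg : forall x, isd g x (g1 x).
Hypothesis dg1 : forall x, isd g1 x (g2 x).
Hypothesis cg2 : continuous g2.
Hypothesis g2le : forall x, p1 <= x <= p2 -> g2 x <= 0.

Let cg : continuous g. Proof. by move=> x; exact: isd_continuous (dg x). Qed.

(** The van der Corput estimate for the weighted amplitude.  The weight is
    decreasing, so its value at a bounds it, and its total variation is at most
    that value; this is the fourth L, after the 3 of [van_der_corput]. *)
Lemma osc_nonstat a b lam : p1 < a -> a <= b -> b <= p2 -> 0 < lam ->
  (forall x, a <= x <= b -> lam <= g1 x) \/ (forall x, a <= x <= b -> g1 x <= - lam) ->
  `|\int[mu_]_(p in `]a, b]) osc g p| <= wgt a * ((4 * L + N1) / lam).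
Proof.
move=> pa ab bp l0 sgn.
have sub x : a <= x <= b -> p1 <= x <= p2.
  by move=> /andP[ax xb]; rewrite (le_trans (ltW pa) ax) (le_trans xb bp).
have subS : `[a, b] `<=` `[p1, p2].
  by move=> x /=; rewrite !in_itv/=; exact: sub.
have sub' x : a < x < b -> p1 < x < p2.
  by move=> /andP[ax xb]; rewrite (lt_trans pa ax) (lt_le_trans xb bp).
have dw x : a <= x <= b -> isd wgt x ((mu - 1) * (x - p1) `^ (mu - 1 - 1)).
  by move=> /andP[ax _]; apply: isd_pow; exact: lt_le_trans ax.
have w0 x : 0 <= wgt x by exact: powR_ge0.
have wa x : a <= x <= b -> wgt x <= wgt a.
  move=> /andP[ax _]; apply: pow_antitone; rewrite ?subr_gt0 ?subr_le0//.
  by rewrite lerD2r.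
pose w' x := (mu - 1) * (x - p1) `^ (mu - 1 - 1).
have w'0 x : w' x <= 0 by rewrite mulr_le0_ge0 ?subr_le0// powR_ge0.
have cw : {within `[a, b], continuous wgt}.
  apply: continuous_within => x /=; rewrite in_itv/= => xab.
  exact: isd_continuous (dw x xab).
have cw' : {within `[a, b], continuous w'}.
  apply: withinZ; apply: continuous_within => x /=; rewrite in_itv/= => /andP[ax _].
  by apply: (isd_continuous _ _ _ (isd_pow p1 _ x _)); exact: lt_le_trans ax.
have s4 := withinS _ _ _ subS.
have cA : {within `[a, b], continuous (fun p => wgt p * ur p)} by apply: withinM => //; exact: s4.
have cB : {within `[a, b], continuous (fun p => wgt p * ui p)} by apply: withinM => //; exact: s4.
have cA' : {within `[a, b], continuous (fun p => w' p * ur p + wgt p * dr p)}.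
  by apply: withinD; apply: withinM => //; exact: s4.
have cB' : {within `[a, b], continuous (fun p => w' p * ui p + wgt p * di p)}.
  by apply: withinD; apply: withinM => //; exact: s4.
pose V p := wgt a * cmod (dr p +i* di p) + (- L) * w' p.
have cV : {within `[a, b], continuous V}.
  by apply: withinD; apply: withinZ => //; exact: s4.
have dA x : a < x < b -> isd (fun p => wgt p * ur p) x (w' x * ur x + wgt x * dr x).
  move=> /[dup] /sub' xp /andP[/ltW ax /ltW xb].
  by apply: isdM; [apply: dw; rewrite ax|exact: dur].
have dB x : a < x < b -> isd (fun p => wgt p * ui p) x (w' x * ui x + wgt x * di x).
  move=> /[dup] /sub' xp /andP[/ltW ax /ltW xb].
  by apply: isdM; [apply: dw; rewrite ax|exact: dui].
have hm x : a <= x <= b -> cmod ((wgt x * ur x) +i* (wgt x * ui x)) <= wgt a * L.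
  move=> xab; have -> : (wgt x * ur x) +i* (wgt x * ui x) = (wgt x)%:C * (ur x +i* ui x).
    by apply: eqRI; rewrite !RIE /=; ring.
  rewrite cmodM cmod_real ger0_norm//; apply: ler_pM; rewrite ?cmod_ge0//; first exact: wa.
  by apply: uL; exact: sub.
have hV x : a <= x <= b ->
    cmod ((w' x * ur x + wgt x * dr x) +i* (w' x * ui x + wgt x * di x)) <= V x.
  move=> xab.
  have -> : (w' x * ur x + wgt x * dr x) +i* (w' x * ui x + wgt x * di x) =
      (wgt x)%:C * (dr x +i* di x) + (w' x)%:C * (ur x +i* ui x).
    by apply: eqRI; rewrite !RIE /=; ring.
  apply: le_trans (cmodD _ _) _; rewrite !cmodM !cmod_real ger0_norm//.
  rewrite (ler0_norm (w'0 x)); apply: lerD.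
    by apply: ler_wpM2r; [exact: cmod_ge0|exact: wa].
  have -> : - L * w' x = - w' x * L by ring.
  apply: ler_wpM2l; first by rewrite oppr_ge0.
  by apply: uL; exact: sub.
have iV1 := seg_igr _ _ _ (s4 _ cdu); have iV2 := seg_igr _ _ _ cw'.
have hv : \int[mu_]_(x in `[a, b]) V x <= wgt a * N1 + L * wgt a.
  rewrite RintegralD//; [|exact: igrZ|exact: igrZ].
  rewrite (RintegralZl (wgt a) _ iV1)// (RintegralZl (- L) _ iV2)//; apply: lerD.
    apply: ler_wpM2l => //; apply: le_trans dN1.
    by apply: le_integral_sub => //; [exact: seg_igr|move=> x _; exact: cmod_ge0].
  have [abE|] := eqVneq a b.
    by rewrite -abE set_itv1 Rintegral_set1 mulr0 mulr_ge0.
  move=> nab; have ab' : a < b by rewrite lt_neqAle nab ab.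
  rewrite (seg_FTC w' wgt a b ab' cw' cw); last first.
    by move=> x /andP[/ltW ax /ltW xb]; apply: dw; rewrite ax.
  rewrite mulNr -mulrN opprB; apply: ler_wpM2l => //.
  by rewrite lerBlDr lerDl.
have iK : igr `]a, b] (osc g).
  apply: igrS (osc_igr g cg) => // p /=; rewrite !in_itv/= => /andP[ap pb].
  by rewrite (lt_trans pa ap) (le_trans pb bp).
rewrite Rintegral_itv_obnd_cbnd//.
have g2le' x : a <= x <= b -> g2 x <= 0 by move=> /sub; exact: g2le.
have := van_der_corput _ _ _ _ V g g1 g2 a b lam _ _ ab l0 cA cB cA' cB' cV dA dB
  dg dg1 cg2 g2le' sgn hm hV hv.
move/le_trans; apply.
rewrite [leRHS]mulrA; apply: ler_wpM2r; first by rewrite invr_ge0 ltW.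
by lra.
Qed.

(** The same estimate with the weight bounded at distance dlt from p1, allowing
    an empty interval: the cutting points of the next two lemmas may coincide. *)
Lemma osc_tail dlt c b lam : 0 < dlt -> p1 <= c -> c <= b -> b <= p2 -> 0 < lam ->
  (c < b -> p1 + dlt <= c) ->
  (c < b -> (forall x, c <= x <= b -> lam <= g1 x) \/ (forall x, c <= x <= b -> g1 x <= - lam)) ->
  `|\int[mu_]_(p in `]c, b]) osc g p| <= dlt `^ (mu - 1) * ((4 * L + N1) / lam).
Proof.
move=> d0 pc + bp l0; rewrite le_eqVlt => /predU1P[<- _ _|cb /(_ cb) cd /(_ cb) sgn].
  rewrite set_itv_ge ?bnd_simp ?ltxx// Rintegral_set0 normr0.
  apply: mulr_ge0; first exact: powR_ge0.
  by apply: divr_ge0; [apply: addr_ge0 => //; exact: mulr_ge0|exact: ltW].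
have pc' : p1 < c by apply: lt_le_trans cd; rewrite ltrDl.
apply: le_trans (osc_nonstat _ _ _ pc' (ltW cb) bp l0 sgn) _.
apply: ler_wpM2r.
  by apply: divr_ge0; [apply: addr_ge0 => //; exact: mulr_ge0|exact: ltW].
apply: pow_antitone => //; last by rewrite subr_le0.
by rewrite lerBrDr addrC.
Qed.

(** Cut at distance dlt from the singularity. *)
Lemma osc_nonstationary dlt lam : 0 < dlt -> 0 < lam ->
  (forall x, p1 <= x <= p2 -> lam <= g1 x) \/ (forall x, p1 <= x <= p2 -> g1 x <= - lam) ->
  `|\int[mu_]_(p in `]p1, p2]) osc g p| <=
    L * (dlt `^ mu / mu) + dlt `^ (mu - 1) * ((4 * L + N1) / lam).
Proof.
move=> d0 l0 sgn; pose c := Num.min (p1 + dlt) p2.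
have pc : p1 <= c by rewrite le_min lerDl !ltW.
have cp : c <= p2 by rewrite ge_min lexx orbT.
rewrite (split_oc _ p1 c p2)//; last exact: osc_igr.
apply: le_trans (ler_normD _ _) _; apply: lerD.
  apply: le_trans (osc_small g p1 c cg _ _ _) _ => //.
  apply: ler_wpM2l => //; apply: ler_wpM2r; first by rewrite invr_ge0 ltW.
  apply: ge0_ler_powR; rewrite ?nnegrE ?subr_ge0 ?(ltW d0) ?(ltW mu0)//.
  by rewrite lerBlDl ge_min lexx.
apply: osc_tail => //.
  by rewrite /c; case: (leP (p1 + dlt) p2) => h //; rewrite ltxx.
move=> _; case: sgn => H; [left|right] => x /andP[cx xp]; apply: H;
  by rewrite (le_trans pc cx).
Qed.

(** Cut at c1 = p1 + dlt and at c2, c3 = p0 -+ dlt, all clipped so that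
    p1 <= c1 <= c2 <= c3 <= p2.  The first piece has length at most dlt and the third
    at most 2 dlt, whence the factor 3; on the other two |g1| >= lam dlt. *)
Lemma osc_stationary dlt lam p0 : 0 < dlt -> 0 < lam -> p1 <= p0 <= p2 ->
  (forall p, p1 <= p <= p2 -> p0 < p -> g1 p <= - (lam * (p - p0))) ->
  (forall p, p1 <= p <= p2 -> p < p0 -> lam * (p0 - p) <= g1 p) ->
  `|\int[mu_]_(p in `]p1, p2]) osc g p| <=
    3 * (L * (dlt `^ mu / mu)) + 2 * (dlt `^ (mu - 1) * ((4 * L + N1) / (lam * dlt))).
Proof.
move=> d0 l0 /andP[p10 p02] gr gl; pose c1 := Num.min (p1 + dlt) p2.
pose c2 := Num.max c1 (p0 - dlt); pose c3 := Num.min p2 (Num.max c1 (p0 + dlt)).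
have c1E : c1 < p2 -> c1 = p1 + dlt by rewrite /c1; case: (leP (p1 + dlt) p2) => h //; rewrite ltxx.
have pc1 : p1 <= c1 by rewrite le_min lerDl !ltW.
have c1p : c1 <= p2 by rewrite ge_min lexx orbT.
have c12 : c1 <= c2 by rewrite le_max lexx.
have c2p : c2 <= p2 by rewrite ge_max c1p/= lerBlDr ler_wpDr// ltW.
have c23 : c2 <= c3.
  rewrite le_min c2p/= ge_max le_max lexx/= le_max.
  by apply/orP; right; lra.
have c3p : c3 <= p2 by rewrite ge_min lexx.
have c32 : c3 - c2 <= 2 * dlt.
  rewrite lerBlDr; have [h|h] := leP (p0 + dlt) c1.
    have : c3 <= c1 by rewrite /c3 (max_l h) ge_min lexx orbT.
    by lra.
  have : c3 <= p0 + dlt by rewrite /c3 (max_r (ltW h)) ge_min lexx orbT.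
  have : p0 - dlt <= c2 by rewrite le_max lexx orbT.
  by lra.
have c1d : c1 - p1 <= dlt by rewrite lerBlDl ge_min lexx.
have pc2 := le_trans pc1 c12; have pc3 := le_trans pc2 c23.
have iK := osc_igr g cg.
have iK1 : igr `]c1, p2] (osc g).
  apply: igrS iK => // p /=; rewrite !in_itv/= => /andP[ap ->].
  by rewrite (le_lt_trans pc1 ap).
have iK2 : igr `]c2, p2] (osc g).
  apply: igrS iK => // p /=; rewrite !in_itv/= => /andP[ap ->].
  by rewrite (le_lt_trans pc2 ap).
rewrite (split_oc _ p1 c1 p2)// (split_oc _ c1 c2 p2)// (split_oc _ c2 c3 p2)//.
have ld0 : 0 < lam * dlt by rewrite mulr_gt0.
have iv0 : 0 <= mu^-1 by rewrite invr_ge0 ltW.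
have b1 : `|\int[mu_]_(p in `]p1, c1]) osc g p| <= L * (dlt `^ mu / mu).
  apply: le_trans (osc_small g p1 c1 cg _ _ _) _ => //.
  apply: ler_wpM2l => //; apply: ler_wpM2r => //.
  by apply: ge0_ler_powR; rewrite ?nnegrE ?subr_ge0 ?(ltW d0) ?(ltW mu0).
have b3 : `|\int[mu_]_(p in `]c2, c3]) osc g p| <= 2 * (L * (dlt `^ mu / mu)).
  apply: le_trans (osc_small g c2 c3 cg _ _ _) _ => //.
  rewrite [leRHS]mulrCA; apply: ler_wpM2l => //; rewrite mulrA; apply: ler_wpM2r => //.
  apply: (@le_trans _ _ ((2 * dlt) `^ mu)).
    apply: ge0_ler_powR; rewrite ?nnegrE ?subr_ge0 ?(ltW mu0)//.
    by apply: mulr_ge0 => //; exact: ltW.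
  rewrite powRM ?(ltW d0)//; apply: ler_wpM2r; first exact: powR_ge0.
  by apply: ler1_powR => //; rewrite ler1n.
have b2 : `|\int[mu_]_(p in `]c1, c2]) osc g p| <= dlt `^ (mu - 1) * ((4 * L + N1) / (lam * dlt)).
  apply: osc_tail => // lt12.
    by rewrite -c1E// (lt_le_trans lt12).
  left=> x /andP[cx xc].
  have c2E : c2 = p0 - dlt by move: lt12; rewrite /c2; case: (leP c1 (p0 - dlt)) => h //; rewrite
    ltxx.
  have xd : x <= p0 - dlt by rewrite -c2E.
  apply: le_trans (gl x _ _); first by apply: ler_wpM2l; [exact: ltW|lra].
    by rewrite (le_trans pc1 cx) (le_trans xc c2p).
  by lra.
have b4 : `|\int[mu_]_(p in `]c3, p2]) osc g p| <= dlt `^ (mu - 1) * ((4 * L + N1) / (lam * dlt)).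
  apply: osc_tail => // lt3.
    by rewrite -c1E ?(le_trans c12)//; exact: le_lt_trans (le_trans c12 c23) lt3.
  right=> x /andP[cx xc].
  have c3E : p0 + dlt <= c3.
    move: lt3; rewrite /c3; case: (leP p2 (Num.max c1 (p0 + dlt))) => [_|h _]; first by rewrite
      ltxx.
    by rewrite le_max lexx orbT.
  have xd : p0 + dlt <= x by exact: le_trans cx.
  apply: le_trans (gr x _ _) _.
  - by rewrite (le_trans pc3 cx) xc.
  - by lra.
  - by rewrite lerN2; apply: ler_wpM2l; [exact: ltW|lra].
apply: le_trans (ler_normD _ _) _.
apply: le_trans (lerD b1 (ler_normD _ _)) _.
apply: le_trans (lerD (lexx _) (lerD b2 (ler_normD _ _))) _.
apply: le_trans (lerD (lexx _) (lerD (lexx _) (lerD b3 b4))) _.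
by lra.
Qed.

(** If g1 does not vanish on [p1, p2], the endpoint closest to vanishing plays the role of
    the stationary point, which makes one estimate cover all cases. *)
Lemma stationary_point lam : 0 < lam -> (forall x, p1 <= x <= p2 -> g2 x <= - lam) ->
  exists2 p0, p1 <= p0 <= p2 &
  (forall p, p1 <= p <= p2 -> p0 < p -> g1 p <= - (lam * (p - p0))) /\
  (forall p, p1 <= p <= p2 -> p < p0 -> lam * (p0 - p) <= g1 p).
Proof.
move=> l0 g2l.
have cg1 : continuous g1 by move=> x; exact: isd_continuous (dg1 x).
have dec p q : p1 <= p -> p <= q -> q <= p2 -> g1 q <= g1 p - lam * (q - p).
  move=> pp pq qp.
  have [z + E] := MVT_segment pq (fun z _ => dg1 z) (within_cts _ _ cg1).
  rewrite in_itv/= => /andP[pz zq].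
  have H : g2 z <= - lam by apply: g2l; rewrite (le_trans pp pz) (le_trans zq qp).
  have := ler_wpM2r (_ : 0 <= q - p) H; rewrite subr_ge0 => /(_ pq); rewrite -E.
  by lra.
have [h1|h1] := leP (g1 p1) 0.
  exists p1; first by rewrite lexx ltW.
  split=> p /andP[a b]; last by rewrite ltNge a.
  by move=> lt; have := dec p1 p (lexx _) a b; lra.
have [h2|h2] := leP 0 (g1 p2).
  exists p2; first by rewrite lexx ltW.
  split=> p /andP[a b]; first by rewrite ltNge b.
  by move=> lt; have := dec p p2 a b (lexx _); lra.
have [] := IVT (ltW p12) (within_cts `[p1, p2] _ cg1)
  (_ : Num.min (g1 p1) (g1 p2) <= 0 <= Num.max (g1 p1) (g1 p2)).
  by rewrite ge_min le_max (ltW h1) (ltW h2) orbT.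
move=> p0; rewrite in_itv/= => /andP[a0 b0] g0; exists p0; first by rewrite a0.
split=> p /andP[a b] lt.
  by have := dec p0 p a0 (ltW lt) b; rewrite g0; lra.
by have := dec p p0 a (ltW lt) b0; rewrite g0; lra.
Qed.

End Phase.
End Amplitude.

(** * Time averages against the Gamma density *)

Section GammaKernel.
Context {R : realType}.
Notation mu_ := (@lebesgue_measure R).

(** Half of the exponential absorbs the factor t. *)
Lemma texp_le (e t : R) : 0 < e -> 0 <= t ->
  t * expR (- (e * t)) <= 2 / e * expR (- (e / 2 * t)).
Proof.
move=> e0 t0.
have -> : expR (- (e * t)) = expR (- (e / 2 * t)) * expR (- (e / 2 * t)).
  by rewrite -expRD; congr expR; field.
rewrite mulrA; apply: ler_wpM2r; first exact: expR_ge0.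
rewrite expRN ler_pdivrMr ?expR_gt0//.
apply: (@le_trans _ _ (2 / e * (e / 2 * t))).
  by rewrite le_eqVlt; apply/orP; left; apply/eqP; field; rewrite gt_eqF.
apply: ler_wpM2l; first by apply: divr_ge0 => //; exact: ltW.
by apply: le_trans (expR_ge1Dx _); rewrite lerDr.
Qed.

(** The density of the Gamma distribution of shape 2, up to the factor e^2. *)
Definition gam (e t : R) : R := t * expR (- e * t).

Lemma gam_igr (e : R) : 0 < e -> igr `]0, +oo[ (gam e).
Proof.
move=> e0; have e20 : 0 < e / 2 by rewrite divr_gt0.
apply: (igr_dom _ _ (fun t => 2 / e * expR (- (e / 2 * `|t|)))) => //.
- apply: measurable_funTS; apply: continuous_measurable_fun; apply: ctsM; first exact: cts_id.
  by apply: (cts_comp expR); [exact: continuous_expR|apply: ctsZ; exact: cts_id].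
- apply: igrZ => //; apply: igrS (exp_abs_igr _ e20) => //.
- move=> t /=; rewrite in_itv/= andbT => t0.
  rewrite /gam ger0_norm; last by rewrite mulr_ge0 ?expR_ge0// ltW.
  by rewrite gtr0_norm// mulNr; exact/texp_le/ltW.
Qed.

Section antiderivatives.
Variables (e z : R).
Hypothesis e0 : 0 < e.
Let D := e ^+ 2 + z ^+ 2.
(* Minus the real and imaginary parts of (e + iz) t / D + (e + iz)^2 / D^2, which
   come from the primitive of t e^{-(e - iz) t}. *)
Let P t := - t * e / D - (e ^+ 2 - z ^+ 2) / D ^+ 2.
Let Q t := - t * z / D - 2 * e * z / D ^+ 2.

Let D0 : D != 0.
Proof. by rewrite gt_eqF// ltr_pwDl ?exprn_gt0// sqr_ge0. Qed.

Let dP t : isd P t (- e / D).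
Proof.
apply: isd_eq.
  apply: isdB; last exact: isd_cst.
  apply: isdM; last exact: isd_cst.
  by apply: isdM; [apply: isdN; exact: isd_id|exact: isd_cst].
by rewrite /=; ring.
Qed.

Let dQ t : isd Q t (- z / D).
Proof.
apply: isd_eq.
  apply: isdB; last exact: isd_cst.
  apply: isdM; last exact: isd_cst.
  by apply: isdM; [apply: isdN; exact: isd_id|exact: isd_cst].
by rewrite /=; ring.
Qed.

Let dtz t : isd (fun t => t * z) t z.
Proof.
by apply: isd_eq; [apply: isdM; [exact: isd_id|exact: isd_cst]|rewrite /=; ring].
Qed.

Lemma gamcos_isd t : isd (fun t => expR (- e * t) * (P t * cos (t * z) - Q t * sin (t * z))) t
  (gam e t * cos (t * z)).
Proof.
apply: isd_eq.
  apply: isdM; first by apply: isd_exp; apply: isdZ; exact: isd_id.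
  by apply: isdB; apply: isdM; [exact: dP|apply: isd_cos; exact: dtz|
    exact: dQ|apply: isd_sin; exact: dtz].
by rewrite /gam /P /Q /=; move: D0; rewrite /D => D0'; field.
Qed.

Lemma gamsin_isd t : isd (fun t => expR (- e * t) * (P t * sin (t * z) + Q t * cos (t * z))) t
  (gam e t * sin (t * z)).
Proof.
apply: isd_eq.
  apply: isdM; first by apply: isd_exp; apply: isdZ; exact: isd_id.
  by apply: isdD; apply: isdM; [exact: dP|apply: isd_sin; exact: dtz|
    exact: dQ|apply: isd_cos; exact: dtz].
by rewrite /gam /P /Q /=; move: D0; rewrite /D => D0'; field.
Qed.

Let lim0 (k1 k2 : R -> R) : (forall y, `|k1 y| <= 1) -> (forall y, `|k2 y| <= 1) ->
  expR (- e * n.+2%:R) * (P n.+2%:R * k1 (n.+2%:R * z) + Q n.+2%:R * k2 (n.+2%:R * z))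
    @[n --> \oo] --> (0 : R).
Proof.
move=> k11 k21.
have e20 : 0 < e / 2 by rewrite divr_gt0.
pose a := `|e / D| + `|z / D|; pose b := `|(e ^+ 2 - z ^+ 2) / D ^+ 2| + `|2 * e * z / D ^+ 2|.
have a0 : 0 <= a by exact: addr_ge0.
have b0 : 0 <= b by exact: addr_ge0.
apply: (damped_cvg0 (e / 2) (a * (2 / e) + b)) => // n.
set t : R := n.+2%:R; have t0 : 0 <= t by [].
rewrite normrM ger0_norm ?expR_ge0//.
have PQ : `|P t * k1 (t * z) + Q t * k2 (t * z)| <= a * t + b.
  apply: le_trans (trig_comb_le _ _ _ _ (k11 _) (k21 _)) _.
  have h1 : `|P t| <= `|e / D| * t + `|(e ^+ 2 - z ^+ 2) / D ^+ 2|.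
    rewrite /P (le_trans (ler_normB _ _))// lerD2r.
    by rewrite mulNr mulNr normrN -mulrA normrM (ger0_norm t0) mulrC.
  have h2 : `|Q t| <= `|z / D| * t + `|2 * e * z / D ^+ 2|.
    rewrite /Q (le_trans (ler_normB _ _))// lerD2r.
    by rewrite mulNr mulNr normrN -mulrA normrM (ger0_norm t0) mulrC.
  by rewrite /a /b; lra.
apply: le_trans (ler_wpM2l (expR_ge0 _) PQ) _.
rewrite [leLHS]mulrDr [leRHS]mulrDl; apply: lerD.
  have -> : expR (- e * t) * (a * t) = a * (t * expR (- e * t)) by ring.
  by rewrite -[leRHS]mulrA mulNr; apply: ler_wpM2l => //; exact: texp_le.
rewrite mulrC; apply: ler_wpM2l => //; rewrite ler_expR mulNr lerN2.
by apply: ler_wpM2r => //; lra.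
Qed.

Let cgam : continuous (gam e).
Proof.
apply: ctsM; first exact: cts_id.
by apply: (cts_comp expR); [exact: continuous_expR|apply: ctsZ; exact: cts_id].
Qed.

Let ctz (k : R -> R) : continuous k -> continuous (fun t : R => k (t * z)).
Proof.
by move=> ck; apply: (cts_comp k) => //; apply: ctsM; [exact: cts_id|exact: cts_cst].
Qed.

Let igrk (k : R -> R) : continuous k -> (forall y, `|k y| <= 1) ->
  igr `]0, +oo[ (fun t => gam e t * k (t * z)).
Proof.
move=> ck k1; apply: (igrMb _ _ (fun t => k (t * z)) 1) => //; first exact: gam_igr.
by apply: measurable_funTS; apply: continuous_measurable_fun; exact: ctz.
Qed.

Lemma gam_cos : \int[mu_]_(t in `]0, +oo[) (gam e t * cos (t * z)) =
  (e ^+ 2 - z ^+ 2) / (e ^+ 2 + z ^+ 2) ^+ 2.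
Proof.
rewrite (int_pos _ _ 0 (igrk _ (@continuous_cos R) (@cos_max R)) gamcos_isd).
- by rewrite /P /Q !mul0r mulr0 expR0 cos0 sin0 /D; ring.
- by apply: ctsM => //; apply: ctz; exact: continuous_cos.
- have Ns y : `|- sin y| <= 1 :> R by rewrite normrN sin_max.
  apply: cvg_trans (lim0 cos (fun y => - sin y) (@cos_max R) Ns).
  by apply: near_eq_cvg; near=> n; rewrite mulrN.
Unshelve. all: by end_near. Qed.

Lemma gam_sin : \int[mu_]_(t in `]0, +oo[) (gam e t * sin (t * z)) =
  2 * e * z / (e ^+ 2 + z ^+ 2) ^+ 2.
Proof.
rewrite (int_pos _ _ 0 (igrk _ (@continuous_sin R) (@sin_max R)) gamsin_isd).
- by rewrite /P /Q !mul0r mulr0 expR0 cos0 sin0 /D; ring.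
- by apply: ctsM => //; apply: ctz; exact: continuous_sin.
- exact: lim0 (@sin_max R) (@cos_max R).
Qed.

End antiderivatives.

Lemma gam_int (e : R) : 0 < e -> \int[mu_]_(t in `]0, +oo[) gam e t = e ^- 2.
Proof.
move=> e0; have := gam_cos e 0 e0.
rewrite expr0n/= addr0 subr0 => E.
transitivity (\int[mu_]_(t in `]0, +oo[) (gam e t * cos (t * 0))).
  by apply: eq_Rintegral => t _; rewrite mulr0 cos0 mulr1.
by rewrite E; field; rewrite gt_eqF.
Qed.

(** The average of t^(-s) has the order e^s of its value at t = 1/e; the
    exponential is dropped below 1/e, and t^(-s) is frozen above. *)
Lemma gam_pow_le (e s : R) : 0 < e -> 0 < s < 2 ->
  igr `]0, +oo[ (fun t => gam e t * t `^ (- s)) /\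
  \int[mu_]_(t in `]0, +oo[) (gam e t * t `^ (- s)) <= ((2 - s)^-1 + 1) * e `^ (s - 2).
Proof.
move=> e0 /andP[s0 s2].
have s20 : 0 < 2 - s by lra.
have ei0 : 0 < e^-1 by rewrite invr_gt0.
have einv x : e^-1 `^ x = e `^ (- x).
  by rewrite -[e^-1](powR_inv1 (ltW e0)) -powRrM mulN1r.
pose g1 t := ((fun t : R => (t - 0) `^ ((2 - s) - 1)) \_ `]0, e^-1]) t.
pose g2 t := e `^ s * gam e t.
have i0 := pow_igr (0 : R) e^-1 (2 - s) s20.
have i1 : igr `]0, +oo[ g1.
  by apply: igrS (igr_patch _ _ _ i0) => //.
have i2 : igr `]0, +oo[ g2 by apply: igrZ => //; exact: gam_igr.
have bd t : 0 < t -> `|gam e t * t `^ (- s)| <= g1 t + g2 t.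
  move=> t0; have E : t * t `^ (- s) = t `^ (1 - s).
    rewrite powRD; last by rewrite (gt_eqF t0) implybT.
    by rewrite powRr1// ltW.
  have ge0 : 0 <= gam e t by rewrite mulr_ge0 ?expR_ge0// ltW.
  rewrite (ger0_norm (mulr_ge0 ge0 (powR_ge0 _ _))).
  have g20 : 0 <= g2 t by rewrite mulr_ge0 ?powR_ge0.
  rewrite /g1 patchE; case: ifPn => h.
    apply: (@le_trans _ _ (t `^ (1 - s))).
      rewrite /gam mulrAC E ler_piMr ?powR_ge0// -expR0 ler_expR mulNr oppr_le0.
      by rewrite mulr_ge0// ltW.
    rewrite subr0 (_ : 2 - s - 1 = 1 - s); first by rewrite lerDl.
    by ring.
  have te : e^-1 <= t.
    rewrite leNgt; apply/negP => lt; move/negP : h; apply.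
    by rewrite inE/= in_itv/= t0 ltW.
  rewrite add0r /g2 mulrC; apply: ler_wpM2r => //.
  have -> : e `^ s = e^-1 `^ (- s) by rewrite einv opprK.
  by apply: pow_antitone => //; lra.
have mw : measurable_fun (`]0, +oo[ : set R) (fun t : measurableTypeR R => t `^ (- s)).
  apply: open_continuous_measurable_fun; first exact: interval_open.
  move=> y yI; have y0 : 0 < y by move: yI; rewrite inE/= in_itv/= andbT.
  have := isd_continuous _ _ _ (isd_pow 0 (- s) y y0).
  by rewrite (_ : (fun q => (q - 0) `^ (- s)) = fun q => q `^ (- s))//;
    apply/funext => q; rewrite subr0.
have i3 : igr `]0, +oo[ (fun t => gam e t * t `^ (- s)).
  apply: (igr_dom _ _ (fun t => g1 t + g2 t)) => //.
  - by apply: measurable_funM => //; exact: igr_meas (gam_igr e e0).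
  - exact: igrD.
  - by move=> y; rewrite /= in_itv/= andbT; exact: bd.
split=> //.
apply: (@le_trans _ _ (\int[mu_]_(t in `]0, +oo[) (g1 t + g2 t))).
  apply: le_Rintegral => //; first exact: igrD.
  move=> y; rewrite /= in_itv/= andbT => /bd; apply: le_trans; exact: ler_norm.
rewrite RintegralD// (RintegralZl (e `^ s) _ (gam_igr e e0))// gam_int//.
have -> : \int[mu_]_(t in `]0, +oo[) g1 t = (e^-1 - 0) `^ (2 - s) / (2 - s).
  rewrite -pow_int ?(ltW ei0)// -Rintegral_mkcondr setIidr//.
  by move=> y; rewrite /= !in_itv/= => /andP[->].
rewrite subr0 mulrDl mul1r (mulrC _ (2 - s)^-1).
have -> : e^-1 `^ (2 - s) = e `^ (s - 2).
  by rewrite einv opprB.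
rewrite lerD2l powRD; last by rewrite (gt_eqF e0) implybT.
by rewrite powR_invn ?(ltW e0)// exprVn.
Qed.

End GammaKernel.

(** * Lower bounds for oscillatory integrals *)

Section Optimality.
Context {R : realType}.
Notation mu_ := (@lebesgue_measure R).
Variables (p1 p2 mu c C K A0 : R) (k : nat) (A B phi : R -> R).
Hypothesis p12 : p1 < p2.
Hypothesis mu0 : 0 < mu.
Hypothesis mu1 : mu <= 1.
Hypothesis k0 : (0 < k)%N.
Hypothesis c0 : 0 < c.
Hypothesis A00 : 0 < A0.
Hypothesis cphi : continuous phi.
Hypothesis phic : forall p, p1 < p <= p2 -> c * (p - p1) ^+ k <= phi p.
Hypothesis phiC : forall p, p1 < p <= p2 -> phi p <= C * (p - p1) ^+ k.
Hypothesis AK : forall p, p1 < p <= p2 -> `|A p - A0| <= K * (p - p1).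
Hypothesis BK : forall p, p1 < p <= p2 -> `|B p| <= K * (p - p1).
Let w (p : R) : R := (p - p1) `^ (mu - 1).
Hypothesis iA : igr `]p1, p2] (fun p => w p * A p).
Hypothesis iB : igr `]p1, p2] (fun p => w p * B p).

(** The integral to be bounded below, normalised so that A is close to the
    positive number A0 near p1 while B vanishes there. *)
Definition osc_sin (t : R) : R :=
  \int[mu_]_(p in `]p1, p2]) (w p * A p * sin (t * phi p) + w p * B p * cos (t * phi p)).

Let K0 : 0 <= K.
Proof.
have := AK p2; rewrite p12 lexx => /(_ isT) H.
by have := le_trans (normr_ge0 _) H; rewrite pmulr_lge0// subr_gt0.
Qed.

Let C0 : 0 < C.
Proof.
have := le_trans (phic p2 _) (phiC p2 _); rewrite p12 lexx => /(_ isT isT).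
rewrite ler_pM2r ?exprn_gt0 ?subr_gt0// => cC; exact: lt_le_trans cC.
Qed.

Let phi_gt0 p : p1 < p <= p2 -> 0 < phi p.
Proof.
move=> h; apply: lt_le_trans (phic p h); rewrite mulr_gt0// exprn_gt0// subr_gt0.
by case/andP: h.
Qed.

Let mtphi (h : R -> R) (t : R) : continuous h ->
  measurable_fun setT (fun p : measurableTypeR R => h (t * phi p)).
Proof.
move=> ch; apply: continuous_measurable_fun; apply: (cts_comp h) => //.
exact: ctsZ.
Qed.

Let igrk (a h : R -> R) (t : R) : continuous h -> (forall y, `|h y| <= 1) ->
  igr `]p1, p2] a -> igr `]p1, p2] (fun p => a p * h (t * phi p)).
Proof.
move=> ch h1 ia; apply: (igrMb _ _ (fun p => h (t * phi p)) 1) => //.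
by apply: measurable_funTS; exact: mtphi.
Qed.

(** Averages of sin(t y) and cos(t y) over t against e^2 t e^{-e t}.  The sine
    average is positive for y > 0, which is why sin is made to carry the main term. *)
Definition ksin (e y : R) := 2 * e ^+ 3 * y / (e ^+ 2 + y ^+ 2) ^+ 2.
Definition kcos (e y : R) := e ^+ 2 * (e ^+ 2 - y ^+ 2) / (e ^+ 2 + y ^+ 2) ^+ 2.

Lemma average (a h kk : R -> R) (e : R) : 0 < e -> continuous h -> (forall y, `|h y| <= 1) ->
  (forall z, e ^+ 2 * \int[mu_]_(t in `]0, +oo[) (gam e t * h (t * z)) = kk z) ->
  igr `]p1, p2] a ->
  [/\ igr `]0, +oo[ (fun t => gam e t * \int[mu_]_(p in `]p1, p2]) (a p * h (t * phi p))),
    igr `]p1, p2] (fun p => a p * kk (phi p)) &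
    e ^+ 2 * \int[mu_]_(t in `]0, +oo[)
      (gam e t * \int[mu_]_(p in `]p1, p2]) (a p * h (t * phi p))) =
    \int[mu_]_(p in `]p1, p2]) (a p * kk (phi p))].
Proof.
move=> e0 ch h1 kkE ia.
have ig := gam_igr e e0.
have e1 : e != 0 by rewrite gt_eqF.
have [G GE iG] : exists2 G : R -> R, G = gam e \_ `]0, +oo[ & igr setT G.
  by exists (gam e \_ `]0, +oo[) => //; exact: igr_patch.
have [a' aE ia'] : exists2 a' : R -> R, a' = a \_ `]p1, p2] & igr setT a'.
  by exists (a \_ `]p1, p2]) => //; exact: igr_patch.
have mk : measurable_fun setT (fun z : R * R => h (z.1 * phi z.2)).
  apply: (measurableT_comp (f := h)); first exact: continuous_measurable_fun.
  apply: measurable_funM => //; apply: (measurableT_comp (f := phi)) => //.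
  exact: continuous_measurable_fun.
have mk' : measurable_fun setT (fun z : R * R => h (z.2 * phi z.1)).
  apply: (measurableT_comp (f := h)); first exact: continuous_measurable_fun.
  apply: measurable_funM => //; apply: (measurableT_comp (f := phi)) => //.
  exact: continuous_measurable_fun.
have [i1 E1] : igr setT (fun t => G t * \int[mu_]_p (a' p * h (t * phi p))) /\
    \int[mu_]_t (G t * \int[mu_]_p (a' p * h (t * phi p))) =
    \int[mu_]_p (a' p * \int[mu_]_t (G t * h (t * phi p))).
  exact: (fubini_kernel _ _ (fun z => h (z.1 * phi z.2)) iG ia' mk (fun z => h1 _)).
have i2 : igr setT (fun p => a' p * \int[mu_]_t (G t * h (t * phi p))).
  exact: (fubini_kernel _ _ (fun z => h (z.2 * phi z.1)) ia' iG mk' (fun z => h1 _)).1.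
have inA t : \int[mu_]_p (a' p * h (t * phi p)) =
    \int[mu_]_(p in `]p1, p2]) (a p * h (t * phi p)).
  rewrite [RHS]Rintegral_mkcond; apply: eq_Rintegral => p _.
  by rewrite aE !patchE; case: ifPn => // _; rewrite mul0r.
have inG p : \int[mu_]_t (G t * h (t * phi p)) = e ^- 2 * kk (phi p).
  rewrite -kkE mulrA mulVf ?mul1r ?gt_eqF ?exprn_gt0//.
  rewrite [RHS]Rintegral_mkcond; apply: eq_Rintegral => t _.
  by rewrite GE !patchE; case: ifPn => // _; rewrite mul0r.
have i3 : igr `]0, +oo[ (fun t => gam e t * \int[mu_]_(p in `]p1, p2]) (a p * h (t * phi p))).
  apply: eq_igr (igrS `]0, +oo[ measurableT _ _ i1) => // t t0.
  by rewrite inA GE patchE mem_set.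
have i4 : igr `]p1, p2] (fun p => a p * kk (phi p)).
  have := igrZ _ (e ^+ 2) _ (measurable_itv _) (igrS `]p1, p2] measurableT (measurable_itv _)
    (@subsetT _ _) i2).
  apply: eq_igr => // p pI; rewrite inG aE patchE mem_set//.
  by field.
have L1 : \int[mu_]_(t in `]0, +oo[) (gam e t * \int[mu_]_(p in `]p1, p2]) (a p * h (t * phi p))) =
    \int[mu_]_t (G t * \int[mu_]_p (a' p * h (t * phi p))).
  rewrite [LHS]Rintegral_mkcond; apply: eq_Rintegral => t _.
  by rewrite inA GE !patchE; case: ifPn => // _; rewrite mul0r.
have L2 : \int[mu_]_(p in `]p1, p2]) (a p * kk (phi p)) =
    \int[mu_]_p (e ^+ 2 * (a' p * \int[mu_]_t (G t * h (t * phi p)))).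
  rewrite [LHS]Rintegral_mkcond; apply: eq_Rintegral => p _.
  rewrite inG aE !patchE; case: ifPn => _; last by rewrite mul0r mulr0.
  by field.
split; [exact: i3|exact: i4|].
by rewrite L1 E1 L2 (RintegralZl _ measurableT i2).
Qed.

Lemma ksinE e z : 0 < e -> e ^+ 2 * \int[mu_]_(t in `]0, +oo[) (gam e t * sin (t * z)) = ksin e z.
Proof. by move=> e0; rewrite gam_sin// /ksin; ring. Qed.

Lemma kcosE e z : 0 < e -> e ^+ 2 * \int[mu_]_(t in `]0, +oo[) (gam e t * cos (t * z)) = kcos e z.
Proof. by move=> e0; rewrite gam_cos// /kcos; ring. Qed.

Let lor (e y : R) := e ^+ 2 / (e ^+ 2 + y ^+ 2).

Let ksin_le e y : 0 < e -> 0 < y -> `|ksin e y| <= lor e y.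
Proof.
move=> e0 y0; have D0 : 0 < e ^+ 2 + y ^+ 2 by rewrite addr_gt0// exprn_gt0.
have n0 : 0 <= 2 * e ^+ 3 * y.
  by apply: mulr_ge0; [apply: mulr_ge0 => //; exact/exprn_ge0/ltW|exact: ltW].
rewrite /ksin /lor ger0_norm; last by apply: divr_ge0 => //; exact/exprn_ge0/ltW.
rewrite ler_pdivrMr ?exprn_gt0//.
have -> : e ^+ 2 / (e ^+ 2 + y ^+ 2) * (e ^+ 2 + y ^+ 2) ^+ 2 = e ^+ 2 * (e ^+ 2 + y ^+ 2).
  by field; rewrite gt_eqF.
have -> : 2 * e ^+ 3 * y = e ^+ 2 * (2 * e * y) by ring.
apply: ler_wpM2l; first exact: sqr_ge0.
by have := sqr_ge0 (e - y); rewrite sqrrB; lra.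
Qed.

Let kcos_le e y : 0 < e -> 0 < y -> `|kcos e y| <= lor e y.
Proof.
move=> e0 y0; have D0 : 0 < e ^+ 2 + y ^+ 2 by rewrite addr_gt0// exprn_gt0.
have E2 := sqr_ge0 e; have Y2 := sqr_ge0 y.
rewrite /kcos /lor (normrM (e ^+ 2 * _)) (normrM (e ^+ 2)) normfV (ger0_norm E2).
rewrite (gtr0_norm (exprn_gt0 2 D0)).
rewrite ler_pdivrMr ?exprn_gt0//.
have -> : e ^+ 2 / (e ^+ 2 + y ^+ 2) * (e ^+ 2 + y ^+ 2) ^+ 2 = e ^+ 2 * (e ^+ 2 + y ^+ 2).
  by field; rewrite gt_eqF.
apply: ler_wpM2l => //; rewrite ler_norml; lra.
Qed.

(* Any exponent between mu and mu + 1, at most 2, would do: eta exceeds mu, and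
   the error terms, of size (p - p1)^(mu - eta), remain integrable. *)
Let eta := mu + 2^-1.

(** Both averages are bounded by lor, which is at most
    min(1, (sig / s)^(2k) / c^2), hence at most a multiple of any power of sig / s of exponent
      between 0 and 2. *)
Let lor_le (s y sig : R) : 0 < sig -> 0 < s -> c * s ^+ k <= y ->
  lor (sig ^+ k) y <= (1 + c ^- 2) * (sig `^ eta * s `^ (- eta)).
Proof.
move=> sg0 s0 cy.
have y0 : 0 < y by apply: lt_le_trans cy; rewrite mulr_gt0// exprn_gt0.
have e0 : 0 < sig ^+ k by rewrite exprn_gt0.
have D0 : 0 < (sig ^+ k) ^+ 2 + y ^+ 2 by rewrite addr_gt0// exprn_gt0.
have eta0 : 0 < eta by rewrite /eta addr_gt0// invr_gt0.
have E : sig `^ eta * s `^ (- eta) = (sig / s) `^ eta.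
  rewrite powRM ?(ltW sg0) ?invr_ge0 ?(ltW s0)//; congr (_ * _).
  by rewrite -[s^-1](powR_inv1 (ltW s0)) -powRrM mulN1r.
rewrite E; have r0 : 0 < sig / s by rewrite divr_gt0.
have c20 : 0 < c ^- 2 by rewrite invr_gt0 exprn_gt0.
have [r1|r1] := leP 1 (sig / s).
  apply: (@le_trans _ _ (1 * 1)).
    by rewrite mulr1 /lor ler_pdivrMr// mul1r lerDl sqr_ge0.
  apply: ler_pM => //; first by rewrite lerDl ltW.
  apply: (@le_trans _ _ (1 `^ eta)); first by rewrite powR1.
  by apply: ge0_ler_powR; rewrite ?nnegrE ?(ltW eta0) ?(ltW r0).
apply: (@le_trans _ _ (c ^- 2 * (sig / s) ^+ 2)); last first.
  apply: ler_pM; rewrite ?(ltW c20) ?sqr_ge0//; first by rewrite lerDr.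
  rewrite -(powR_mulrn 2 (ltW r0)); apply: ger_powR; first by rewrite r0 ltW.
  by rewrite /eta; move: mu1; lra.
apply: (@le_trans _ _ ((sig ^+ k) ^+ 2 / (c * s ^+ k) ^+ 2)).
  apply: ler_wpM2l; first exact: sqr_ge0.
  rewrite lef_pV2 ?posrE ?exprn_gt0 ?mulr_gt0 ?exprn_gt0//.
  apply: (@le_trans _ _ (y ^+ 2)); last by rewrite lerDr sqr_ge0.
  by apply: lerXn2r => //; rewrite nnegrE ltW ?mulr_gt0 ?exprn_gt0.
have -> : (sig ^+ k) ^+ 2 / (c * s ^+ k) ^+ 2 = c ^- 2 * ((sig / s) ^+ k) ^+ 2.
  rewrite expr_div_n; field; rewrite (gt_eqF c0) /= expf_neq0//.
  by rewrite gt_eqF.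
apply: ler_wpM2l; first exact: ltW.
have q1 : (sig / s) ^+ k <= sig / s.
  by rewrite -[leRHS]expr1; apply: ler_wiXn2l => //; exact: ltW.
by apply: lerXn2r => //; rewrite nnegrE ?exprn_ge0// ltW.
Qed.

(** Only p - p1 in (sig/2, sig] is kept, where phi is comparable to sig^k and the
    kernel is bounded below. *)
Let main_lower (sig : R) : 0 < sig -> sig <= p2 - p1 ->
  igr `]p1, p2] (fun p => w p * ksin (sig ^+ k) (phi p)) ->
  (c / 2 ^+ k) / (1 + C ^+ 2) ^+ 2 * sig `^ mu <=
  \int[mu_]_(p in `]p1, p2]) (w p * ksin (sig ^+ k) (phi p)).
Proof.
move=> sg0 sgb ik.
set q := (c / 2 ^+ k) / (1 + C ^+ 2) ^+ 2.
have q0 : 0 < q by rewrite divr_gt0 ?divr_gt0 ?exprn_gt0 ?ltr_pwDl ?sqr_ge0.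
pose a := p1 + sig / 2; pose b := p1 + sig.
have sub : `]a, b] `<=` `]p1, p2].
  by move=> p /=; rewrite /a /b !in_itv/= => /andP[h1 h2]; apply/andP; split; lra.
have e0 : 0 < sig ^+ k by rewrite exprn_gt0.
have kge0 p : p1 < p <= p2 -> 0 <= w p * ksin (sig ^+ k) (phi p).
  move=> h; apply: mulr_ge0; first exact: powR_ge0.
  apply: divr_ge0; last exact: sqr_ge0.
  by apply: mulr_ge0; [apply: mulr_ge0 => //; exact/exprn_ge0/ltW|exact/ltW/phi_gt0].
have low p : a < p <= b -> 2 * q * sig `^ (mu - 1) <= w p * ksin (sig ^+ k) (phi p).
  rewrite /a /b => /andP[ap pb].
  have pp : p1 < p <= p2 by apply/andP; split; lra.
  rewrite mulrC; apply: ler_pM; rewrite ?powR_ge0//.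
  - by rewrite mulr_ge0// ltW.
  - by apply: pow_antitone; rewrite ?subr_gt0 ?subr_le0//; lra.
  have y1 : (c / 2 ^+ k) * sig ^+ k <= phi p.
    apply: le_trans (phic p pp); rewrite -mulrA [_^-1 * _]mulrC -expr_div_n.
    by apply: ler_wpM2l; [exact: ltW|apply: lerXn2r; rewrite ?nnegrE; lra].
  have y2 : phi p <= C * sig ^+ k.
    apply: le_trans (phiC p pp) _.
    by apply: ler_wpM2l; [exact: ltW|apply: lerXn2r; rewrite ?nnegrE; lra].
  have y0 := phi_gt0 p pp.
  move: (sig ^+ k) (phi p) e0 y0 y1 y2 => e y e0 y0 y1 y2.
  have D0 : 0 < e ^+ 2 + y ^+ 2 by rewrite addr_gt0// exprn_gt0.
  rewrite /ksin ler_pdivlMr ?exprn_gt0//.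
  have D1 : e ^+ 2 + y ^+ 2 <= (1 + C ^+ 2) * e ^+ 2.
    rewrite mulrDl mul1r lerD2l -exprMn; apply: lerXn2r => //; rewrite nnegrE ?ltW//.
    by rewrite mulr_gt0.
  have D2 : (e ^+ 2 + y ^+ 2) ^+ 2 <= (1 + C ^+ 2) ^+ 2 * e ^+ 4.
    rewrite (_ : (1 + C ^+ 2) ^+ 2 * e ^+ 4 = ((1 + C ^+ 2) * e ^+ 2) ^+ 2); last by ring.
    apply: lerXn2r => //; rewrite nnegrE ltW//.
    by rewrite mulr_gt0 ?exprn_gt0 ?ltr_pwDl ?sqr_ge0.
  apply: (@le_trans _ _ (2 * q * ((1 + C ^+ 2) ^+ 2 * e ^+ 4))).
    by apply: ler_wpM2l => //; rewrite mulr_ge0// ltW.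
  have -> : 2 * q * ((1 + C ^+ 2) ^+ 2 * e ^+ 4) = 2 * e ^+ 3 * (c / 2 ^+ k * e).
    have n1 : 1 + C ^+ 2 != 0 by rewrite gt_eqF// ltr_pwDl// sqr_ge0.
    have n2 : 2 ^+ k != 0 :> R by rewrite expf_neq0.
    by rewrite /q; field; rewrite ?n1 ?n2.
  by apply: ler_wpM2l => //; rewrite mulr_ge0// exprn_ge0// ltW.
have ab : a <= b by rewrite /a /b; lra.
have h1 : q * sig `^ mu <= \int[mu_]_(p in `]a, b]) (w p * ksin (sig ^+ k) (phi p)).
  apply: (@le_trans _ _ (\int[mu_]_(p in `]a, b]) (2 * q * sig `^ (mu - 1)))).
    have ab' : a < b by rewrite /a /b; lra.
    have mE : lebesgue_measure (`]a, b]%classic : set R) = (b - a)%:E.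
      by rewrite lebesgue_measure_itv/= lte_fin ab'.
    rewrite Rintegral_cst// [fine _](_ : _ = b - a); last exact: (congr1 fine mE).
    rewrite (_ : b - a = sig / 2); last by rewrite /a /b; field.
    rewrite -(mulr_powRB1 (ltW sg0) mu0).
    by rewrite le_eqVlt; apply/orP; left; apply/eqP; field.
  apply: le_Rintegral => //.
  - apply: measurable_bounded_integrable => //; last exact: bounded_cst.
    have : (lebesgue_measure (`]a, b]%classic : set R) < +oo)%E.
      by rewrite lebesgue_measure_itv/=; case: ifP => // _; rewrite -EFinD ltry.
    by [].
  - exact: igrS ik.
apply: le_trans h1 _.
by apply: le_integral_sub => // p /=; rewrite in_itv/=; exact: kge0.
Qed.

(** Compare two evaluations of the same time average.  The exponent gamma is
    first lowered to s, with k s = mu + rho and 0 < rho <= 1/2, so that s < 2 and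
    t^(-s) is integrable against the average; the assumed bound then holds for
    all t > 0. *)
Lemma osc_sin_optimal (gamma D : R) : mu < k%:R * gamma ->
  ~ (forall t, 1 <= t -> `|osc_sin t| <= D * t `^ (- gamma)).
Proof.
move=> kg HD.
have kR0 : 0 < k%:R :> R by rewrite ltr0n.
have kR1 : 1 <= k%:R :> R by rewrite ler1n.
pose rho := Num.min (k%:R * gamma - mu) 2^-1.
have rho0 : 0 < rho by rewrite lt_min subr_gt0 kg invr_gt0 ltr0n.
have rho2 : rho <= 2^-1 by rewrite ge_min lexx orbT.
pose s := (mu + rho) / k%:R.
have ks : k%:R * s = mu + rho by rewrite /s mulrC divfK// gt_eqF.
have s0 : 0 < s by rewrite divr_gt0// addr_gt0.
have sg : s <= gamma.
  by rewrite -(ler_pM2l kR0) ks -lerBrDl ge_min lexx.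
have s2 : s < 2.
  have : s <= k%:R * s by rewrite ler_peMl// ltW.
  by rewrite ks; move: mu1 rho2; lra.
have iAs t := igrk _ _ t (@continuous_sin R) (@sin_max R) iA.
have iBc t := igrk _ _ t (@continuous_cos R) (@cos_max R) iB.
pose J0 := \int[mu_]_(p in `]p1, p2]) (`|w p * A p| + `|w p * B p|).
have iJ0 : igr `]p1, p2] (fun p => `|w p * A p| + `|w p * B p|).
  by apply: igrD => //; exact: igr_norm.
have JJ0 t : `|osc_sin t| <= J0.
  apply: le_norm_integral => //; first exact: igrD.
  by move=> p _; apply: trig_comb_le; [exact: sin_max|exact: cos_max].
have J00 : 0 <= J0 by exact: le_trans (JJ0 0).
pose D2 := `|D| + J0.
have D20 : 0 <= D2 by exact: addr_ge0.
have bd t : 0 < t -> `|osc_sin t| <= D2 * t `^ (- s).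
  move=> t0; have [t1|t1] := leP 1 t.
    apply: le_trans (HD t t1) _.
    apply: (@le_trans _ _ (`|D| * t `^ (- gamma))).
      by apply: ler_wpM2r; [exact: powR_ge0|exact: ler_norm].
    apply: ler_pM; rewrite ?powR_ge0//; first by rewrite lerDl.
    by apply: ler_powR => //; rewrite lerN2.
  apply: le_trans (JJ0 t) _; rewrite -[leLHS]mulr1; apply: ler_pM => //.
    by rewrite lerDr.
  apply: (@le_trans _ _ (1 `^ (- s))); first by rewrite powR1.
  apply: pow_antitone => //; first exact: ltW.
  by rewrite oppr_le0 ltW.
pose D3 := D2 * ((2 - s)^-1 + 1).
have D30 : 0 <= D3 by rewrite mulr_ge0// addr_ge0// invr_ge0 subr_ge0 ltW.
pose D4 := 2 * K * (1 + c ^- 2) * ((p2 - p1) `^ 2^-1 / 2^-1).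
have D40 : 0 <= D4.
  apply: mulr_ge0; last by rewrite divr_ge0 ?powR_ge0.
  apply: mulr_ge0; first by rewrite mulr_ge0.
  by rewrite addr_ge0// invr_ge0 sqr_ge0.
pose q := (c / 2 ^+ k) / (1 + C ^+ 2) ^+ 2.
have q0 : 0 < q by rewrite divr_gt0 ?divr_gt0 ?exprn_gt0 ?ltr_pwDl ?sqr_ge0.
have key sig : 0 < sig -> sig <= 1 -> sig <= p2 - p1 ->
    A0 * q <= (D3 + D4) * sig `^ rho.
  move=> sg0 sg1 sgb; have e0 : 0 < sig ^+ k by rewrite exprn_gt0.
  set e := sig ^+ k in e0.
  have [a1 a2 a3] := average _ _ _ e e0 (@continuous_sin R) (@sin_max R)
    (fun z => ksinE e z e0) iA.
  have [b1 b2 b3] := average _ _ _ e e0 (@continuous_cos R) (@cos_max R)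
    (fun z => kcosE e z e0) iB.
  have [_ w2 _] := average _ _ _ e e0 (@continuous_sin R) (@sin_max R)
    (fun z => ksinE e z e0) (pow_igr p1 p2 mu mu0).
  pose S := \int[mu_]_(p in `]p1, p2]) (w p * A p * ksin e (phi p)) +
            \int[mu_]_(p in `]p1, p2]) (w p * B p * kcos e (phi p)).
  have up : `|S| <= D3 * sig `^ (mu + rho).
    have -> : S = e ^+ 2 * \int[mu_]_(t in `]0, +oo[) (gam e t * osc_sin t).
      rewrite /S -a3 -b3 -mulrDr -RintegralD//; congr (_ * _).
      apply: eq_Rintegral => t _; rewrite -mulrDr; congr (_ * _).
      by rewrite /osc_sin RintegralD.
    have [g1 g2] := gam_pow_le e s e0 (introT andP (conj s0 s2)).
    have iM : igr `]0, +oo[ (fun t => gam e t * osc_sin t).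
      have := igrD _ _ _ (measurable_itv _) a1 b1; apply: eq_igr => // t _.
      by rewrite -mulrDr /osc_sin RintegralD.
    rewrite normrM ger0_norm; last exact: sqr_ge0.
    have b4 : `|\int[mu_]_(t in `]0, +oo[) (gam e t * osc_sin t)| <=
        D2 * (((2 - s)^-1 + 1) * e `^ (s - 2)).
      apply: (@le_trans _ _ (\int[mu_]_(t in `]0, +oo[) (D2 * (gam e t * t `^ (- s))))).
        apply: le_norm_integral => //; first exact: igrZ.
        move=> t /=; rewrite in_itv/= andbT => t0.
        have gt0 : 0 <= gam e t by rewrite mulr_ge0 ?expR_ge0// ltW.
        rewrite (normrM (gam e t)) (ger0_norm gt0) mulrCA.
        by apply: ler_wpM2l => //; exact: bd.
      by rewrite (RintegralZl D2 _ g1)//; apply: ler_wpM2l.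
    apply: le_trans (ler_wpM2l (sqr_ge0 e) b4) _.
    have -> : sig `^ (mu + rho) = e ^+ 2 * e `^ (s - 2).
      rewrite -(powR_mulrn 2 (ltW e0)) -powRD; last by rewrite (gt_eqF e0) implybT.
      have -> : 2%:R + (s - 2) = s by ring.
      by rewrite -ks powRrM (powR_mulrn k (ltW sg0)).
    by rewrite le_eqVlt; apply/orP; left; apply/eqP; rewrite /D3; ring.
  pose E p := w p * A p * ksin e (phi p) - A0 * (w p * ksin e (phi p)) +
    w p * B p * kcos e (phi p).
  have iE : igr `]p1, p2] E.
    by apply: igrD => //; apply: igrB => //; exact: igrZ.
  have SE : S = A0 * \int[mu_]_(p in `]p1, p2]) (w p * ksin e (phi p)) +
      \int[mu_]_(p in `]p1, p2]) E p.
    have iw2 := igrZ _ A0 _ (measurable_itv `]p1, p2]) w2.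
    have iAB := igrB _ _ _ (measurable_itv `]p1, p2]) a2 iw2.
    rewrite (RintegralD _ iAB b2)// (RintegralB _ a2 iw2)// (RintegralZl A0 _ w2)//.
    by rewrite /S; ring.
  have err : `|\int[mu_]_(p in `]p1, p2]) E p| <= D4 * sig `^ eta.
    have ih : igr `]p1, p2] (fun p => (p - p1) `^ (2^-1 - 1)) by apply: pow_igr; rewrite invr_gt0.
    pose cc := 2 * K * (1 + c ^- 2) * sig `^ eta.
    apply: (@le_trans _ _ (\int[mu_]_(p in `]p1, p2]) (cc * (p - p1) `^ (2^-1 - 1)))).
      apply: le_norm_integral => //; first exact: igrZ.
      move=> p /=; rewrite in_itv/= => pI; have y0 := phi_gt0 p pI.
      have h0 : 0 < p - p1 by rewrite subr_gt0; case/andP: pI.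
      have l1 := lor_le _ _ sig sg0 h0 (phic p pI).
      have ks1 := le_trans (ksin_le e _ e0 y0) l1; have kc1 := le_trans (kcos_le e _ e0 y0) l1.
      have -> : E p = w p * ((A p - A0) * ksin e (phi p) + B p * kcos e (phi p)).
        by rewrite /E; ring.
      have w0 : 0 <= w p by exact: powR_ge0.
      rewrite normrM (ger0_norm w0).
      set l := (1 + c ^- 2) * _ in ks1 kc1.
      have t1 : `|(A p - A0) * ksin e (phi p) + B p * kcos e (phi p)| <= 2 * (K * (p - p1) * l).
        rewrite (le_trans (ler_normD _ _))// mulr_natl mulr2n.
        rewrite (normrM (A p - A0)) (normrM (B p)).
        by apply: lerD; apply: ler_pM => //; [exact: AK|exact: BK].
      apply: le_trans (ler_wpM2l w0 t1) _.
      have -> : (p - p1) `^ (2^-1 - 1) = w p * (p - p1) * (p - p1) `^ (- eta).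
        rewrite /w [_ `^ (mu - 1) * _]mulrC (mulr_powRB1 (ltW h0) mu0).
        rewrite -powRD; last by rewrite (gt_eqF h0) implybT.
        by congr (_ `^ _); rewrite /eta; field.
      by rewrite le_eqVlt; apply/orP; left; apply/eqP; rewrite /cc /l; ring.
    rewrite (RintegralZl cc _ ih)// pow_int ?invr_gt0 ?(ltW p12)//.
    by rewrite le_eqVlt; apply/orP; left; apply/eqP; rewrite /cc /D4; ring.
  have low := main_lower sig sg0 sgb w2.
  have low' : A0 * (q * sig `^ mu) <= D3 * sig `^ (mu + rho) + D4 * sig `^ eta.
    apply: le_trans (ler_wpM2l (ltW A00) low) _.
    have -> : A0 * \int[mu_]_(p in `]p1, p2]) (w p * ksin e (phi p)) =
      S - \int[mu_]_(p in `]p1, p2]) E p by rewrite SE addrK.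
    apply: le_trans (ler_norm _) _; apply: le_trans (ler_normB _ _) _.
    exact: lerD.
  have pe : sig `^ eta <= sig `^ (mu + rho).
    by apply: ger_powR; rewrite ?sg0//= /eta lerD2l.
  have sm : 0 < sig `^ mu by exact: powR_gt0.
  have E3 : (D3 + D4) * sig `^ rho * sig `^ mu = (D3 + D4) * sig `^ (mu + rho).
    rewrite [mu + rho]addrC powRD; last by rewrite (gt_eqF sg0) implybT.
    by rewrite mulrA.
  rewrite -(ler_pM2r sm) E3 -(mulrA A0); apply: le_trans low' _; rewrite mulrDl lerD2l.
  exact: ler_wpM2l.
pose T := D3 + D4 + 1.
have T0 : 0 < T by rewrite ltr_wpDl// addr_ge0.
pose v := A0 * q / (2 * T).
have v0 : 0 < v by apply: divr_gt0; exact: mulr_gt0.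
pose sig := Num.min (Num.min 1 (p2 - p1)) (v `^ rho^-1).
have sig0 : 0 < sig by rewrite !lt_min ltr01 subr_gt0 p12 powR_gt0.
have sv : sig `^ rho <= v.
  have -> : v = (v `^ rho^-1) `^ rho by rewrite -powRrM mulVf ?gt_eqF// powRr1// ltW.
  apply: ge0_ler_powR; rewrite ?nnegrE ?(ltW rho0) ?(ltW sig0) ?powR_ge0//.
  by rewrite ge_min lexx orbT.
have := key sig sig0; rewrite /sig !ge_min !lexx !orbT/= -/sig => /(_ isT isT).
apply/negP; rewrite -ltNge.
apply: (@le_lt_trans _ _ (T * v)).
  apply: ler_pM; rewrite ?powR_ge0//; first exact: addr_ge0.
  by rewrite /T lerDl.
have -> : T * v = A0 * q / 2 by rewrite /v; field; rewrite gt_eqF.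
have : 0 < A0 * q by exact: mulr_gt0.
by lra.
Qed.

End Optimality.

(** * Sup and L1 norms on an interval *)

Section Norms.
Context {R : realType}.
Notation mu := (@lebesgue_measure R).

Lemma within_bounded (h : R -> R) (a b : R) : a <= b -> {within `[a, b], continuous h} ->
  exists M, forall x, a <= x <= b -> `|h x| <= M.
Proof.
move=> ab ch; have cn : {within `[a, b], continuous (fun x => `|h x|)}.
  by apply: (within_comp _ (fun x => `|x|)) => //; exact: cts_norm.
have [c _ H] := EVT_max ab cn; exists `|h c| => x xab.
by apply: H; rewrite in_itv.
Qed.

(** A value above the essential supremum would persist on a neighbourhood,
    which has positive measure. *)
Lemma Linf_bound (g : R -> R[i]) (a b : R) : a < b ->
  {within `[a, b], continuous (re_fun g)} -> {within `[a, b], continuous (im_fun g)} ->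
  forall x, a <= x <= b -> cmod (re_fun g x +i* im_fun g x) <= Linf_norm a b g.
Proof.
move=> ab c1 c2; have cm := within_cmod _ _ _ c1 c2.
apply: (closed_bound _ _ _ _ ab cm).
have [M HM] := within_bounded _ _ _ (ltW ab) cm.
pose F : R -> \bar R := (fun x => (cmod (g x))%:E) \_ `]a, b[.
have lenI (u v : R) : u < v -> mu (`]u, v[%classic : set R) = (v - u)%:E.
  by move=> uv; rewrite lebesgue_measure_itv/= lte_fin uv.
have muT : (0 < mu setT)%E.
  apply: (@lt_le_trans _ _ (mu (`]0, 1[%classic : set R))).
    by rewrite lenI// lte_fin subr0.
  by apply: le_measure; rewrite ?inE.
have M0 : 0 <= M by apply: le_trans (HM a _) => //; rewrite lexx ltW.
have F0 x : (`|F x|)%E = F x.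
  by rewrite gee0_abs// /F patchE; case: ifP => // _; rewrite lee_fin cmod_ge0.
have FM x : (`|F x| <= M%:E)%E.
  rewrite F0 /F patchE; case: ifPn => [/set_mem/=|_]; last by rewrite lee_fin.
  rewrite in_itv/= lee_fin => /andP[/ltW ax /ltW xb].
  by apply: le_trans (HM x _); [exact: ler_norm|rewrite ax].
set S := ess_sup mu (abse \o F).
have LE : Linf_norm a b g = fine S by rewrite /Linf_norm unlock muT.
have S1 : (S <= M%:E)%E by apply/ess_supP; apply: aeW => x; exact: FM.
have S2 : (0 <= S)%E.
  by apply: ess_sup_gee => //; apply: aeW => x; exact: abse_ge0.
have Sfin : S \is a fin_num.
  by rewrite fin_numElt (lt_le_trans _ S2)// (le_lt_trans S1)// ltry.
move=> x /andP[ax xb]; rewrite LE leNgt; apply/negP => Lx.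
have [cmi _ _] := (continuous_within_itvP _ ab).1 cm.
have xI : x \in `]a, b[ by rewrite in_itv/= ax.
have near1 : \forall y \near x, fine S < cmod (re_fun g y +i* im_fun g y).
  exact: (cvgr_gt _ (cmi x xI) _ Lx).
have near2 : \forall y \near x, y \in `]a, b[.
  by apply: near_in_itvoo.
have [r /= r0 rB] := (@nbhs_ballP R R x _).1 (filterI near1 near2).
have [N [mN muN sN]] := ess_sup_ge mu (abse \o F).
have sub : `]x - r, x + r[ `<=` N.
  move=> y /=; rewrite in_itv/= => yr; apply: sN => /=.
  have [] := rB y; first by rewrite /ball/= ltr_distlC; case/andP: yr => -> ->.
  move=> H1 H2; apply/negP; rewrite -ltNge F0 /F patchE mem_set//.
  by rewrite -/S -(fineK Sfin) lte_fin.
have : (mu (`](x - r)%R, (x + r)%R[%classic : set R) <= mu N)%E by apply: le_measure; rewrite ?inE.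
rewrite lenI ?muN ?lee_fin; last by lra.
by rewrite leNgt => /negP; apply; lra.
Qed.

Lemma L1_normE (g : R -> R[i]) (d e : R -> R) (a b : R) : a < b ->
  {within `[a, b], continuous d} -> {within `[a, b], continuous e} ->
  (forall x, a < x < b -> d x = derive1 (re_fun g) x) ->
  (forall x, a < x < b -> e x = derive1 (im_fun g) x) ->
  L1_norm a b (cderiven 1 g) = \int[mu]_(x in `[a, b]) cmod (d x +i* e x).
Proof.
move=> ab cd ce dE eE; have cm := within_cmod _ _ _ cd ce.
have im := seg_igr _ _ _ cm.
rewrite /L1_norm Lnorm1 -Rintegral_itv_obnd_cbnd; last first.
  by apply: igrS im => // x /=; rewrite !in_itv/= => /andP[/ltW -> ->].
rewrite -Rintegral_itv_bndo_bndc; last first.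
  by apply: igrS im => // x /=; rewrite !in_itv/= => /andP[/ltW -> /ltW ->].
rewrite Rintegral_mkcond /Rintegral; congr fine; apply: eq_integral => x _.
rewrite !patchE; case: ifPn => [/set_mem/=|_]; last by rewrite abse0.
rewrite in_itv/= => xab; rewrite ger0_norm ?cmod_ge0//.
by rewrite dE// eE// /cderiven !derive1n1.
Qed.

End Norms.

(** * Integrals of functions supported in a segment *)

Section Support.
Context {R : realType}.
Notation mu := (@lebesgue_measure R).

(** The hypotheses leave h(p1) arbitrary; a single point does not affect
    integrals. *)
Lemma supp_int (p1 p2 : R) (h : R -> R) : p1 < p2 -> (forall p, p \notin `[p1, p2] -> h p = 0) ->
  igr `]p1, p2] h ->
  igr setT h /\ \int[mu]_p h p = \int[mu]_(p in `]p1, p2]) h p.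
Proof.
move=> p12 h0 ih.
have i1 : igr setT (h \_ `]p1, p2]) by exact: igr_patch.
have ic : igr [set p1] (fun _ : R => h p1).
  apply: measurable_bounded_integrable => //.
    have : lebesgue_measure ([set p1] : set R) = 0%E by exact: lebesgue_measure_set1.
    by move=> E; have : (lebesgue_measure ([set p1] : set R) < +oo)%E by rewrite E.
  exact: bounded_cst.
have i2 : igr setT ((fun _ : R => h p1) \_ [set p1]) by exact: igr_patch.
have hE p : (h \_ `]p1, p2]) p + ((fun _ : R => h p1) \_ [set p1]) p = h p.
  rewrite !patchE; case: ifPn => [/set_mem/=|].
    rewrite in_itv/= => /andP[pp _]; rewrite ifF ?addr0//; apply/negP => /set_mem/= E.
    by move: pp; rewrite E ltxx.
  move=> /negP nI; rewrite add0r; case: ifPn => [/set_mem/= ->//|/negP n1].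
  apply/esym/h0; apply/negP; rewrite in_itv/= le_eqVlt => /andP[/predU1P[pE|pp] pb].
    by apply: n1; rewrite inE/= pE.
  by apply: nI; rewrite inE/= in_itv/= pp.
have iT : igr setT h.
  by have := igrD _ _ _ measurableT i1 i2; apply: eq_igr => // p _; exact: hE.
split=> //; rewrite Rintegral_itv_obnd_cbnd// [RHS]Rintegral_mkcond.
apply: eq_Rintegral => p _; rewrite patchE; case: ifPn => // /negP nI.
by apply: h0; apply/negP => pI; apply: nI; rewrite inE.
Qed.

(** The modulus of z is the real part of its product with conj(z) / |z|. *)
Lemma cmod_le_of_rotations (z : R[i]) (B : R) : 0 <= B ->
  (forall c s : R, c ^+ 2 + s ^+ 2 = 1 -> c * complex.Re z - s * complex.Im z <= B) ->
  cmod z <= B.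
Proof.
move=> B0 H; have [->//|z0] := eqVneq (cmod z) 0.
have c0 : 0 < cmod z by rewrite lt_def z0 cmod_ge0.
have := H (complex.Re z / cmod z) (- complex.Im z / cmod z).
have -> : (complex.Re z / cmod z) ^+ 2 + (- complex.Im z / cmod z) ^+ 2 = 1.
  by rewrite !expr_div_n sqrrN -mulrDl -cmod_sqr divff// expf_neq0.
move=> /(_ erefl); rewrite (_ : _ - _ = cmod z)//.
have -> : complex.Re z / cmod z * complex.Re z - - complex.Im z / cmod z * complex.Im z =
   (complex.Re z ^+ 2 + complex.Im z ^+ 2) / cmod z by ring.
by rewrite -cmod_sqr expr2 mulfK.
Qed.

End Support.

(** * The dispersive solution *)

Section Solution.
Context {R : realType}.
Notation mu_ := (@lebesgue_measure R).
Variables (f : R -> R) (mu p1 p2 : R) (uhat ut : R -> R[i]).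
Hypothesis f_smooth : smooth f.
Hypothesis f_growth : forall n : nat, poly_growth (derive1n n f).
Hypothesis f_convex : forall p : R, 0 < derive1n 2 f p.
Hypothesis mu0 : 0 < mu.
Hypothesis mu1 : mu <= 1.
Hypothesis p12 : p1 < p2.
Hypothesis C1 : condition_C1 p1 p2 mu uhat ut.

Let ur := re_fun ut.
Let ui := im_fun ut.
Let w (p : R) : R := (p - p1) `^ (mu - 1).

Lemma symbol_multf (I : Type) : multf (fun _ : I => f).
Proof.
move=> n; apply: Ck_of_derive1n => [k|k _ x]; last exact: f_smooth.
by have [C [N H]] := f_growth k; exists C, N => _ x; exact: H.
Qed.

Let df x : isd f x (derive1 f x).
Proof. by apply: isd_derivable; exact: (f_smooth 0%N). Qed.

Let ddf x : isd (derive1 f) x (derive1n 2 f x).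
Proof. by apply: isd_derivable; exact: (f_smooth 1%N). Qed.

Let cf2 : continuous (derive1n 2 f).
Proof. by move=> x; apply: isd_continuous; apply: isd_derivable; exact: (f_smooth 2%N). Qed.

Let cf : continuous f. Proof. by move=> x; exact: isd_continuous (df x). Qed.

Lemma derive1_increasing x y : x < y -> derive1 f x < derive1 f y.
Proof.
move=> xy; rewrite -subr_gt0.
have cdf : continuous (derive1 f) by move=> z; exact: isd_continuous (ddf z).
have [z _ ->] := MVT xy (fun z _ => ddf z) (within_cts _ _ cdf).
by rewrite mulr_gt0// subr_gt0.
Qed.

Lemma min_f2_le x : p1 <= x <= p2 -> min_f2 f p1 p2 <= derive1n 2 f x.
Proof.
move=> xI; apply: ge_inf; first by exists 0 => _ [y _ <-]; exact/ltW.
by exists x => //=; rewrite in_itv.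
Qed.

Lemma min_f2_gt0 : 0 < min_f2 f p1 p2.
Proof.
have [c _ H] := EVT_min (ltW p12) (within_cts `[p1, p2] _ cf2).
apply: (lt_le_trans (f_convex c)); apply: lb_le_inf.
  by exists (derive1n 2 f p1), p1 => //=; rewrite in_itv/= lexx ltW.
by move=> _ [y yI <-]; exact: H.
Qed.

Let wu_igr (v : R -> R) : {within `[p1, p2], continuous v} -> igr `]p1, p2] (fun p => w p * v p).
Proof.
move=> cv; have [M HM] := within_bounded _ _ _ (ltW p12) cv.
apply: (igrMb _ _ _ M) => //; first exact: pow_igr.
  apply: subspace_continuous_measurable_fun => //.
  by apply: withinS cv => x /=; rewrite !in_itv/= => /andP[/ltW -> ->].
by move=> p /=; rewrite in_itv/= => /andP[/ltW a b]; apply: HM; rewrite a.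
Qed.

Let cur : {within `[p1, p2], continuous ur}. Proof. by case: C1 => _ _ [[]]. Qed.
Let cui : {within `[p1, p2], continuous ui}. Proof. by case: C1 => _ _ [_ []]. Qed.

Let uhat0 p : p \notin `[p1, p2] -> uhat p = 0. Proof. by case: C1 => + _ _ _; exact. Qed.
Let uhatE p : p1 < p <= p2 -> uhat p = (w p)%:C * ut p.
Proof. by move=> pI; case: C1 => _ + _ _; apply; rewrite in_itv. Qed.

Lemma uhat_cigr : cigr uhat.
Proof.
split.
  apply: (supp_int p1 p2 _ p12 _ _).1; first by move=> p /uhat0; rewrite /re_fun => ->.
  apply: eq_igr (wu_igr _ cur) => // p /=; rewrite in_itv/= => pI.
  by rewrite /ur /re_fun uhatE// ReM /= mul0r subr0.
apply: (supp_int p1 p2 _ p12 _ _).1; first by move=> p /uhat0; rewrite /im_fun => ->.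
apply: eq_igr (wu_igr _ cui) => // p /=; rewrite in_itv/= => pI.
by rewrite /ui /im_fun uhatE// ImM /= mul0r addr0.
Qed.

Lemma rotated_integral (c s : R) (g : R -> R) : continuous g ->
  c * complex.Re (cintegral (fun p => uhat p * cis (g p))) -
  s * complex.Im (cintegral (fun p => uhat p * cis (g p))) =
  \int[mu_]_(p in `]p1, p2]) (w p * (c * ur p - s * ui p) * cos (g p) -
     w p * (c * ui p + s * ur p) * sin (g p)).
Proof.
move=> cg; have [i1 i2] := cigr_cis _ _ uhat_cigr cg.
rewrite /= -(RintegralZl c _ i1)// -(RintegralZl s _ i2)//.
have j1 := igrZ _ c _ measurableT i1; have j2 := igrZ _ s _ measurableT i2.
rewrite -(RintegralB _ j1 j2)//.
have j := igrB _ _ _ measurableT j1 j2.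
rewrite (supp_int p1 p2 _ p12 _ (igrS _ _ _ _ j)).2//; last first.
  by move=> p /uhat0; rewrite /re_fun /im_fun => ->; rewrite !mul0r /=; ring.
apply: eq_Rintegral => p; rewrite inE/= in_itv/= => pI.
by rewrite /re_fun /im_fun uhatE// !RIE /= /ur /ui /re_fun /im_fun; ring.
Qed.

Lemma solution_formula (u0 : distr R) (u : R -> distr R) :
  eq_distr (distr_fourier u0) (distr_of_fun uhat) -> solution f u0 u ->
  forall t : R, 0 <= t -> eq_distr (u t) (distr_of_fun (uf f uhat t)).
Proof.
move=> u0_hat sol t t0 phi /schwartz_csch sphi.
have schi : csch (fun _ : unit => ifourier phi) := csch_ifourier _ sphi.
have spsi := csch_phase f symbol_multf _ (- t) schi.
have := evolution f u0 u symbol_multf sol _ t spsi t0.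
have -> : (fun p => cis (t * f p) * (cis (- t * f p) * ifourier phi p)) = ifourier phi.
  by apply/funext => p; rewrite mulrA -cisD mulNr subrr cis0 mul1r.
rewrite ifourierK// => ->.
have := u0_hat _ (csch_schwartz _ tt spsi); rewrite /distr_fourier => ->.
rewrite /distr_of_fun.
have cm : continuous (fun p : R => - t * f p) by exact: ctsZ.
have := ifourier_swap _ _ (cigr_cis _ _ uhat_cigr cm) (csch_cigr _ tt sphi).
have -> : (fun p => uhat p * cis (- t * f p) * ifourier phi p) =
   fun p => uhat p * (cis (- t * f p) * ifourier phi p).
  by apply/funext => p; rewrite mulrA.
move=> ->; congr cintegral; apply/funext => x; congr (_ * _).
rewrite /ifourier /uf; congr (_ * cintegral _); apply/funext => p.
by rewrite -mulrA -cisD addrC mulNr.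
Qed.

Section Bounds.
Let L := Linf_norm p1 p2 ut.
Let N1 := L1_norm p1 p2 (cderiven 1 ut).

Let uL x : p1 <= x <= p2 -> cmod (ur x +i* ui x) <= L.
Proof. exact: Linf_bound. Qed.

Let L0 : 0 <= L.
Proof. by apply: le_trans (uL p1 _); rewrite ?cmod_ge0// lexx ltW. Qed.

(** Multiplying by c + i s with c^2 + s^2 = 1 preserves both norms of the regular
    factor, so a bound for real parts that only depends on these norms bounds the
    modulus. *)
Lemma uf_bound (B t x : R) : 0 <= B ->
  (forall vr vi dr di : R -> R,
    {within `[p1, p2], continuous vr} -> {within `[p1, p2], continuous vi} ->
    {within `[p1, p2], continuous dr} -> {within `[p1, p2], continuous di} ->
    (forall y, p1 < y < p2 -> isd vr y (dr y)) ->
    (forall y, p1 < y < p2 -> isd vi y (di y)) ->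
    (forall y, p1 <= y <= p2 -> cmod (vr y +i* vi y) <= L) ->
    \int[mu_]_(y in `[p1, p2]) cmod (dr y +i* di y) <= N1 ->
    `|\int[mu_]_(p in `]p1, p2]) osc p1 mu vr vi (fun p => x * p - t * f p) p| <= B) ->
  cmod (uf f uhat t x) <= (2 * pi)^-1 * B.
Proof.
move=> B0 H; rewrite /uf cmodM cmod_real ger0_norm; last first.
  by rewrite invr_ge0 mulr_ge0// pi_ge0.
apply: ler_wpM2l; first by rewrite invr_ge0 mulr_ge0// pi_ge0.
have cg : continuous (fun p : R => x * p - t * f p).
  by apply: ctsD; [apply: ctsZ; exact: cts_id|apply: ctsN; exact: ctsZ].
apply: cmod_le_of_rotations => // c s cs.
rewrite rotated_integral//; apply: le_trans (ler_norm _) _.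
have [_ _ [[_ der [dr [cdr drE]]] [_ dei [di [cdi diE]]]] _] := C1.
have unit : cmod (c +i* s) = 1 by rewrite /cmod /= cs sqrtr1.
apply: (H (fun p => c * ur p - s * ui p) (fun p => c * ui p + s * ur p)
  (fun p => c * dr p - s * di p) (fun p => c * di p + s * dr p)).
- by apply: withinB; exact: withinZ.
- by apply: withinD; exact: withinZ.
- by apply: withinB; exact: withinZ.
- by apply: withinD; exact: withinZ.
- move=> y yI; have yI' : y \in `]p1, p2[ by rewrite in_itv.
  by apply: isdB; apply: isdZ; rewrite (drE, diE)//; apply: isd_derivable; [exact: der|exact: dei].
- move=> y yI; have yI' : y \in `]p1, p2[ by rewrite in_itv.
  by apply: isdD; apply: isdZ; rewrite (drE, diE)//; apply: isd_derivable; [exact: dei|exact: der].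
- move=> y yI; have -> : (c * ur y - s * ui y) +i* (c * ui y + s * ur y) = (c +i* s) *
  (ur y +i* ui y).
    by apply: eqRI; rewrite !RIE /=; ring.
  by rewrite cmodM unit mul1r; exact: uL.
- rewrite /N1 (L1_normE ut dr di)//.
  rewrite le_eqVlt; apply/orP; left; apply/eqP; apply: eq_Rintegral => y _.
  have -> : (c * dr y - s * di y) +i* (c * di y + s * dr y) = (c +i* s) * (dr y +i* di y).
    by apply: eqRI; rewrite !RIE /=; ring.
  by rewrite cmodM unit mul1r.
Qed.

Let N10 : 0 <= N1.
Proof. by rewrite /N1 /L1_norm fine_ge0// Lnorm_ge0. Qed.

Let dphase t x y : isd (fun p => x * p - t * f p) y (x - t * derive1 f y).
Proof.
apply: isd_eq; first by apply: isdB; apply: isdZ; [exact: isd_id|exact: df].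
by rewrite mulr1.
Qed.

Let ddphase t x y : isd (fun p => x - t * derive1 f p) y (- t * derive1n 2 f y).
Proof.
apply: isd_eq; first by apply: isdB; [exact: isd_cst|apply: isdZ; exact: ddf].
by rewrite sub0r mulNr.
Qed.

Let cddphase t : continuous (fun y => - t * derive1n 2 f y).
Proof. exact: ctsZ. Qed.

(** Taking d = t^(-1/2) makes both contributions of
    [osc_stationary] of order t^(-mu/2). *)
Lemma uniform_decay (t x : R) : 0 < t ->
  cmod (uf f uhat t x) <= c_cone f mu p1 p2 ut * t `^ (- (mu / 2)).
Proof.
move=> t0; have m0 := min_f2_gt0; set m := min_f2 f p1 p2 in m0.
pose d := t `^ (- 2^-1); have d0 : 0 < d by exact: powR_gt0.
have tm0 : 0 < t * m by rewrite mulr_gt0.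
have dmu : d `^ mu = t `^ (- (mu / 2)).
  by rewrite /d -powRrM; congr (_ `^ _); ring.
have d2 : d * d = t^-1.
  rewrite /d -powRD; last by rewrite (gt_eqF t0) implybT.
  rewrite -[t^-1](powR_inv1 (ltW t0)); congr (_ `^ _); lra.
pose B := 3 * (L * (d `^ mu / mu)) + 2 * (d `^ (mu - 1) * ((4 * L + N1) / (t * m * d))).
have dmu1 : d `^ (mu - 1) = d `^ mu / d.
  by rewrite powRB ?(gt_eqF d0) ?implybT// powRr1// ltW.
have -> : c_cone f mu p1 p2 ut * t `^ (- (mu / 2)) = (2 * pi)^-1 * B.
  rewrite /c_cone -/L -/N1 -/m /B dmu1 dmu.
  move: (t `^ _) => e; rewrite (_ : (t * m * d) = m * (t * d)); last by ring.
  have -> : e / d * ((4 * L + N1) / (m * (t * d))) = e * (4 * L + N1) / m / (t * (d * d)).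
    by field; rewrite !gt_eqF.
  rewrite d2 mulfV ?gt_eqF// divr1; clearbody m.
  have p0 : pi != 0 :> R by rewrite gt_eqF// pi_gt0.
  by move: p0; move: (pi : R) => z z0; field; rewrite z0 !gt_eqF.
have LN : 0 <= 4 * L + N1 by rewrite addr_ge0// mulr_ge0.
have tmd0 : 0 < t * m * d by rewrite mulr_gt0.
apply: uf_bound.
  apply: addr_ge0; apply: mulr_ge0 => //.
    by apply: mulr_ge0 => //; apply: divr_ge0; [exact: powR_ge0|exact: ltW].
  by apply: mulr_ge0; [exact: powR_ge0|apply: divr_ge0 => //; exact: ltW].
move=> vr vi dr di cvr cvi cdr cdi dvr dvi vL dN.
have g2l y : p1 <= y <= p2 -> - t * derive1n 2 f y <= - (t * m).
  move=> yI; rewrite mulNr lerN2; apply: ler_wpM2l; first exact: ltW.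
  exact: min_f2_le.
have g20 y : p1 <= y <= p2 -> - t * derive1n 2 f y <= 0.
  by move=> /g2l /le_trans; apply; rewrite oppr_le0 ltW.
have [p0 p0I [gr gl]] := stationary_point p1 p2 p12 _ _ (ddphase t x) (t * m) tm0 g2l.
exact: (osc_stationary p1 p2 mu L N1 vr vi dr di p12 mu0 mu1 cvr cvi cdr cdi dvr dvi vL dN
  _ _ _ (dphase t x) (ddphase t x) (cddphase t) g20 d (t * m) p0).
Qed.

(** For a given (t, x) only one of the two summands of the constant is used,
    according to the side of the cone on which (t, x) lies. *)
Lemma outer_decay (q1 q2 t x : R) : q1 < p1 -> p2 < q2 -> 0 < t ->
  x / t <= derive1 f q1 \/ derive1 f q2 <= x / t ->
  cmod (uf f uhat t x) <= c_compl f mu p1 p2 q1 q2 ut * t `^ (- mu).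
Proof.
move=> q1p1 p2q2 t0 xt.
pose m1 := derive1 f p1 - derive1 f q1; pose m2 := derive1 f q2 - derive1 f p2.
have m10 : 0 < m1 by rewrite subr_gt0 derive1_increasing.
have m20 : 0 < m2 by rewrite subr_gt0 derive1_increasing.
have LN : 0 <= 4 * L + N1 by rewrite addr_ge0// mulr_ge0.
have mono y z : y <= z -> derive1 f y <= derive1 f z.
  by rewrite le_eqVlt => /predU1P[->//|/derive1_increasing/ltW].
pose d := t^-1; have d0 : 0 < d by rewrite invr_gt0.
pose S (m : R) := L * (d `^ mu / mu) + d `^ (mu - 1) * ((4 * L + N1) / (t * m)).
have S0 m : 0 < m -> 0 <= S m.
  move=> m0; apply: addr_ge0.
    by apply: mulr_ge0 => //; apply: divr_ge0; [exact: powR_ge0|exact: ltW].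
  by apply: mulr_ge0; [exact: powR_ge0|apply: divr_ge0 => //; rewrite mulr_ge0// ltW].
have dmu : d `^ mu = t `^ (- mu).
  by rewrite /d -powR_inv1 ?(ltW t0)// -powRrM mulN1r.
have dmu1 : d `^ (mu - 1) = d `^ mu / d.
  by rewrite powRB ?(gt_eqF d0) ?implybT// powRr1// ltW.
have -> : c_compl f mu p1 p2 q1 q2 ut * t `^ (- mu) = (2 * pi)^-1 * S m1 + (2 * pi)^-1 * S m2.
  rewrite /c_compl -/L -/N1 -/m1 -/m2 /S dmu1 dmu /d; clearbody m1 m2.
  have p0 : pi != 0 :> R by rewrite gt_eqF// pi_gt0.
  by move: p0; move: (pi : R) => z z0; field; rewrite z0 !gt_eqF.
have pi0 : 0 <= (2 * pi)^-1 :> R by rewrite invr_ge0 mulr_ge0// pi_ge0.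
have g20 y : p1 <= y <= p2 -> - t * derive1n 2 f y <= 0.
  by move=> _; rewrite mulNr oppr_le0 mulr_ge0// ltW.
have main m : 0 < m ->
    (forall y, p1 <= y <= p2 -> t * m <= x - t * derive1 f y) \/
    (forall y, p1 <= y <= p2 -> x - t * derive1 f y <= - (t * m)) ->
    cmod (uf f uhat t x) <= (2 * pi)^-1 * S m.
  move=> m0 sgn; apply: uf_bound; first exact: S0.
  move=> vr vi dr di cvr cvi cdr cdi dvr dvi vL dN.
  apply: (osc_nonstationary p1 p2 mu L N1 vr vi dr di p12 mu0 mu1 cvr cvi cdr cdi dvr dvi vL dN
    _ _ _ (dphase t x) (ddphase t x) (cddphase t) g20 d (t * m)) => //.
  exact: mulr_gt0.
case: xt => xt.
  apply: (@le_trans _ _ ((2 * pi)^-1 * S m1)); last by rewrite lerDl mulr_ge0// S0.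
  apply: main => //; right=> y /andP[yI _].
  have := mono _ _ yI; have xt' : x <= t * derive1 f q1 by rewrite mulrC -ler_pdivrMr.
  move=> h; have := ler_wpM2l (ltW t0) h; rewrite /m1 mulrBr; lra.
apply: (@le_trans _ _ ((2 * pi)^-1 * S m2)); last by rewrite lerDr mulr_ge0// S0.
apply: main => //; left=> y /andP[_ yI].
have := mono _ _ yI; have xt' : t * derive1 f q2 <= x by rewrite mulrC -ler_pdivlMr.
move=> h; have := ler_wpM2l (ltW t0) h; rewrite /m2 mulrBr; lra.
Qed.

End Bounds.

Section Sharp.
Let lip_seg (v d : R -> R) : {within `[p1, p2], continuous v} ->
  {within `[p1, p2], continuous d} -> (forall x, p1 < x < p2 -> isd v x (d x)) ->
  exists2 M, 0 <= M & forall p, p1 < p <= p2 -> `|v p - v p1| <= M * (p - p1).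
Proof.
move=> cv cd dv; have [M HM] := within_bounded _ _ _ (ltW p12) cd.
have M0 : 0 <= M by apply: le_trans (HM p1 _) => //; rewrite lexx ltW.
exists M => // p /andP[pp pb].
have dv' y : y \in `]p1, p[ -> is_derive y 1 v (d y).
  rewrite in_itv/= => /andP[a b]; apply: dv; rewrite a.
  exact: lt_le_trans b pb.
have cv' : {within `[p1, p], continuous v}.
  apply: withinS cv => y /=; rewrite !in_itv/= => /andP[-> b].
  exact: le_trans b pb.
have [y + ->] := MVT pp dv' cv'.
rewrite in_itv/= => /andP[a b].
have pp' : 0 <= p - p1 by rewrite subr_ge0 ltW.
rewrite normrM [`|p - p1|]ger0_norm//; apply: ler_wpM2r => //.
by apply: HM; rewrite (ltW a) (ltW (lt_le_trans b pb)).
Qed.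

(** On the ray x = v t the phase is t (sg phi + kap).  Multiplying the solution by
    the conjugate of ut(p1) and by e^{-i t kap} makes the amplitude at p1 the positive
    number |ut(p1)|^2, changing the size by a constant factor only, and sg times the imaginary
    part is the integral of [osc_sin_optimal]. *)
Lemma ray_sharp (k : nat) (sg v kap c C gamma D : R) (phi : R -> R) :
  (0 < k)%N -> 0 < c -> sg = 1 \/ sg = -1 ->
  (forall p, v * p - f p = sg * phi p + kap) ->
  (forall p, p1 < p <= p2 -> c * (p - p1) ^+ k <= phi p) ->
  (forall p, p1 < p <= p2 -> phi p <= C * (p - p1) ^+ k) ->
  mu < k%:R * gamma ->
  ~ (forall t, 1 <= t -> cmod (uf f uhat t (v * t)) <= D * t `^ (- gamma)).
Proof.
move=> k0 c0 sgE phE phic phiC kg H.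
have [_ _ [[_ der [dr [cdr drE]]] [_ dei [di [cdi diE]]]] un0] := C1.
have sg2 : sg * sg = 1 by case: sgE => ->; rewrite ?mulr1// mulrNN mulr1.
have cphi : continuous phi.
  have -> : phi = fun p => sg * (v * p - f p - kap).
    by apply/funext => p; rewrite phE addrK mulrA sg2 mul1r.
  apply: ctsZ; apply: ctsD; last exact: cts_cst.
  by apply: ctsD; [apply: ctsZ; exact: cts_id|exact: ctsN].
have dur x : p1 < x < p2 -> isd ur x (dr x).
  move=> xI; have xI' : x \in `]p1, p2[ by rewrite in_itv.
  by rewrite drE//; apply: isd_derivable; exact: der.
have dui x : p1 < x < p2 -> isd ui x (di x).
  move=> xI; have xI' : x \in `]p1, p2[ by rewrite in_itv.
  by rewrite diE//; apply: isd_derivable; exact: dei.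
have [Mr Mr0 HMr] := lip_seg ur dr cur cdr dur.
have [Mi Mi0 HMi] := lip_seg ui di cui cdi dui.
pose r1 := ur p1; pose i1 := ui p1.
pose A p := r1 * ur p + i1 * ui p.
pose B p := sg * (r1 * ui p - i1 * ur p).
pose A0 := r1 ^+ 2 + i1 ^+ 2.
have A00 : 0 < A0.
  rewrite lt_def addr_ge0 ?sqr_ge0// andbT; apply/negP => /eqP E; apply: un0.
  have : r1 == 0 /\ i1 == 0.
    by move: E => /eqP; rewrite paddr_eq0 ?sqr_ge0// !sqrf_eq0 => /andP[].
  by move=> [/eqP h1 /eqP h2]; apply: eqRI.
pose K := (`|r1| + `|i1|) * (Mr + Mi).
have lin (a b : R) p : p1 < p <= p2 -> `|a * (ur p - r1) + b * (ui p - i1)| <= (`|a| + `|b|) *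
  (Mr + Mi) * (p - p1).
  move=> pI; have pp : 0 <= p - p1 by rewrite subr_ge0 ltW//; case/andP: pI.
  apply: le_trans (ler_normD _ _) _; rewrite !normrM.
  have e1 := ler_wpM2l (normr_ge0 a) (HMr p pI).
  have e2 := ler_wpM2l (normr_ge0 b) (HMi p pI).
  have e3 : 0 <= `|a| * Mi * (p - p1) by apply: mulr_ge0 => //; exact: mulr_ge0.
  have e4 : 0 <= `|b| * Mr * (p - p1) by apply: mulr_ge0 => //; exact: mulr_ge0.
  by apply: le_trans (lerD e1 e2) _; lra.
have AK p : p1 < p <= p2 -> `|A p - A0| <= K * (p - p1).
  move=> pI; have -> : A p - A0 = r1 * (ur p - r1) + i1 * (ui p - i1).
    by rewrite /A /A0; ring.
  exact: lin.
have BK p : p1 < p <= p2 -> `|B p| <= K * (p - p1).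
  move=> pI; have -> : B p = (- sg * i1) * (ur p - r1) + (sg * r1) * (ui p - i1).
    by rewrite /B; ring.
  have -> : K = (`|- sg * i1| + `|sg * r1|) * (Mr + Mi).
    have s1 : `|sg| = 1 by case: sgE => ->; rewrite ?normrN1 ?normr1.
    by rewrite !normrM normrN s1 !mul1r /K [`|r1| + _]addrC.
  exact: lin.
have cA : {within `[p1, p2], continuous A} by apply: withinD; exact: withinZ.
have cB : {within `[p1, p2], continuous B} by apply: withinZ; apply: withinB; exact: withinZ.
have iA := wu_igr _ cA; have iB := wu_igr _ cB.
have sinsg y : sin (sg * y) = sg * sin y by case: sgE => ->; rewrite ?mul1r// !mulN1r sinN.
have cossg y : cos (sg * y) = cos y by case: sgE => ->; rewrite ?mul1r// mulN1r cosN.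
apply: (osc_sin_optimal p1 p2 mu c C K A0 k A B phi p12 mu0 mu1 k0 c0 A00 cphi
  phic phiC AK BK iA iB gamma (cmod (r1 +i* - i1) * (2 * pi) * D) kg) => t t1.
have cg : continuous (fun p : R => v * t * p - t * f p).
  by apply: ctsD; [apply: ctsZ; exact: cts_id|apply: ctsN; exact: ctsZ].
have cm := fun cc s => rotated_integral cc s _ cg.
set Z := cintegral (fun p => uhat p * cis (v * t * p - t * f p)) in cm.
pose zz := (r1 +i* - i1) * cis (- (t * kap)).
have E : osc_sin p1 p2 mu A B phi t = sg * complex.Im (zz * Z).
  rewrite ImM -[complex.Re zz * _]opprK -mulNr [- _ + _]addrC.
  have := cm (complex.Im zz) (- complex.Re zz); rewrite mulNr opprK => ->.
  rewrite -RintegralZl//; last first.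
    have [j1 j2] := cigr_cis _ _ uhat_cigr cg.
    have := igrD _ _ _ measurableT (igrZ _ (complex.Im zz) _ measurableT j1)
      (igrZ _ (complex.Re zz) _ measurableT j2).
    move=> /(igrS `]p1, p2] measurableT (measurable_itv _) (@subsetT _ _)).
    apply: eq_igr => // p /=; rewrite in_itv/= => pI.
    by rewrite /re_fun /im_fun uhatE// !RIE /= /ur /ui /re_fun /im_fun; ring.
  apply: eq_Rintegral => p _.
  have phE' : v * t * p - t * f p = sg * (t * phi p) + t * kap.
    have -> : v * t * p - t * f p = t * (v * p - f p) by ring.
    by rewrite phE; ring.
  rewrite phE' cosD sinD sinsg cossg /zz !RIE /= cosN sinN.
  have cs := cos2Dsin2 (t * kap).
  move: (cos (t * kap)) (sin (t * kap)) cs => ck sk cs.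
  rewrite /A /B.
  rewrite -/(w p); move: (w p) => W.
  by case: sgE => ->; rewrite -[LHS]mulr1 -[X in _ * X = _]cs; ring.
rewrite E normrM; have -> : `|sg| = 1 by case: sgE => ->; rewrite ?normrN1 ?normr1.
rewrite mul1r; apply: le_trans (Im_le_cmod _) _; rewrite cmodM /zz cmodM.
have -> : cmod (cis (- (t * kap))) = 1 by rewrite /cmod /= cos2Dsin2 sqrtr1.
rewrite mulr1 -!mulrA; apply: ler_wpM2l; first exact: cmod_ge0.
have := H t t1; rewrite /uf cmodM cmod_real -/Z ger0_norm; last first.
  by rewrite invr_ge0 mulr_ge0// pi_ge0.
rewrite ler_pdivrMl; last by rewrite mulr_gt0// pi_gt0.
by rewrite !mulrA.
Qed.

Let mvt (g dg : R -> R) (a b : R) : a < b -> (forall x, isd g x (dg x)) ->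
  exists2 c, a < c < b & g b - g a = dg c * (b - a).
Proof.
move=> ab dgE; have cg : continuous g by move=> x; exact: isd_continuous (dgE x).
have [c + E] := MVT ab (fun x _ => dgE x) (within_cts _ _ cg).
by rewrite in_itv/= => cI; exists c.
Qed.

(** The ray on which the stationary frequency is the singular one, p1; phi is the
    remainder of the first order Taylor expansion of f at p1. *)
Lemma inner_ray_sharp (gamma D : R) : mu / 2 < gamma ->
  ~ (forall t, 1 <= t ->
       cmod (uf f uhat t (derive1 f p1 * t)) <= D * t `^ (- gamma)).
Proof.
move=> hg; set m := min_f2 f p1 p2.
have m0 : 0 < m by exact: min_f2_gt0.
have [M HM] := within_bounded _ _ _ (ltW p12) (within_cts `[p1, p2] _ cf2).
apply: (ray_sharp 2 (-1) (derive1 f p1) (derive1 f p1 * p1 - f p1) (m / 2) M gamma D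
  (fun p => f p - f p1 - derive1 f p1 * (p - p1))) => //.
- by rewrite divr_gt0.
- by right.
- by move=> p; ring.
- move=> p /andP[pp pb].
  pose g q := f q - derive1 f p1 * q - m / 2 * (q - p1) ^+ 2.
  have dg q : isd g q (derive1 f q - derive1 f p1 - m * (q - p1)).
    rewrite /g; apply: isd_eq.
      apply: isdB; first by apply: isdB; [exact: df|apply: isdZ; exact: isd_id].
      by apply: isdZ; apply: isdM; (apply: isdB; [exact: isd_id|exact: isd_cst]).
    by rewrite /=; field.
  have [c /andP[pc cp] gE] := mvt _ _ _ _ pp dg.
  have [e /andP[pe ec] fE] := mvt _ _ _ _ pc ddf.
  have eI : p1 <= e <= p2 by rewrite (ltW pe) (ltW (lt_le_trans (lt_trans ec cp) pb)).
  have : 0 <= g p - g p1.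
    rewrite gE; apply: mulr_ge0; last by rewrite subr_ge0 ltW.
    rewrite fE -mulrBl; apply: mulr_ge0; last by rewrite subr_ge0 ltW.
    by rewrite subr_ge0 min_f2_le.
  by rewrite /g subrr expr0n/= mulr0; lra.
- move=> p /andP[pp pb].
  have [c /andP[pc cp] gE] := mvt _ _ _ _ pp df.
  have [e /andP[pe ec] fE] := mvt _ _ _ _ pc ddf.
  have eI : p1 <= e <= p2 by rewrite (ltW pe) (ltW (lt_le_trans (lt_trans ec cp) pb)).
  have M0 : 0 <= M by apply: le_trans (HM _ eI); exact: normr_ge0.
  rewrite gE -mulrBl fE expr2 mulrA; apply: ler_wpM2r; first by rewrite subr_ge0 ltW.
  apply: (@le_trans _ _ (M * (c - p1))).
    apply: ler_wpM2r; first by rewrite subr_ge0 ltW.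
    by apply: le_trans (HM _ eI); exact: ler_norm.
  by apply: ler_wpM2l => //; rewrite lerD2r ltW.
- lra.
Qed.

(** The boundary ray of the cone at q2, where phi has a nonvanishing derivative
    on [p1, p2]. *)
Lemma outer_ray_sharp (q2 gamma D : R) : p2 < q2 -> mu < gamma ->
  ~ (forall t, 1 <= t ->
       cmod (uf f uhat t (derive1 f q2 * t)) <= D * t `^ (- gamma)).
Proof.
move=> p2q2 hg; set v := derive1 f q2.
have c0 : 0 < v - derive1 f p2 by rewrite subr_gt0 derive1_increasing.
apply: (ray_sharp 1 1 v (v * p1 - f p1) (v - derive1 f p2) (v - derive1 f p1) gamma D
  (fun p => v * (p - p1) - (f p - f p1))) => //.
- by left.
- by move=> p; ring.
- move=> p /andP[pp pb]; have [c /andP[pc cp] ->] := mvt _ _ _ _ pp df.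
  rewrite expr1 -mulrBl; apply: ler_wpM2r; first by rewrite subr_ge0 ltW.
  by rewrite lerD2l lerN2 ltW// derive1_increasing// (lt_le_trans cp).
- move=> p /andP[pp pb]; have [c /andP[pc cp] ->] := mvt _ _ _ _ pp df.
  rewrite expr1 -mulrBl; apply: ler_wpM2r; first by rewrite subr_ge0 ltW.
  by rewrite lerD2l lerN2 ltW// derive1_increasing.
- by rewrite mul1r.
Qed.

End Sharp.

End Solution.

Theorem theorem2p3 (R : realType) (f : R -> R) (mu p1 p2 q1 q2 : R)
    (u0 : distr R) (uhat ut : R -> R[i]) (u : R -> distr R)
    (f_smooth : smooth f)
    (f_growth : forall n : nat, poly_growth (derive1n n f))
    (f_convex : forall p : R, 0 < derive1n 2 f p)
    (mu01 : 0 < mu <= 1)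
    (p12 : p1 < p2)
    (u0_tempered : tempered u0)
    (u0_hat : eq_distr (distr_fourier u0) (distr_of_fun uhat))
    (u0_C1 : condition_C1 p1 p2 mu uhat ut)
    (q1p1 : q1 < p1) (p2q2 : p2 < q2)
    (u_sol : solution f u0 u) :
  (forall t : R, 0 <= t -> eq_distr (u t) (distr_of_fun (uf f uhat t))) /\
  [/\ 0 < min_f2 f p1 p2, 0 < derive1 f q2 - derive1 f p2
    & 0 < derive1 f p1 - derive1 f q1] /\
  (forall t x : R, cone f q1 q2 (t, x) ->
     cmod (uf f uhat t x) <= c_cone f mu p1 p2 ut * t `^ (- (mu / 2))) /\
  (forall t x : R, cone_compl f q1 q2 (t, x) ->
     cmod (uf f uhat t x) <= c_compl f mu p1 p2 q1 q2 ut * t `^ (- mu)) /\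
  (~ exists gamma C : R, [/\ mu / 2 < gamma, 0 < C &
       forall t x : R, cone f q1 q2 (t, x) -> 1 <= t ->
         cmod (uf f uhat t x) <= C * t `^ (- gamma)]) /\
  (~ exists gamma C : R, [/\ mu < gamma, 0 < C &
       forall t x : R, cone_compl f q1 q2 (t, x) -> 1 <= t ->
         cmod (uf f uhat t x) <= C * t `^ (- gamma)]).
Proof.
have [mu0 mu1] := andP mu01.
have incr := derive1_increasing f f_smooth f_convex.
split; first exact: (solution_formula f mu p1 p2 uhat ut f_smooth f_growth mu0 p12 u0_C1 u0 u).
split.
  by split; [exact: min_f2_gt0|rewrite subr_gt0 incr|rewrite subr_gt0 incr].
split.
  by move=> t x [/= t0 _]; exact: (uniform_decay f mu p1 p2).
split.
  move=> t x [/= t0 ncone]; apply: (outer_decay f mu p1 p2) => //.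
  have [?|lo] := leP (x / t) (derive1 f q1); first by left.
  have [?|hi] := leP (derive1 f q2) (x / t); first by right.
  by case: ncone; split=> //=; rewrite lo.
have ray v t : 1 <= t -> 0 < t /\ v * t / t = v :> R.
  by move=> t1; have t0 := lt_le_trans ltr01 t1; rewrite mulfK// gt_eqF.
split=> -[gamma [C [hg _ H]]].
  apply: (inner_ray_sharp f mu p1 p2 uhat ut f_smooth f_convex mu0 mu1 p12 u0_C1 gamma C hg)
    => // t t1.
  have [t0 E] := ray (derive1 f p1) t t1.
  apply: H => //; split=> //=; rewrite E incr//=.
  exact: incr (lt_trans p12 p2q2).
apply: (outer_ray_sharp f mu p1 p2 uhat ut f_smooth f_convex mu0 mu1 p12 u0_C1 q2 gamma C p2q2
  hg) => // t t1.
have [t0 E] := ray (derive1 f q2) t t1.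
by apply: H => //; split=> //= -[_ /=]; rewrite E ltxx andbF.
Qed.
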